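(* Let $M>1$ and $M_1,M_2>0$ be constants. Suppose that $sn^{-1}\log p\le1/4$ and $2\le s\le p^c$ for some constant $c<1/2$. Then for any $\alpha\in(0,1/4)$ and any positive integer $s_1\le s/2$, we have $$\inf_{\mathcal{CI}_\alpha\in\mathcal{C}_\alpha(\Theta(s))}\ \sup_{\theta\in\Theta(s_1)}\mathbb{E}_\theta\,\mathrm{diam}(\mathcal{CI}_\alpha)\asymp n^{-1/2}+sn^{-1}\log p.$$
   Context: Model: for each $n$ (with $p=p_n$, $s=s_n$ and $s_1=s_{1,n}$ allowed to depend on $n$), the data $\mathbf{D}=\{(y_i,Z_i,\mathbf{W}_i)\}_{i=1}^n$ are i.i.d. with $Z_i\in\mathbb{R}$, $\mathbf{W}_i\in\mathbb{R}^{p-1}$, $\mathbf{X}_i=(Z_i,\mathbf{W}_i^\top)^\top\sim\mathcal{N}_p(0,\boldsymbol{\Sigma})$, $y_i=Z_i\beta+\mathbf{W}_i^\top\boldsymbol{\gamma}+\varepsilon_i$, $\varepsilon_i\sim\mathcal{N}(0,\sigma^2)$ independent of $\mathbf{X}_i$. The law is indexed by $\theta=(\beta,\boldsymbol{\gamma},\boldsymbol{\Sigma},\sigma)$; $\boldsymbol{\beta}=(\beta,\boldsymbol{\gamma}^\top)^\top$; $\boldsymbol{\Omega}=\boldsymbol{\Sigma}^{-1}$ with first row $\boldsymbol{\Omega}_{1,}$; $\|\cdot\|_0$ counts non-zero entries. Parameter spaces: $\Theta$ is the set of $\theta=(\beta,\boldsymbol{\gamma},\boldsymbol{\Sigma},\sigma)$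 with $\beta\in\mathbb{R}$, $M^{-1}\le\lambda_{\min}(\boldsymbol{\Sigma})\le\lambda_{\max}(\boldsymbol{\Sigma})\le M$, $\boldsymbol{\Sigma}_{(-1),(-1)}=\mathbb{I}_{p-1}$ ($\boldsymbol{\Sigma}$ with first row and column removed is the identity), $0\le\sigma\le M_1$, $\|\boldsymbol{\beta}\|_2\le M_2$; and for $s_0>0$, $\Theta(s_0)=\{\theta\in\Theta:\|\boldsymbol{\Omega}_{1,}\|_0\le s_0\}$. Confidence intervals: $\mathcal{C}_\alpha(\Theta_1)$ is the set of all random intervals $[l(\mathbf{D}),u(\mathbf{D})]$ computed from the data with $\inf_{\theta\in\Theta_1}\mathbb{P}_\theta(l(\mathbf{D})\le\beta\le u(\mathbf{D}))\ge1-\alpha$; $\mathrm{diam}$ denotes the length of an interval. Notation: $a_n\asymp b_n$ means that $a_n\le Cb_n$ and $b_n\le Ca_n$ for a positive constant $C$ independent of $n$. *)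

(* Defs.v *)
From HB Require Import structures.
From mathcomp Require Import all_boot all_order all_algebra.
From mathcomp Require Import all_classical all_reals all_analysis.

Set Implicit Arguments.
Unset Strict Implicit.
Unset Printing Implicit Defensive.

Import Order.TTheory GRing.Theory Num.Theory.
Import numFieldNormedType.Exports.

Local Open Scope classical_set_scope.
Local Open Scope ring_scope.

(* Dimensions: [d] is the dimension of W, so that p = 1 + d; index 0 of a
   vector or matrix of size 1 + d is the coordinate of Z. *)

Section model.
Context {R : realType}.

Record param (d : nat) := Param {
  beta : R;
  gamma : 'cV[R]_d;
  Sigma : 'M[R]_(1 + d);
  sigma : R }.

(* One observation (y, (Z, W)). *)
Definition obs (d : nat) := (R * (R * d.-tuple R))%type.

Definition obs_y d (o : obs d) : R := o.1.
Definition obs_Z d (o : obs d) : R := o.2.1.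
Definition obs_W d (o : obs d) : 'cV[R]_d := \col_j tnth o.2.2 j.
Definition obs_X d (o : obs d) : 'cV[R]_(1 + d) :=
  col_mx (obs_Z o)%:M (obs_W o).

(* The noise is a function of the observation, since
   y = Z * beta + W^T gamma + eps. *)
Definition noise d (theta : param d) (o : obs d) : R :=
  obs_y o - obs_Z o * beta theta - ((obs_W o)^T *m gamma theta) 0 0.

(* N(0, tau^2), [tau >= 0] being the standard deviation. The case tau = 0 is
   the point mass at 0; [normal_prob 0 0] is not. *)
Definition centered_normal (tau : R) (B : set R) : \bar R :=
  if tau == 0 then \d_(0 : R) B else normal_prob 0 tau B.

(* The vector X has law N(0, S) under P: every linear combination a^T X has
   law N(0, a^T S a). *)
Definition gaussian_vector {disp} {T : measurableType disp}
    (P : probability T R) k (X : T -> 'cV[R]_k) (S : 'M[R]_k) : Prop :=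
  forall (a : 'cV[R]_k) (B : set R), measurable B ->
    P [set t | B ((a^T *m X t) 0 0)] =
    centered_normal (Num.sqrt ((a^T *m S *m a) 0 0)) B.

(* Law of one observation under theta. Independence of the noise and X is
   tested on measurable sets of values of X = (Z, W), seen in R * R^d. *)
Definition obs_law d (theta : param d) (P : probability (obs d) R) : Prop :=
  [/\ gaussian_vector P (@obs_X d) (Sigma theta),
      forall B : set R, measurable B ->
        P [set o | B (noise theta o)] = centered_normal (sigma theta) B
    & forall (A : set (R * d.-tuple R)) (B : set R),
        measurable A -> measurable B ->
        P [set o | A o.2 /\ B (noise theta o)] =
        (P [set o | A o.2] * P [set o | B (noise theta o)])%E].

Definition data (n d : nat) := (n.-tuple (obs d))%type.

(* Q is the law of n i.i.d. observations, each of law P. *)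
Definition iid_law n d (P : probability (obs d) R)
    (Q : probability (data n d) R) : Prop :=
  forall B : 'I_n -> set (obs d), (forall i, measurable (B i)) ->
    Q [set D | forall i, B i (tnth D i)] = (\prod_(i < n) P (B i))%E.

(* Q = P_theta. The conditions determine Q uniquely from theta. *)
Definition data_law n d (theta : param d) (Q : probability (data n d) R) :
    Prop :=
  exists2 P : probability (obs d) R, obs_law theta P & iid_law P Q.

Definition lambda_min k (S : 'M[R]_k) : R := inf [set a | eigenvalue S a].
Definition lambda_max k (S : 'M[R]_k) : R := sup [set a | eigenvalue S a].

Definition norm0 k (v : 'rV[R]_k) : nat := #|[set j | v 0 j != 0]|.
Definition norm2 k (v : 'cV[R]_k) : R := Num.sqrt (\sum_i v i 0 ^+ 2).

Definition Theta d (M M1 M2 : R) : set (param d) :=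
  [set theta | [/\ (Sigma theta)^T = Sigma theta,
    [&& M^-1 <= lambda_min (Sigma theta),
        lambda_min (Sigma theta) <= lambda_max (Sigma theta)
      & lambda_max (Sigma theta) <= M],
    drsubmx (Sigma theta) = 1%:M,
    0 <= sigma theta <= M1
  & norm2 (col_mx (beta theta)%:M (gamma theta)) <= M2]].

Definition Theta_sparse d (M M1 M2 s0 : R) : set (param d) :=
  [set theta | Theta M M1 M2 theta /\
    (norm0 (row 0 (invmx (Sigma theta))))%:R <= s0].

(* A confidence interval is the pair (l, u) of its endpoints. *)
Definition conf_intervals n d (alpha : R) (Theta1 : set (param d)) :
    set ((data n d -> R) * (data n d -> R)) :=
  [set CI : (data n d -> R) * (data n d -> R) |
    [/\ measurable_fun setT CI.1, measurable_fun setT CI.2,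
    forall D, CI.1 D <= CI.2 D
  & ((1 - alpha)%:E <= ereal_inf [set x | exists (theta : param d)
      (Q : probability (data n d) R), [/\ Theta1 theta, data_law theta Q
      & x = Q [set D | (CI.1 D <= beta theta <= CI.2 D)%R]]])%E]].

Definition max_expected_diam n d (Theta1 : set (param d))
    (CI : (data n d -> R) * (data n d -> R)) : \bar R :=
  ereal_sup [set x | exists (theta : param d)
    (Q : probability (data n d) R), [/\ Theta1 theta, data_law theta Q
    & x = (\int[Q]_D (CI.2 D - CI.1 D)%:E)%E]].

Definition minimax_diam (n d : nat) (alpha : R) (Theta0 Theta1 : set (param d)) :
    \bar R :=
  ereal_inf (max_expected_diam (n := n) Theta1 @` conf_intervals alpha Theta0).

(* a_n and b_n are of the same order, for n ranging over N. *)
Definition same_order (N : set nat) (a : nat -> \bar R) (b : nat -> R) : Prop :=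
  exists2 C : R, 0 < C & forall n, N n ->
    (a n <= (C * b n)%:E)%E /\ ((b n)%:E <= C%:E * a n)%E.

End model.

(* Main.v *)
(* Upper bound. Write eta = Cov(Z, W) and tau^2 = Var(Z) - |eta|^2. Since W is
   standard normal, Omega_1 is proportional to (1, - eta), so that eta has less
   than s nonzero entries, and beta * tau^2 = Cov(Z, y) - <eta, Cov(y, W)>.
   Both beta * tau^2 and tau^2 are thus of the form
   Cov(Z, V) - \sum_j eta_j Cov(V, W_j), with V = y and V = Z. The sample is split
   in three: the first part selects the coordinates j at which one of the
   empirical covariances with W_j exceeds a threshold of order
   sqrt(log p / n), and the other two estimate the two factors independently, so
   that the noise of the selected products adds up in L^2 only. The dropped
   coordinates of the support of eta cost O(s log p / n), the other terms
   O(n^(-1/2)). The interval is centered at the ratio of the two estimates.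

   Lower bound. Compare the law with beta = 0, gamma = 0, Sigma = 1, sigma = M1
   with a mixture of laws sharing the value b of the slope. If the chi-square
   distance of the mixture is at most 1/16, the interval contains both 0 and b
   with probability at least 1/4, and its expected length is at least |b| / 4.
   For n^(-1/2) the mixture is the single law with gamma = 0 and b of order
   n^(-1/2). For s log p / n, let v be uniform on the unit vectors with k = s / 2
   equal nonzero entries, one per block of coordinates, and let
   ((y / M1 + Z) / sqrt 2, (y / M1 - Z) / sqrt 2) be a standard normal pair whose
   first component has correlation r with <v, W>, the second one being
   independent of W, where r^2 is of order s log p / n. Then b is of order r^2,
   and the likelihood ratio is a Mehler kernel, whose second moments are
   1 / (1 - r^2 <v, v'>). *)

Require Import Defs.
From HB Require Import structures.
From mathcomp Require Import all_boot all_order all_algebra.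
From mathcomp Require Import all_classical all_reals all_analysis.
From mathcomp Require Import measurable_realfun random_variable.
From mathcomp Require Import ring lra zify.

Set Implicit Arguments.
Unset Strict Implicit.
Unset Printing Implicit Defensive.
Set SsrOldRewriteGoalsOrder.

Import Order.TTheory GRing.Theory Num.Theory.
Import numFieldNormedType.Exports HBNNSimple.

Local Open Scope classical_set_scope.
Local Open Scope ring_scope.

(** * Change of variables *)

Section measure_facts.
Local Open Scope ereal_scope.

(** A coordinate acts through a product of two covariances. If both empirical ones are below the
    threshold, the product is of order log p / n, and only the support of [eta] pays for it. The
    null law of the lower bound has Sigma = 1, so it lies in [Theta(s1)] for every s1 >= 1; this is
    why s1 is absent from the rate. In the mixture with directions the law of (y, Z) and that of W
    are kept, and only the dependence between them changes. Two random directions agree on at most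
    p^(2c - 1) blocks on average, while one agreement multiplies the second moment by at most p^(2
    c0); c < 1/2 leaves room for a positive c0. Nearly all integrands are kept nonnegative, so that
    Tonelli applies without integrability conditions. *)

Lemma ge0_integral_law d d' (T : measurableType d) (U : measurableType d')
    (R : realType) (P : {measure set T -> \bar R}) (X : T -> U)
    (nu : {measure set U -> \bar R}) (F : U -> \bar R) :
  measurable_fun [set: T] X ->
  (forall B, measurable B -> P (X @^-1` B) = nu B) ->
  measurable_fun [set: U] F -> (forall y, 0 <= F y) ->
  \int[P]_x F (X x) = \int[nu]_y F y.
Proof.
move=> mX PX mF F0.
rewrite -[LHS](ge0_integral_pushforward mX P measurableT mF (fun y _ => F0 y)).
by apply: eq_measure_integral => A mA _; rewrite /= /pushforward PX.
Qed.

(** The density is known through the measure of sets only, so the formula climbs from indicators to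
    simple functions and then to monotone limits. *)
Lemma ge0_integral_density d (T : measurableType d) (R : realType)
    (mu nu : {measure set T -> \bar R}) (g : T -> R) (F : T -> \bar R) :
  measurable_fun [set: T] g -> (forall x, (0 <= g x)%R) ->
  (forall A, measurable A -> nu A = \int[mu]_(x in A) (g x)%:E) ->
  measurable_fun [set: T] F -> (forall x, 0 <= F x) ->
  \int[nu]_x F x = \int[mu]_x (F x * (g x)%:E).
Proof.
move=> mg g0 nuE mF F0.
have mg' : measurable_fun setT (fun x => (g x)%:E) by exact/measurable_EFinP.
have indicE' A : measurable A ->
    \int[nu]_x (\1_A x)%:E = \int[mu]_x ((\1_A x)%:E * (g x)%:E).
  move=> mA; rewrite integral_indic//= setIT nuE// integral_mkcond/=.
  apply: eq_integral => x _; rewrite patchE indicE.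
  by case: ifP => _; rewrite ?mul1e ?mul0e.
have nnE (f : {nnsfun T >-> R}) :
    \int[nu]_x (f x)%:E = \int[mu]_x ((f x)%:E * (g x)%:E).
  under [LHS]eq_integral do rewrite fimfunE -fsumEFin//.
  rewrite [LHS]ge0_integral_fsum//; last 2 first.
    - by move=> r; exact/measurable_EFinP/measurableT_comp.
    - by move=> n x _; rewrite EFinM nnfun_muleindic_ge0.
  under [RHS]eq_integral => x _.
    rewrite fimfunE -fsumEFin// ge0_mule_fsuml; last first.
      by move=> r; rewrite EFinM nnfun_muleindic_ge0.
    over.
  rewrite [RHS]ge0_integral_fsum//; last 2 first.
    - move=> r; apply: emeasurable_funM => //.
      by apply/measurable_EFinP; do 2 apply/measurableT_comp => //.
    - move=> n x _; rewrite mule_ge0 ?lee_fin//.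
      by rewrite -lee_fin EFinM nnfun_muleindic_ge0.
  apply: eq_fsbigr => r _.
  have [r0|r0] := leP 0%R r.
    have mi : measurable_fun setT (fun x => (\1_(f @^-1` [set r]) x : R)%:E).
      exact/measurable_EFinP.
    under eq_integral do rewrite EFinM.
    rewrite ge0_integralZl ?lee_fin//.
    under [RHS]eq_integral do rewrite EFinM -muleA.
    rewrite indicE'// ge0_integralZl ?lee_fin//.
    - exact: emeasurable_funM.
    - by move=> x _; rewrite mule_ge0 ?lee_fin.
  rewrite !integral0_eq// => x _; rewrite preimage_nnfun0//.
    by rewrite indic0 mulr0 mul0e.
  by rewrite indic0 mulr0.
pose f_ := nnsfun_approx measurableT mF.
transitivity (lim (\int[nu]_x (f_ n x)%:E @[n --> \oo])).
  rewrite -monotone_convergence//=.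
  - apply: eq_integral => x _; apply/esym/cvg_lim => //=.
    exact: cvg_nnsfun_approx.
  - by move=> n; exact/measurable_EFinP/measurable_funTS.
  - by move=> n ? _; rewrite lee_fin.
  - by move=> ? _ ? ? mn; rewrite lee_fin; exact/lefP/nd_nnsfun_approx.
transitivity (lim (\int[mu]_x ((f_ n x)%:E * (g x)%:E) @[n --> \oo])).
  by apply: congr_lim; apply/funext => n /=; exact: nnE.
rewrite -monotone_convergence//=.
- apply: eq_integral => x _; apply/cvg_lim => //=.
  apply: cvgeZr => //; exact: cvg_nnsfun_approx.
- by move=> n; apply: emeasurable_funM => //; exact/measurable_EFinP/measurable_funTS.
- by move=> n ? _; rewrite mule_ge0 ?lee_fin.
- move=> ? _ ? ? mn; rewrite lee_wpmul2r ?lee_fin//.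
  exact/lefP/nd_nnsfun_approx.
Qed.

(** The image of Lebesgue measure under [x |-> m + s * x], multiplied by [s], gives each interval
    []a, b]] its length, hence is Lebesgue measure. *)
Lemma ge0_integral_affine (R : realType) (m s : R) (F : R -> \bar R) :
  (0 < s)%R -> measurable_fun [set: R] F -> (forall x, 0 <= F x) ->
  \int[lebesgue_measure]_x F x =
  s%:E * \int[lebesgue_measure]_x F (m + s * x)%R.
Proof.
move=> s0 mF F0.
pose phi (x : measurableTypeR R) : measurableTypeR R := (m + s * x)%R.
have mphi : measurable_fun setT phi.
  by apply: measurable_realfun.measurable_funD => //; exact: measurable_realfun.measurable_funM.
have mFphi : measurable_fun setT (fun x => F (phi x)) by exact: measurableT_comp.
have sE : s = (NngNum (ltW s0))%:num by [].
rewrite -(ge0_integral_pushforward mphi lebesgue_measure measurableT mF (fun y _ => F0 y)).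
rewrite [in RHS]sE -(ge0_integral_mscale _ measurableT)//.
apply: eq_measure_integral => A mA _.
apply: lebesgue_measure_unique => // _ [[a b]] /= _ <-.
rewrite /mscale/= /pushforward.
have -> : phi @^-1` `]a, b]%classic =
    `]((a - m) / s)%R, ((b - m) / s)%R]%classic.
  apply/seteqP; split => x /=; rewrite !in_itv/= ltr_pdivrMr// ler_pdivlMr//
    ltrBlDl lerBrDl [(x * s)%R]mulrC//.
rewrite !lebesgue_measure_itv/= !lte_fin ltr_pM2r ?invr_gt0// ltrD2r.
case: ifP => _; last by rewrite mule0.
by rewrite -!EFinB -EFinM; congr EFin; field; rewrite gt_eqF.
Qed.

End measure_facts.

(** * Normal integrals *)

(** [distribution] expects a bundled measurable function; here the function and its measurability
    proof are separate arguments. *)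
Definition image_prob d d' (T : measurableType d) (U : measurableType d')
    (R : realType) (P : probability T R) (X : T -> U)
    (mX : measurable_fun [set: T] X) : probability U R :=
  distribution P (mfun_Sub (mem_set mX : X \in mfun)).

Lemma image_probE d d' (T : measurableType d) (U : measurableType d')
    (R : realType) (P : probability T R) (X : T -> U)
    (mX : measurable_fun [set: T] X) (B : set U) :
  image_prob P mX B = P (X @^-1` B).
Proof. by []. Qed.

Lemma ge0_integral_image d d' (T : measurableType d) (U : measurableType d')
    (R : realType) (P : probability T R) (X : T -> U)
    (mX : measurable_fun [set: T] X) (F : U -> \bar R) :
  measurable_fun [set: U] F -> (forall y, (0 <= F y)%E) ->
  (\int[image_prob P mX]_y F y = \int[P]_x F (X x))%E.
Proof. by move=> mF F0; rewrite (ge0_integral_law mX (nu := image_prob P mX)). Qed.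

Lemma integral_prob_cst d (T : measurableType d) (R : realType)
    (P : probability T R) (r : \bar R) : (\int[P]_x r)%E = r.
Proof.
transitivity (r * P setT)%E; first exact: integral_cst.
by rewrite probability_setT mule1.
Qed.

Lemma measurable_to_R (R : realType) :
  measurable_fun setT (fun x : measurableTypeR R => x : R).
Proof. exact: measurable_id. Qed.

(* [normal_prob] lives on [measurableTypeR R], which carries the same
   sigma-algebra as [R] but under another display. *)
Definition stdnormal (R : realType) : probability R R :=
  image_prob (normal_prob 0 1) (measurable_to_R (R := R)).

Ltac mfun := repeat lazymatch goal with
  | |- measurable_fun _ (fun _ => EFin _) => apply/measurable_EFinP
  | |- measurable_fun _ (GRing.add _) => apply: measurable_funD
  | |- measurable_fun _ (GRing.mul _) => apply: measurable_funM
  | |- measurable_fun _ (fun x => _ + _)%R => apply: measurable_funD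
  | |- measurable_fun _ (fun x => - _)%R => apply: measurable_funN
  | |- measurable_fun _ (fun x => _ * _)%R => apply: measurable_funM
  | |- measurable_fun _ (fun x => _ ^+ _)%R => apply: measurable_funX
  | |- measurable_fun _ (fun x => \sum_(_ <- _) _)%R => apply: measurable_sum => ?
  | |- measurable_fun _ (fun x => expR _) =>
      apply: (measurableT_comp (@measurable_expR _))
  | |- measurable_fun _ _ =>
      first [ assumption | exact: measurable_cst | exact: measurable_id
            | exact: measurable_fst | exact: measurable_snd ]
  end.

Section stdnormal.
Context {R : realType}.
Implicit Types (F : R -> \bar R) (m s x : R).
Local Notation gam := (stdnormal R).
Local Open Scope ereal_scope.

Lemma ge0_integral_normal m s F : (s != 0)%R ->
  measurable_fun [set: R] F -> (forall x, 0 <= F x) ->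
  \int[normal_prob m s]_x F x =
  \int[lebesgue_measure]_x (F x * (normal_pdf m s x)%:E).
Proof.
move=> s0 mF F0.
apply: (@ge0_integral_density _ (measurableTypeR R) R lebesgue_measure
  (normal_prob m s) (normal_pdf m s)) => //.
- exact: measurable_normal_pdf.
- by move=> x; exact: normal_pdf_ge0.
Qed.

Lemma ge0_integral_stdnormal F :
  measurable_fun [set: R] F -> (forall x, 0 <= F x) ->
  \int[gam]_x F x = \int[normal_prob 0 1]_x F x.
Proof. exact: ge0_integral_image. Qed.

Lemma stdnormal_pdf F : measurable_fun [set: R] F -> (forall x, 0 <= F x) ->
  \int[gam]_x F x = \int[lebesgue_measure]_x (F x * (normal_pdf 0 1 x)%:E).
Proof.
by move=> mF F0; rewrite ge0_integral_stdnormal// ge0_integral_normal// oner_eq0.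
Qed.

Lemma normal_peakE s : (0 < s)%R ->
  (normal_peak s = s^-1 * normal_peak (1 : R))%R.
Proof.
move=> s0; rewrite /normal_peak -!mulrnAr sqrtrM ?sqr_ge0// sqrtr_sqr.
by rewrite gtr0_norm// expr1n mul1r invfM.
Qed.

Lemma normal_pdf_affine m s x : (0 < s)%R ->
  (s * normal_pdf m s (m + s * x) = normal_pdf 0 1 x)%R.
Proof.
move=> s0; rewrite !normal_pdfE ?oner_eq0 ?gt_eqF// normal_peakE// /normal_fun.
rewrite !mulrA divff ?gt_eqF// mul1r subr0; congr (_ * expR _)%R.
by rewrite -[in LHS]mulr_natr -[in RHS]mulr_natr; field; rewrite gt_eqF.
Qed.

Lemma ge0_integral_normal_affine m s F : (0 < s)%R ->
  measurable_fun [set: R] F -> (forall x, 0 <= F x) ->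
  \int[normal_prob m s]_x F x = \int[gam]_x F (m + s * x)%R.
Proof.
move=> s0 mF F0.
have maff : measurable_fun setT (fun x : R => m + s * x)%R.
  by apply: measurable_funD => //; exact: measurable_funM.
have mFa : measurable_fun setT (fun x : R => F (m + s * x)%R).
  exact: measurableT_comp.
rewrite ge0_integral_normal ?gt_eqF//.
rewrite [RHS]stdnormal_pdf; [|exact: mFa|by []].
have mp (m' s' : R) : measurable_fun setT (fun x => (normal_pdf m' s' x)%:E).
  by apply/measurable_EFinP; exact: measurable_normal_pdf.
rewrite (@ge0_integral_affine R m s)//; last 2 first.
- exact: emeasurable_funM.
- by move=> x; rewrite mule_ge0 ?lee_fin ?normal_pdf_ge0.
rewrite -ge0_integralZl_EFin ?ltW//.
- apply: eq_integral => x _.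
  by rewrite muleCA -EFinM normal_pdf_affine.
- by move=> x _; rewrite mule_ge0 ?lee_fin ?normal_pdf_ge0.
- apply: emeasurable_funM; first exact: measurableT_comp.
  exact: (measurableT_comp (mp m s)).
Qed.

(** The factor on the right is the density of N(m, s ^+ 2) with respect to N(0, 1). The likelihood
    ratios of the lower bound all come from it. *)
Lemma stdnormal_shift m s F : (0 < s)%R ->
  measurable_fun [set: R] F -> (forall x, 0 <= F x) ->
  \int[gam]_x F (m + s * x)%R =
  \int[gam]_x (F x * (s^-1 * expR (x ^+ 2 / 2 - (x - m) ^+ 2 / (2 * s ^+ 2)))%:E).
Proof.
move=> s0 mF F0.
have ml : measurable_fun setT (fun x : R =>
    s^-1 * expR (x ^+ 2 / 2 - (x - m) ^+ 2 / (2 * s ^+ 2)))%R.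
  by mfun.
rewrite -ge0_integral_normal_affine// ge0_integral_normal ?gt_eqF//.
rewrite [RHS]stdnormal_pdf; first last.
- by move=> x; rewrite mule_ge0// lee_fin mulr_ge0 ?expR_ge0 ?invr_ge0 ?ltW.
- by apply: emeasurable_funM => //; exact/measurable_EFinP.
apply: eq_integral => x _; rewrite -muleA; congr (_ * _); rewrite -EFinM.
congr EFin; rewrite !normal_pdfE ?oner_eq0 ?gt_eqF// normal_peakE// /normal_fun.
rewrite subr0 -!mulrA; congr (_ * _)%R; rewrite [RHS]mulrCA; congr (_ * _)%R.
rewrite -expRD; congr expR.
rewrite -[(s ^+ 2 *+ 2)%R]mulr_natr -[(1 ^+ 2 *+ 2)%R]mulr_natr.
by field; rewrite gt_eqF.
Qed.

Lemma stdnormalN F : measurable_fun [set: R] F -> (forall x, 0 <= F x) ->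
  \int[gam]_x F (- x)%R = \int[gam]_x F x.
Proof.
move=> mF F0.
have mFN : measurable_fun setT (fun x : R => F (- x)%R).
  exact: measurableT_comp.
rewrite [LHS]stdnormal_pdf//.
rewrite [RHS]stdnormal_pdf//.
have mp (m' s' : R) : measurable_fun setT (fun x => (normal_pdf m' s' x)%:E).
  by apply/measurable_EFinP; exact: measurable_normal_pdf.
pose opp (x : measurableTypeR R) : measurableTypeR R := (- x)%R.
have mopp : measurable_fun setT opp by exact: measurable_funN.
pose G (x : measurableTypeR R) := F x * (normal_pdf 0 1 x)%:E.
rewrite [RHS](_ : _ = \int[pushforward lebesgue_measure opp]_x G x); last first.
  by apply: eq_measure_integral => A mA _; exact/esym/lebesgue_measureN.
have mG : measurable_fun setT G.
  by apply: emeasurable_funM; [exact: mF|exact: mp].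
have G0 x : 0 <= G x by apply: mule_ge0; rewrite ?lee_fin ?normal_pdf_ge0.
rewrite (ge0_integral_pushforward mopp lebesgue_measure measurableT mG (fun y _ => G0 y)).
apply: eq_integral => x _; rewrite /G /opp /=; congr (_ * _%:E).
by rewrite !normal_pdfE ?oner_eq0// /normal_fun !subr0 sqrrN.
Qed.

Lemma stdnormal_affine m s F : (s != 0)%R ->
  measurable_fun [set: R] F -> (forall x, 0 <= F x) ->
  \int[gam]_x F (m + s * x)%R = \int[gam]_x F (m + `|s| * x)%R.
Proof.
move=> s0 mF F0; have [s_gt0|s_le0] := ltP 0%R s; first by rewrite gtr0_norm.
rewrite ler0_norm// -[RHS]stdnormalN; [|by apply: (measurableT_comp mF); mfun|by []].
by apply: eq_integral => x _; rewrite mulrNN.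
Qed.

(** Completing the square: up to a constant the integrand is the density of N(b / v, 1 / v) with
    [v = 1 - 2 * a]. Its total mass is 1, which is [stdnormal_shift] for the constant function 1. *)
Lemma stdnormal_expR_quad (a b : R) : (a < 1 / 2)%R ->
  \int[gam]_x (expR (a * x ^+ 2 + b * x))%:E =
  ((Num.sqrt (1 - 2 * a))^-1 * expR (b ^+ 2 / (2 * (1 - 2 * a))))%:E.
Proof.
move=> ha; pose v := (1 - 2 * a)%R; have v0 : (0 < v)%R by rewrite /v; lra.
pose s := (Num.sqrt v)^-1%R; have s0 : (0 < s)%R by rewrite invr_gt0 sqrtr_gt0.
have s2 : (s ^+ 2 = v^-1)%R by rewrite exprVn sqr_sqrtr ?ltW.
pose m := (b / v)%R.
have := stdnormal_shift m (F := cst 1) s0 (measurable_cst _) (fun=> lee01).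
rewrite (_ : \int[gam]_x cst 1 (m + s * x)%R = 1); last exact: integral_prob_cst.
under [X in _ = X -> _]eq_integral => x _.
  rewrite mul1e s2 /m.
  rewrite (_ : x ^+ 2 / 2 - (x - b / v) ^+ 2 / (2 / v) =
     - (b ^+ 2 / (2 * v)) + (a * x ^+ 2 + b * x))%R; last first.
    by rewrite (_ : a = ((1 - v) / 2)%R) /v; [field; rewrite -/v gt_eqF|field].
  rewrite expRD mulrA EFinM. over.
have mE : measurable_fun setT (fun x : R => (expR (a * x ^+ 2 + b * x))%:E).
  by mfun.
have E0 (x : R) : 0 <= (expR (a * x ^+ 2 + b * x))%:E by rewrite lee_fin expR_ge0.
have k0 : (0 <= s^-1 * expR (- (b ^+ 2 / (2 * v))))%R.
  by apply: mulr_ge0; rewrite ?expR_ge0// invr_ge0 ltW.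
rewrite (ge0_integralZl_EFin _ measurableT (fun x _ => E0 x) mE k0) => h.
have -> : (Num.sqrt (1 - 2 * a))^-1%R = s by [].
(* [h] reads 1 = k * integral; multiplying by the reciprocal of k avoids a division of extended
   reals. *)
rewrite -[LHS]mul1e -[X in X * _](_ : (s * expR (b ^+ 2 / (2 * v)))%:E *
    (s^-1 * expR (- (b ^+ 2 / (2 * v))))%:E = 1); last first.
  by rewrite -EFinM mulrACA divff ?gt_eqF// -expRD subrr expR0 mulr1.
by rewrite -muleA -h mule1.
Qed.

End stdnormal.

Lemma ge0_integral_swap d1 d2 (T1 : measurableType d1) (T2 : measurableType d2)
    (R : realType) (P : probability T1 R) (Q : probability T2 R)
    (f : T1 -> T2 -> \bar R) :
  measurable_fun [set: T1 * T2] (fun z => f z.1 z.2) ->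
  (forall x y, 0 <= f x y)%E ->
  (\int[P]_x \int[Q]_y f x y = \int[Q]_y \int[P]_x f x y)%E.
Proof.
move=> mf f0.
exact: (fubini_tonelli (m1 := P) (m2 := Q) _ mf (fun z => f0 z.1 z.2)).
Qed.

Section stdnormal2.
Context {R : realType}.
Local Notation gam := (stdnormal R).
Local Open Scope ereal_scope.

(* Density of N(s * y, c ^+ 2) with respect to N(0, 1). When c ^+ 2 + s ^+ 2 = 1
   this is the Mehler kernel, the density of a standard bivariate normal law
   with correlation s with respect to the uncorrelated one. *)
Definition mehler (c s x y : R) : R :=
  (c^-1 * expR (x ^+ 2 / 2 - (x - s * y) ^+ 2 / (2 * c ^+ 2)))%R.

Lemma mehler_ge0 c s x y : (0 <= c)%R -> (0 <= mehler c s x y)%R.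
Proof. by move=> c0; rewrite mulr_ge0 ?expR_ge0 ?invr_ge0. Qed.

(** The bivariate normal law with equal variances is exchangeable; in the exponents the difference
    carries the factor [1 - c ^+ 2 - s ^+ 2]. *)
Lemma mehlerC c s x y : (0 < c)%R -> (c ^+ 2 + s ^+ 2 = 1)%R ->
  mehler c s x y = mehler c s y x.
Proof.
move=> c0 cs; rewrite /mehler; congr (_ * expR _)%R.
apply/eqP; rewrite -subr_eq0; apply/eqP.
transitivity ((1 - c ^+ 2 - s ^+ 2) * (y ^+ 2 - x ^+ 2) / (2 * c ^+ 2))%R.
  by field; rewrite gt_eqF.
by rewrite (_ : 1 - c ^+ 2 - s ^+ 2 = 0)%R ?mul0r//; lra.
Qed.

Lemma measurable_mehler c s d (T : measurableType d) (f g : T -> R) :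
  measurable_fun [set: T] f -> measurable_fun [set: T] g ->
  measurable_fun [set: T] (fun t => mehler c s (f t) (g t)).
Proof. by move=> mf mg; rewrite /mehler; mfun. Qed.

Lemma stdnormal_mehler c s y (F : R -> \bar R) : (0 < c)%R ->
  measurable_fun [set: R] F -> (forall x, 0 <= F x) ->
  \int[gam]_x F (s * y + c * x)%R = \int[gam]_x (F x * (mehler c s x y)%:E).
Proof. by move=> c0 mF F0; rewrite stdnormal_shift. Qed.

(** Rotation invariance by changes of variable on the line only. Given y, the first new coordinate x
    has density [mehler c s x y]; by [mehlerC] this kernel is also the density of [s * x + c * y']
    given x, and drawing y from it turns [(y - s * x) / c] into the fresh variable y'. *)
Lemma stdnormal_rotation_pos c s (F : R * R -> \bar R) :
  (0 < c)%R -> (c ^+ 2 + s ^+ 2 = 1)%R ->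
  measurable_fun [set: R * R] F -> (forall x, 0 <= F x) ->
  \int[gam]_x \int[gam]_y F (c * x + s * y, - s * x + c * y)%R =
  \int[gam]_x \int[gam]_y F (x, y).
Proof.
move=> c0 cs mF F0.
have mF2 d (T : measurableType d) (f g : T -> R) : measurable_fun [set: T] f ->
    measurable_fun [set: T] g -> measurable_fun [set: T] (fun t => F (f t, g t)).
  by move=> mf mg; apply: (measurableT_comp mF); exact: measurable_fun_pair.
rewrite ge0_integral_swap; [|by apply: mF2; mfun|by []].
transitivity (\int[gam]_y \int[gam]_x
    (F (x, (y - s * x) / c)%R * (mehler c s x y)%:E)).
  apply: eq_integral => y _.
  rewrite -(@stdnormal_mehler c s y (fun x => F (x, (y - s * x) / c)%R));
    [|by []|by apply: mF2; mfun|by []].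
  apply: eq_integral => x _; congr (F (_, _)); first by rewrite addrC.
  apply/eqP; rewrite -subr_eq0; apply/eqP.
  transitivity ((c ^+ 2 + s ^+ 2 - 1) * y / c)%R; last by rewrite cs subrr !mul0r.
  by field; rewrite gt_eqF.
rewrite ge0_integral_swap; last 2 first.
- apply: emeasurable_funM; first by apply: mF2; mfun.
  by apply/measurable_EFinP; apply: measurable_mehler; mfun.
- by move=> x y; rewrite mule_ge0// lee_fin mehler_ge0// ltW.
apply: eq_integral => x _.
under eq_integral do rewrite mehlerC//.
rewrite -(@stdnormal_mehler c s x (fun y => F (x, (y - s * x) / c)%R));
  [|by []|by apply: mF2; mfun|by []].
apply: eq_integral => y _; congr (F (_, _)).
by field; rewrite gt_eqF.
Qed.

(** When c < 0 both variables are negated, which gives back c > 0; when c = 0 the rotation exchanges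
    the coordinates up to sign. *)
Lemma stdnormal_rotation c s (F : R * R -> \bar R) : (c ^+ 2 + s ^+ 2 = 1)%R ->
  measurable_fun [set: R * R] F -> (forall x, 0 <= F x) ->
  \int[gam]_x \int[gam]_y F (c * x + s * y, - s * x + c * y)%R =
  \int[gam]_x \int[gam]_y F (x, y).
Proof.
move=> cs mF F0.
have mF2 d (T : measurableType d) (f g : T -> R) : measurable_fun [set: T] f ->
    measurable_fun [set: T] g -> measurable_fun [set: T] (fun t => F (f t, g t)).
  by move=> mf mg; apply: (measurableT_comp mF); exact: measurable_fun_pair.
have mF1 d (T : measurableType d) (f g : T * R -> R) :
    measurable_fun [set: T * R] f -> measurable_fun [set: T * R] g ->
    measurable_fun [set: T] (fun x => \int[gam]_y F (f (x, y), g (x, y))).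
  move=> mf mg.
  apply: (measurable_fun_fubini_tonelli_F (fun z => F (f z, g z))) => //.
  exact: mF2.
have [c0|c0|c0] := ltgtP c 0%R; last 2 first.
- exact: stdnormal_rotation_pos.
- have s0 : (s != 0)%R by apply/eqP => s0; move: cs; rewrite c0 s0; lra.
  have s1 : (`|s| = 1)%R.
    have /eqP : (s ^+ 2 = 1)%R by rewrite -cs c0 expr0n add0r.
    by rewrite -real_normK ?num_real// sqrp_eq1// => /eqP.
  rewrite c0; transitivity (\int[gam]_x \int[gam]_y F (s * y, - s * x)%R).
    by apply: eq_integral => x _; apply: eq_integral => y _;
      rewrite !mul0r add0r addr0.
  rewrite ge0_integral_swap; [|by apply: mF2; mfun|by []].
  transitivity (\int[gam]_y \int[gam]_x F (s * y, x)%R).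
    apply: eq_integral => y _.
    transitivity (\int[gam]_x F (s * y, 0 + - s * x)%R).
      by apply: eq_integral => x _; rewrite add0r.
    rewrite (@stdnormal_affine _ 0 (- s) (fun x => F (s * y, x)%R)); last 3 first.
    - by rewrite oppr_eq0.
    - by apply: mF2; mfun.
    - by [].
    by apply: eq_integral => x _; rewrite normrN s1 add0r mul1r.
  transitivity (\int[gam]_y \int[gam]_x F (0 + s * y, x)%R).
    by apply: eq_integral => y _; apply: eq_integral => x _; rewrite add0r.
  rewrite (@stdnormal_affine _ 0 s (fun z => \int[gam]_x F (z, x))); last 3 first.
  - by [].
  - by apply: (mF1 _ _ fst snd); mfun.
  - by move=> x; apply: integral_ge0 => y _; exact: F0.
  by apply: eq_integral => y _; apply: eq_integral => x _; rewrite add0r s1 mul1r.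
- rewrite -(@stdnormal_rotation_pos (- c)%R (- s)%R F); last 4 first.
  + by rewrite oppr_gt0.
  + by rewrite !sqrrN.
  + by [].
  + by [].
  rewrite -[RHS]stdnormalN; last 2 first.
  + apply: (mF1 _ _ (fun z => - c * z.1 + - s * z.2)%R
      (fun z => - - s * z.1 + - c * z.2)%R); mfun.
  + by move=> x; apply: integral_ge0 => y _; exact: F0.
  apply: eq_integral => x _.
  rewrite -[RHS]stdnormalN; [|by apply: mF2; mfun|by []].
  by apply: eq_integral => y _; congr (F (_, _)); ring.
Qed.

(** A rotation takes (a, b) to the first axis, where only one variable is left. The normalised
    vector exists only if (a, b) is nonzero, hence the case split. *)
Lemma stdnormal_conv (a b : R) (F : R -> \bar R) :
  measurable_fun [set: R] F -> (forall x, 0 <= F x) ->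
  \int[gam]_x \int[gam]_y F (a * x + b * y)%R =
  \int[gam]_x F (Num.sqrt (a ^+ 2 + b ^+ 2) * x)%R.
Proof.
move=> mF F0; set n := Num.sqrt _.
have n2 : (n ^+ 2 = a ^+ 2 + b ^+ 2)%R by rewrite sqr_sqrtr// addr_ge0 ?sqr_ge0.
have [n0|n0] := eqVneq n 0%R.
  have /eqP : (a ^+ 2 + b ^+ 2 = 0)%R by rewrite -n2 n0 expr0n.
  rewrite paddr_eq0 ?sqr_ge0// !sqrf_eq0 => /andP[/eqP-> /eqP->].
  apply: eq_integral => x _; rewrite n0 mul0r.
  transitivity (\int[gam]_y F 0%R); last exact: integral_prob_cst.
  by apply: eq_integral => y _; rewrite !mul0r addr0.
transitivity (\int[gam]_x \int[gam]_y F (n * (a / n * x + b / n * y))%R).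
  by apply: eq_integral => x _; apply: eq_integral => y _; congr F; field.
rewrite (@stdnormal_rotation (a / n) (b / n) (fun z => F (n * z.1)%R)); last 3 first.
- by rewrite !expr_div_n -mulrDl -n2 divff// expf_neq0.
- by apply: (measurableT_comp mF); mfun.
- by [].
by apply: eq_integral => x _ /=; exact: integral_prob_cst.
Qed.

End stdnormal2.

(** * Product laws *)

Section integral_shorthands.
Context d (T : measurableType d) (R : realType) (P : probability T R).
Implicit Types f g : T -> R.
Local Open Scope ereal_scope.

Lemma le_int f g : measurable_fun setT f -> measurable_fun setT g ->
  (forall x, 0 <= f x <= g x)%R -> \int[P]_x (f x)%:E <= \int[P]_x (g x)%:E.
Proof.
move=> mf mg fg; apply: ge0_le_integral => //.
- by move=> x _; rewrite lee_fin; case/andP: (fg x).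
- exact/measurable_EFinP.
- exact/measurable_EFinP.
- by move=> x _; rewrite lee_fin; case/andP: (fg x).
Qed.

Lemma intD f g : measurable_fun setT f -> measurable_fun setT g ->
  (forall x, 0 <= f x)%R -> (forall x, 0 <= g x)%R ->
  \int[P]_x (f x + g x)%:E = \int[P]_x (f x)%:E + \int[P]_x (g x)%:E.
Proof.
move=> mf mg f0 g0; under eq_integral do rewrite EFinD.
apply: ge0_integralD => //; try exact/measurable_EFinP.
- by move=> x _; rewrite lee_fin.
- by move=> x _; rewrite lee_fin.
Qed.

Lemma intZ (k : R) f : measurable_fun setT f -> (0 <= k)%R ->
  (forall x, 0 <= f x)%R ->
  \int[P]_x (k * f x)%:E = k%:E * \int[P]_x (f x)%:E.
Proof.
move=> mf k0 f0; under eq_integral do rewrite EFinM.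
apply: ge0_integralZl_EFin => //; last exact/measurable_EFinP.
by move=> x _; rewrite lee_fin.
Qed.

Lemma int_sum I (r : seq I) (f : I -> T -> R) :
  (forall i, measurable_fun setT (f i)) -> (forall i x, 0 <= f i x)%R ->
  \int[P]_x (\sum_(i <- r) f i x)%R%:E = \sum_(i <- r) \int[P]_x (f i x)%:E.
Proof.
move=> mf f0; under eq_integral do rewrite -sumEFin.
apply: (ge0_integral_sum P measurableT (f := fun i x => (f i x)%:E)).
- by move=> i; exact/measurable_EFinP.
- by move=> i x _; rewrite lee_fin.
Qed.

Lemma int_ge0 f : (forall x, 0 <= f x)%R -> 0 <= \int[P]_x (f x)%:E.
Proof. by move=> f0; apply: integral_ge0 => x _; rewrite lee_fin. Qed.

End integral_shorthands.

Section iid_power.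
Context d (T : measurableType d) (R : realType).
Implicit Types P : probability T R.
Local Open Scope ereal_scope.

Lemma measurable_cons_pair n :
  measurable_fun [set: T * n.-tuple T] (fun z => [tuple of z.1 :: z.2]).
Proof. exact: measurable_cons. Qed.

(** Built one observation at a time so that integrals are computed by induction on [n];
    [iid_power_unique] identifies it with every [Q] satisfying [iid_law]. *)
Fixpoint iid_power P n : probability (n.-tuple T) R :=
  match n with
  | 0 => \d_([tuple] : 0.-tuple T)
  | m.+1 => image_prob (P \x iid_power P m) (measurable_cons_pair (n := m))
  end.

Lemma iid_power_cons P n (F : n.+1.-tuple T -> \bar R) :
  measurable_fun setT F -> (forall t, 0 <= F t) ->
  \int[iid_power P n.+1]_t F t =
  \int[P]_x \int[iid_power P n]_t F [tuple of x :: t].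
Proof.
move=> mF F0; rewrite [LHS]ge0_integral_image; [|exact: mF|exact: F0].
rewrite fubini_tonelli1; [by []| |by move=> z; exact: F0].
by apply: (measurableT_comp mF); exact: measurable_cons_pair.
Qed.

Lemma iid_power0 P (F : 0.-tuple T -> \bar R) :
  measurable_fun setT F -> \int[iid_power P 0]_t F t = F [tuple].
Proof. by move=> mF; rewrite /= integral_dirac// diracT mul1e. Qed.

Lemma measurable_rectangle n (B : 'I_n -> set T) :
  (forall i, measurable (B i)) ->
  measurable [set t : n.-tuple T | forall i, B i (tnth t i)].
Proof.
move=> mB; rewrite (_ : [set t | _] =
    \bigcap_(i in [set: 'I_n]) ((fun t : n.-tuple T => tnth t i) @^-1` B i)).
  apply: fin_bigcap_measurable; first exact: finite_finset.
  move=> i _; rewrite -[X in measurable X]setTI.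
  exact: measurable_tnth.
by apply/seteqP; split => [t h i _|t h i]; exact: h.
Qed.

Lemma iid_power_rectangle P n (B : 'I_n -> set T) :
  (forall i, measurable (B i)) ->
  iid_power P n [set t | forall i, B i (tnth t i)] = \prod_(i < n) P (B i).
Proof.
elim: n B => [|n IH] B mB.
  rewrite big_ord0 /= diracE mem_set//= => -[]//.
rewrite -[LHS]/((P \x iid_power P n)
  ((fun z : T * n.-tuple T => [tuple of z.1 :: z.2]) @^-1` _)).
rewrite big_ord_recl -IH; last by move=> i; exact: mB.
have mt : measurable [set t : n.-tuple T | forall i, B (lift ord0 i) (tnth t i)].
  by apply: (@measurable_rectangle _ (fun i => B (lift ord0 i))).
rewrite -(product_measure1E P (iid_power P n) (mB ord0) mt).
congr (_ _); apply/seteqP; split => [[x t] /= h|[x t] /= [Bx Bt] i].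
  split; first exact: (h ord0).
  by move=> i; have := h (lift ord0 i); rewrite tnthS.
have [->//|i0] := eqVneq i ord0.
have /unlift_some[j -> _] : ord0 != i by rewrite eq_sym.
by rewrite tnthS.
Qed.

(** Rectangles are stable under intersection and generate the product sigma-algebra: a cylinder over
    coordinate [i] is the rectangle whose other sides are [setT]. *)
Lemma iid_power_unique P n (Q : probability (n.-tuple T) R) :
  (forall B : 'I_n -> set T, (forall i, measurable (B i)) ->
    Q [set t | forall i, B i (tnth t i)] = \prod_(i < n) P (B i)) ->
  forall A, measurable A -> Q A = iid_power P n A.
Proof.
move=> QB.
pose G : set (set (n.-tuple T)) := [set A | exists2 B : 'I_n -> set T,
  (forall i, measurable (B i)) & A = [set t | forall i, B i (tnth t i)]].
have GT : G setT by exists (fun=> setT) => //; exact/seteqP.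
have mG : G `<=` measurable.
  by move=> _ [B mB ->]; exact: measurable_rectangle.
apply: (@measure_unique _ _ _ G (fun=> setT)) => //.
- apply/seteqP; split; last first.
    by apply: smallest_sub => //; exact: sigma_algebra_measurable.
  apply: smallest_sub; first exact: smallest_sigma_algebra.
  case: n {Q QB GT mG} @G => [|n] G; first by rewrite big_ord0.
  rewrite -bigcup_mkord_ord => A [i ilt [B mB <-]].
  apply: sub_sigma_algebra; exists (fun j => if j == inord i then B else setT).
    by move=> j; case: ifP.
  rewrite setTI; apply/seteqP; split => [t /= Bt j|t /= /(_ (inord i))].
    by case: eqP => // ->.
  by rewrite eqxx.
- move=> _ _ [B mB ->] [B' mB' ->]; exists (fun i => B i `&` B' i).
    by move=> i; exact: measurableI.
  by apply/seteqP; split => [t /= [h h'] i|t /= h]; split=> // i; case: (h i).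
- exact: bigcup_const.
- move=> _ [B mB ->] /=; transitivity (\prod_(i < n) P (B i)); first exact: QB.
  exact/esym/iid_power_rectangle.
- by move=> _ /=; apply: le_lt_trans (probability_le1 Q measurableT) (ltry 1).
Qed.

Lemma measurable_cat m n :
  measurable_fun [set: m.-tuple T * n.-tuple T]
    (fun z => [tuple of z.1 ++ z.2]).
Proof.
apply/measurable_fun_tnthP => i; rewrite /comp.
rewrite (_ : (fun _ => _) = fun z : m.-tuple T * n.-tuple T =>
    match fintype.split i with inl j => tnth z.1 j | inr j => tnth z.2 j end).
  by case: (fintype.split i) => j;
    exact: (measurableT_comp (@measurable_tnth _ _ _ j)).
apply/funext => -[t u] /=; case: fintype.splitP => j ij.
  by rewrite (_ : i = lshift n j) ?tnth_lshift//; exact: val_inj.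
by rewrite (_ : i = rshift m j) ?tnth_rshift//; exact: val_inj.
Qed.

Lemma iid_power_cat P m n (F : (m + n).-tuple T -> \bar R) :
  measurable_fun setT F -> (forall t, 0 <= F t) ->
  \int[iid_power P (m + n)]_t F t =
  \int[iid_power P m]_t \int[iid_power P n]_u F [tuple of t ++ u].
Proof.
elim: m F => [|m IH] F mF F0.
  rewrite iid_power0.
    apply: eq_integral => u _; congr F; exact: val_inj.
  apply: (measurable_fun_fubini_tonelli_F
    (fun z : 0.-tuple T * n.-tuple T => F [tuple of z.1 ++ z.2])).
    exact: (measurableT_comp mF (measurable_cat (m := 0) (n := n))).
  by move=> z; exact: F0.
have mFcat := measurableT_comp mF (measurable_cat (m := m.+1) (n := n)).
rewrite (iid_power_cons (n := m) P (F := fun t : m.+1.-tuple T =>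
  \int[iid_power P n]_u F [tuple of t ++ u])); last 2 first.
- exact: (measurable_fun_fubini_tonelli_F
    (fun z : m.+1.-tuple T * n.-tuple T => F [tuple of z.1 ++ z.2])).
- by move=> t; apply: integral_ge0 => u _; exact: F0.
rewrite (iid_power_cons (n := m + n) P mF F0).
apply: eq_integral => x _.
rewrite (IH (fun t : (m + n).-tuple T => F [tuple of x :: t])).
- apply: eq_integral => t _; apply: eq_integral => u _; congr F; exact: val_inj.
- by apply: (measurableT_comp mF); exact: measurable_cons.
- by move=> t; exact: F0.
Qed.

Lemma measurable_prod_tnth n (f : T -> R) : measurable_fun setT f ->
  measurable_fun [set: n.-tuple T] (fun t => \prod_(i < n) f (tnth t i))%R.
Proof.
move=> mf; apply: measurable_prod => i _.
exact: (measurableT_comp mf (@measurable_tnth _ _ _ i)).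
Qed.

Lemma measurable_sum_tnth n (f : T -> R) : measurable_fun setT f ->
  measurable_fun [set: n.-tuple T] (fun t => \sum_(i < n) f (tnth t i))%R.
Proof.
move=> mf; apply: measurable_sum => i.
exact: (measurableT_comp mf (@measurable_tnth _ _ _ i)).
Qed.

(** Serves both the exponential moments of averages in the upper bound and the second moments of
    likelihood ratios in the lower bound. *)
Lemma iid_power_prod_le P n (f : T -> R) (e : R) : measurable_fun setT f ->
  (forall x, 0 <= f x)%R -> \int[P]_x (f x)%:E <= e%:E ->
  \int[iid_power P n]_t (\prod_(i < n) f (tnth t i))%R%:E <= (e ^+ n)%:E.
Proof.
move=> mf f0 fe; have e0 : (0 <= e)%R.
  by rewrite -lee_fin (le_trans _ fe)// int_ge0.
have mF m : measurable_fun [set: m.-tuple T]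
    (fun t => (\prod_(i < m) f (tnth t i))%R%:E).
  by apply/measurable_EFinP; exact: measurable_prod_tnth.
have F0 m (t : m.-tuple T) : 0 <= (\prod_(i < m) f (tnth t i))%R%:E.
  by rewrite lee_fin prodr_ge0.
elim: n => [|n IH]; first by rewrite iid_power0// big_ord0 expr0.
rewrite iid_power_cons; [|exact: mF|exact: F0].
have -> : \int[P]_x \int[iid_power P n]_t
    (\prod_(i < n.+1) f (tnth [tuple of x :: t] i))%R%:E =
  \int[P]_x \int[iid_power P n]_t (f x * \prod_(i < n) f (tnth t i))%R%:E.
  apply: eq_integral => x _; apply: eq_integral => t _; rewrite big_ord_recl.
  by congr (_ * _)%R%:E; apply: eq_bigr => i _; rewrite tnthS.
apply: (@le_trans _ _ (\int[P]_x (f x * e ^+ n)%R%:E)).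
  apply: ge0_le_integral => //.
  - move=> x _; apply: int_ge0 => t; apply: mulr_ge0 => //.
    by rewrite prodr_ge0.
  - apply: (measurable_fun_fubini_tonelli_F (fun z : T * n.-tuple T =>
      (f z.1 * \prod_(i < n) f (tnth z.2 i))%R%:E)).
      apply/measurable_EFinP; apply: measurable_funM.
        exact: (measurableT_comp mf).
      exact: (measurableT_comp (measurable_prod_tnth (n := n) mf)).
    by move=> z; rewrite lee_fin mulr_ge0// prodr_ge0.
  - by apply/measurable_EFinP; apply: measurable_funM.
  - move=> x _; rewrite (intZ (iid_power P n)); last 3 first.
    + exact: measurable_prod_tnth.
    + exact: f0.
    + by move=> t; rewrite prodr_ge0.
    by rewrite EFinM lee_wpmul2l// lee_fin.
have -> : \int[P]_x (f x * e ^+ n)%R%:E = (e ^+ n)%:E * \int[P]_x (f x)%:E.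
  rewrite -(intZ P mf (exprn_ge0 n e0) f0).
  by apply: eq_integral => x _; rewrite mulrC.
by rewrite exprSr EFinM lee_wpmul2l// lee_fin exprn_ge0.
Qed.

Lemma iid_power_density P P' (l : T -> R) n (F : n.-tuple T -> \bar R) :
  measurable_fun setT l -> (forall x, 0 <= l x)%R ->
  (forall G : T -> \bar R, measurable_fun setT G -> (forall x, 0 <= G x) ->
    \int[P']_x G x = \int[P]_x (G x * (l x)%:E)) ->
  measurable_fun setT F -> (forall t, 0 <= F t) ->
  \int[iid_power P' n]_t F t =
  \int[iid_power P n]_t (F t * (\prod_(i < n) l (tnth t i))%R%:E).
Proof.
move=> ml l0 lP; elim: n F => [|n IH] F mF F0.
  have mF' : measurable_fun setT (fun t : 0.-tuple T =>
      F t * (\prod_(i < 0) l (tnth t i))%R%:E).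
    apply: emeasurable_funM => //; apply/measurable_EFinP.
    exact: measurable_prod_tnth.
  by rewrite !iid_power0// big_ord0 mule1.
have mpl m : measurable_fun [set: m.-tuple T]
    (fun t => (\prod_(i < m) l (tnth t i))%R%:E).
  by apply/measurable_EFinP; exact: measurable_prod_tnth.
have pl0 m (t : m.-tuple T) : 0 <= (\prod_(i < m) l (tnth t i))%R%:E.
  by rewrite lee_fin prodr_ge0.
have mFc : measurable_fun setT
    (fun z : T * n.-tuple T => F [tuple of z.1 :: z.2]).
  by apply: (measurableT_comp mF); exact: measurable_cons_pair.
have mFx x : measurable_fun setT (fun t : n.-tuple T => F [tuple of x :: t]).
  by apply: (measurableT_comp mF); exact: measurable_cons.
rewrite iid_power_cons; [|exact: mF|exact: F0].
rewrite iid_power_cons; last 2 first.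
- by apply: emeasurable_funM; [exact: mF|exact: mpl].
- by move=> t; exact: mule_ge0.
have -> : \int[P']_x \int[iid_power P' n]_t F [tuple of x :: t] =
  \int[P']_x \int[iid_power P n]_t
    (F [tuple of x :: t] * (\prod_(i < n) l (tnth t i))%R%:E).
  by apply: eq_integral => x _; rewrite IH.
rewrite lP; last 2 first.
- apply: (measurable_fun_fubini_tonelli_F (fun z : T * n.-tuple T =>
    F [tuple of z.1 :: z.2] * (\prod_(i < n) l (tnth z.2 i))%R%:E)).
    apply: emeasurable_funM => //.
    exact: (measurableT_comp (mpl n)).
  by move=> z; exact: mule_ge0.
- by move=> x; apply: integral_ge0 => t _; exact: mule_ge0.
apply: eq_integral => x _; rewrite muleC -ge0_integralZl_EFin; last 4 first.
- exact: measurableT.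
- by move=> t _; exact: mule_ge0.
- by apply: emeasurable_funM; [exact: mFx|exact: mpl].
- exact: l0.
apply: eq_integral => t _; rewrite muleCA -EFinM big_ord_recl.
by congr (_ * (_ * _)%R%:E); apply: eq_bigr => i _; rewrite tnthS.
Qed.

Lemma int_affine_sqr P (f : T -> R) (c v : R) :
  measurable_fun setT f -> P.-integrable setT (EFin \o f) ->
  \int[P]_x (f x)%:E = 0 -> \int[P]_x (f x ^+ 2)%:E <= v%:E ->
  \int[P]_x ((c + f x) ^+ 2)%:E <= (c ^+ 2 + v)%:E.
Proof.
move=> mf If f_0 f2.
have If2 : P.-integrable setT (fun x => (f x ^+ 2)%:E).
  apply/integrableP; split; first by apply/measurable_EFinP; exact: measurable_funX.
  apply: le_lt_trans (ltry v); apply: le_trans f2.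
  by under eq_integral do rewrite gee0_abs ?lee_fin ?sqr_ge0//.
have Ic k : P.-integrable setT (fun=> (k : R)%:E).
  by apply/integrableP; split=> //; rewrite integral_prob_cst abse_EFin ltry.
have If' : P.-integrable setT (fun x => (2 * c)%:E * (f x)%:E).
  exact: integrableZl.
have -> : \int[P]_x ((c + f x) ^+ 2)%:E =
  \int[P]_x (((2 * c)%:E * (f x)%:E + (c ^+ 2)%:E) + (f x ^+ 2)%:E).
  apply: eq_integral => x _; rewrite -EFinM -!EFinD; congr EFin; ring.
rewrite integralD//=; last exact: integrableD.
rewrite integralD//= integralZl//= f_0 mule0 add0e integral_prob_cst EFinD.
by rewrite leeD2l.
Qed.

(** The constant [c] is there for the induction: it absorbs the terms already drawn, and centering
    removes its cross term with the remaining ones. *)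
Lemma iid_power_sqr_sum P n (f : T -> R) (c v : R) :
  measurable_fun setT f -> P.-integrable setT (EFin \o f) ->
  \int[P]_x (f x)%:E = 0 -> \int[P]_x (f x ^+ 2)%:E <= v%:E ->
  \int[iid_power P n]_t ((c + \sum_(i < n) f (tnth t i)) ^+ 2)%:E <=
  (c ^+ 2 + n%:R * v)%:E.
Proof.
move=> mf If f_0 f2.
have mF k m : measurable_fun [set: m.-tuple T]
    (fun t => ((k + \sum_(i < m) f (tnth t i)) ^+ 2)%R%:E).
  apply/measurable_EFinP; apply: measurable_funX; apply: measurable_funD => //.
  exact: measurable_sum_tnth.
have F0 k m (t : m.-tuple T) : 0 <= ((k + \sum_(i < m) f (tnth t i)) ^+ 2)%R%:E.
  by rewrite lee_fin sqr_ge0.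
elim: n c => [|n IH] c.
  by rewrite iid_power0// big_ord0 addr0 mul0r addr0.
rewrite iid_power_cons; [|exact: mF|exact: F0].
have -> : \int[P]_x \int[iid_power P n]_t
    ((c + \sum_(i < n.+1) f (tnth [tuple of x :: t] i)) ^+ 2)%R%:E =
  \int[P]_x \int[iid_power P n]_t
    ((c + f x + \sum_(i < n) f (tnth t i)) ^+ 2)%R%:E.
  apply: eq_integral => x _; apply: eq_integral => t _.
  rewrite big_ord_recl -addrA; congr ((_ + (_ + _)) ^+ 2)%R%:E.
  by apply: eq_bigr => i _; rewrite tnthS.
have v0 : (0 <= v)%R by rewrite -lee_fin (le_trans _ f2)// int_ge0// => x; rewrite sqr_ge0.
have mcf : measurable_fun setT (fun x => (c + f x) ^+ 2)%R.
  by apply: measurable_funX; apply: measurable_funD.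
apply: (@le_trans _ _ (\int[P]_x ((c + f x) ^+ 2 + n%:R * v)%:E)).
  apply: ge0_le_integral => //.
  - by move=> x _; apply: integral_ge0 => t _; exact: F0.
  - apply: (measurable_fun_fubini_tonelli_F (fun z : T * n.-tuple T =>
      ((c + f z.1 + \sum_(i < n) f (tnth z.2 i)) ^+ 2)%R%:E)).
      apply/measurable_EFinP; apply: measurable_funX; apply: measurable_funD.
        by apply: measurable_funD => //; exact: (measurableT_comp mf).
      exact: (measurableT_comp (measurable_sum_tnth (n := n) mf)).
    by move=> z; rewrite lee_fin sqr_ge0.
  - by apply/measurable_EFinP; apply: measurable_funD.
rewrite intD//; last 2 first.
- by move=> x; rewrite sqr_ge0.
- by move=> _; rewrite mulr_ge0.
rewrite integral_prob_cst -natr1 mulrDl mul1r [(_ + v)%R]addrC addrA EFinD.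
by rewrite leeD2r//; exact: int_affine_sqr.
Qed.

End iid_power.

(** Takes the place of a derivative at 0: the variance of N(0, 1) is read off its exponential
    moments by letting t tend to 0. *)
Lemma le_of_lin (R : realType) (v c k : R) : (0 < c) -> (0 <= k) ->
  (forall t, (0 < t < c) -> (v <= k * t)) -> (v <= 0).
Proof.
move=> c0 k0 H; rewrite leNgt; apply/negP => v0.
(* The second bound gives [k * t <= v / 2], which contradicts [v <= k * t]. *)
pose t := Num.min (c / 2) (v / (2 * (k + 1))).
have k1 : (0 < k + 1) by lra.
have t0 : (0 < t) by rewrite lt_min !divr_gt0//; lra.
have tc : (t < c) by rewrite gt_min; apply/orP; left; lra.
have tv : (t <= v / (2 * (k + 1))) by rewrite ge_min lexx orbT.
have := H t; rewrite t0 tc => /(_ isT) vt.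
have : (t * (2 * (k + 1)) <= v) by rewrite -ler_pdivlMr//; lra.
nra.
Qed.

Lemma invsqrt_le (R : realType) (x y : R) : (0 < x) -> (0 <= y) ->
  (1 <= y ^+ 2 * x) -> ((Num.sqrt x)^-1 <= y).
Proof.
move=> x0 y0 h; have sx : (0 < Num.sqrt x) by rewrite sqrtr_gt0.
rewrite -[leLHS]mul1r ler_pdivrMr// -(@ler_pXn2r _ 2) ?nnegrE ?mulr_ge0 ?sqrtr_ge0//.
by rewrite expr1n exprMn sqr_sqrtr // ltW.
Qed.

(** * Second and fourth moments of the standard normal law *)

Section stdnormal_moments.
Context {R : realType}.
Local Notation gam := (stdnormal R).
Local Open Scope ereal_scope.

Lemma stdnormal_expR_sqr (a : R) : (a < 1 / 2)%R ->
  \int[gam]_x (expR (a * x ^+ 2))%:E = ((Num.sqrt (1 - 2 * a))^-1)%:E.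
Proof.
move=> a12; have := stdnormal_expR_quad 0 a12.
rewrite expr0n/= mul0r expR0 mulr1 => <-.
by apply: eq_integral => x _; rewrite mul0r addr0.
Qed.

(** The exact value 3 would only improve constants. With [u = x ^+ 2 / 4] one has x^4 = 16 u^2 <= 32
    exp u, and exp u has mean sqrt 2 <= 2. *)
Lemma stdnormal_pow4_le : \int[gam]_x (x ^+ 4)%:E <= 64%:E.
Proof.
apply: (@le_trans _ _ (\int[gam]_x (32 * expR (1 / 4 * x ^+ 2))%:E)).
  apply: le_int; [by mfun|by mfun|move=> x].
  rewrite exprn_even_ge0//=.
  have u0 : (0 <= 1 / 4 * x ^+ 2)%R by rewrite mulr_ge0 ?sqr_ge0.
  have := expR_ge1Dxn 1 u0; rewrite (_ : (2`!)%:R = 2 :> R)%R //.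
  rewrite (_ : x ^+ 4 = 16 * (1 / 4 * x ^+ 2) ^+ 2)%R; last by field.
  lra.
rewrite (intZ gam); last 3 first.
- by mfun.
- by [].
- by move=> x; exact: expR_ge0.
rewrite stdnormal_expR_sqr; last by lra.
rewrite -EFinM lee_fin (_ : 1 - 2 * (1 / 4) = 2^-1)%R; last by field.
rewrite sqrtrV// invrK.
have : (Num.sqrt 2 <= 2 :> R)%R.
  rewrite -(@ler_pXn2r _ 2) ?nnegrE ?sqrtr_ge0// sqr_sqrtr//.
  by rewrite expr2; lra.
lra.
Qed.

(** For small t > 0, integrating [1 + t x^2 <= exp (t x^2)] and [1 - t x^2 <= exp (- t x^2)] and
    expanding (1 - 2t)^(-1/2) and (1 + 2t)^(-1/2) to second order bounds the moment by 1 from above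
    and below, up to a multiple of t. The fourth moment makes it finite beforehand. *)
Lemma stdnormal_sqr : \int[gam]_x (x ^+ 2)%:E = 1.
Proof.
have m2 : measurable_fun setT (fun x : R => x ^+ 2)%R by mfun.
have fin : \int[gam]_x (x ^+ 2)%:E \is a fin_num.
  rewrite ge0_fin_numE; last by apply: int_ge0 => x; rewrite sqr_ge0.
  apply: (@le_lt_trans _ _ (\int[gam]_x (1 + x ^+ 4)%:E)).
    by apply: le_int => //; [mfun|move=> x; rewrite sqr_ge0/=; nra].
  rewrite intD; last 4 first.
  - by mfun.
  - by mfun.
  - by [].
  - by move=> x; rewrite exprn_even_ge0.
  rewrite integral_prob_cst; apply: lte_add_pinfty; first exact: ltry.
  exact: le_lt_trans stdnormal_pow4_le (ltry _).
have [v vE] : exists v : R, \int[gam]_x (x ^+ 2)%:E = v%:E.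
  by exists (fine (\int[gam]_x (x ^+ 2)%:E)); rewrite fineK.
rewrite vE; congr EFin; apply/eqP; rewrite eq_le; apply/andP; split.
- rewrite -subr_le0; apply: (@le_of_lin _ _ (1 / 4)%R 4) => // t /andP[t0 t1].
  have : (1 + t * v <= (Num.sqrt (1 - 2 * t))^-1)%R.
    rewrite -lee_fin -stdnormal_expR_sqr; last by lra.
    have -> : (1 + t * v)%:E = \int[gam]_x (1 + t * x ^+ 2)%:E.
      rewrite intD; last 4 first.
      - by mfun.
      - by mfun.
      - by [].
      - by move=> x; rewrite mulr_ge0 ?sqr_ge0 ?ltW.
      rewrite integral_prob_cst (intZ gam m2); last 2 first.
      - exact: ltW.
      - by move=> x; rewrite sqr_ge0.
      by rewrite vE.
    apply: le_int; [by mfun|by mfun|move=> x].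
    by rewrite expR_ge1Dx addr_ge0// mulr_ge0 ?sqr_ge0 ?ltW.
  have : ((Num.sqrt (1 - 2 * t))^-1 <= 1 + t + 4 * t ^+ 2)%R.
    have t2 : (t ^+ 2 <= 1 / 16)%R by nra.
    apply: invsqrt_le; [lra|nra|].
    rewrite (_ : (1 + t + 4 * t ^+ 2) ^+ 2 * (1 - 2 * t) =
      1 + t ^+ 2 * (5 - 10 * t - 32 * (t * t ^+ 2)))%R; last by ring.
    by rewrite lerDl mulr_ge0 ?sqr_ge0//; nra.
  move=> h1 h2; have : (t * (v - 1 - 4 * t) <= 0)%R by nra.
  by rewrite pmulr_rle0//; lra.
- rewrite -subr_le0; apply: (@le_of_lin _ _ (1 / 4)%R 2) => // t /andP[t0 t1].
  have : (1 <= t * v + (Num.sqrt (1 - 2 * (- t)))^-1)%R.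
    rewrite -lee_fin EFinD -stdnormal_expR_sqr; last by lra.
    rewrite EFinM -vE -(intZ gam m2); last 2 first.
    - exact: ltW.
    - by move=> x; rewrite sqr_ge0.
    rewrite -intD; last 4 first.
    - by mfun.
    - by mfun.
    - by move=> x; rewrite mulr_ge0 ?sqr_ge0 ?ltW.
    - by move=> x; exact: expR_ge0.
    rewrite -[leLHS](integral_prob_cst gam); apply: le_int; [by mfun|by mfun|move=> x].
    by rewrite ler01/= mulNr; have := expR_ge1Dx (- (t * x ^+ 2)); lra.
  have : ((Num.sqrt (1 - 2 * (- t)))^-1 <= 1 - t + 2 * t ^+ 2)%R.
    have t2 : (t ^+ 2 <= 1 / 16)%R by nra.
    apply: invsqrt_le; [lra|nra|].
    rewrite (_ : (1 - t + 2 * t ^+ 2) ^+ 2 * (1 - 2 * - t) =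
      1 + t ^+ 2 * (1 + 6 * t - 4 * t ^+ 2 + 8 * (t * t ^+ 2)))%R; last by ring.
    by rewrite lerDl mulr_ge0 ?sqr_ge0//; nra.
  move=> h1 h2; have : (t * (1 - v - 2 * t) <= 0)%R by nra.
  by rewrite pmulr_rle0//; lra.
Qed.

End stdnormal_moments.

(** * Moments of products of normal variables *)

(** With [y = x + 2 * x ^+ 2], both [expR y >= 1 + y] and [(1 + y) * (1 - x) = 1 + x ^+ 2 * (1 - 2 *
    x) >= 1] hold. *)
Lemma expR_ge_sub (R : realType) (x : R) : x <= 1 / 2 ->
  expR (- x - 2 * x ^+ 2) <= 1 - x.
Proof.
move=> x2; have d0 : 0 < 1 + x + 2 * x ^+ 2 by nra.
have e := expR_ge1Dx (x + 2 * x ^+ 2).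
rewrite -opprD expRN -[leRHS]invrK lef_pV2 ?posrE ?expR_gt0 ?invr_gt0//; last by lra.
apply: le_trans e; rewrite addrA -[leLHS]mul1r ler_pdivrMr; last by lra.
have : 0 <= x ^+ 2 * (1 - 2 * x) by rewrite mulr_ge0 ?sqr_ge0//; lra.
nra.
Qed.

Lemma invsqrt_le_expR (R : realType) (x : R) : x <= 1 / 2 ->
  (Num.sqrt (1 - x))^-1 <= expR (x / 2 + x ^+ 2).
Proof.
move=> x2; apply: invsqrt_le; [lra|exact: expR_ge0|].
rewrite -expRM_natr -[leLHS](expRxMexpNx_1 ((x / 2 + x ^+ 2) * 2%:R)).
rewrite ler_wpM2l ?expR_ge0//; apply: le_trans (expR_ge_sub x2).
by rewrite ler_expR; lra.
Qed.

Section gaussian_variables.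
Context d (T : measurableType d) (R : realType) (P : probability T R).
Implicit Types X Y : T -> R.
Local Notation gam := (stdnormal R).
Local Open Scope ereal_scope.

(** The law N(0, v) as that of sqrt v times a standard normal variable: v = 0 is included without a
    separate case. *)
Definition gauss X (v : R) : Prop :=
  [/\ measurable_fun setT X, (0 <= v)%R &
    forall F : R -> \bar R, measurable_fun setT F -> (forall x, 0 <= F x) ->
      \int[P]_t F (X t) = \int[gam]_x F (Num.sqrt v * x)%R].

(* Joint normality enters only through [4 * X * Y = (X + Y) ^+ 2 - (X - Y) ^+ 2]. *)
Definition gauss_pair X Y (vx vy c : R) : Prop :=
  [/\ gauss X vx, gauss Y vy,
      gauss (fun t => X t + Y t)%R (vx + vy + 2 * c) &
      gauss (fun t => X t - Y t)%R (vx + vy - 2 * c)].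

Lemma gauss_meas X v : gauss X v -> measurable_fun setT X. Proof. by case. Qed.
Lemma gauss_var_ge0 X v : gauss X v -> (0 <= v)%R. Proof. by case. Qed.

Lemma gauss_sqr X v : gauss X v -> \int[P]_t (X t ^+ 2)%:E = v%:E.
Proof.
case=> mX v0 hX; rewrite (hX (fun x => (x ^+ 2)%:E)); last 2 first.
- by mfun.
- by move=> x; rewrite lee_fin sqr_ge0.
transitivity (\int[gam]_x (v * x ^+ 2)%:E).
  by apply: eq_integral => x _; rewrite exprMn sqr_sqrtr.
rewrite (intZ gam); [|by mfun|exact: v0|by move=> x; rewrite sqr_ge0].
by rewrite stdnormal_sqr mule1.
Qed.

Lemma gauss_pow4 X v : gauss X v -> \int[P]_t (X t ^+ 4)%:E <= (64 * v ^+ 2)%:E.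
Proof.
case=> mX v0 hX; rewrite (hX (fun x => (x ^+ 4)%:E)); last 2 first.
- by mfun.
- by move=> x; rewrite lee_fin exprn_even_ge0.
have -> : \int[gam]_x ((Num.sqrt v * x) ^+ 4)%:E = \int[gam]_x (v ^+ 2 * x ^+ 4)%:E.
  by apply: eq_integral => x _; rewrite exprMn (exprM _ 2 2) sqr_sqrtr.
rewrite (intZ gam); last 3 first.
- by mfun.
- exact: sqr_ge0.
- by move=> x; rewrite exprn_even_ge0.
rewrite [(64 * _)%R]mulrC [leRHS]EFinM; apply: lee_wpmul2l; last exact: stdnormal_pow4_le.
by rewrite lee_fin sqr_ge0.
Qed.

Lemma gauss_expR_sqr X v (a : R) : gauss X v -> (2 * (a * v) <= 1 / 2)%R ->
  \int[P]_t (expR (a * X t ^+ 2))%:E <=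
  (expR (a * v + 4 * (a * v) ^+ 2))%:E.
Proof.
case=> mX v0 hX av; rewrite (hX (fun x => (expR (a * x ^+ 2))%:E)); last 2 first.
- by mfun.
- by move=> x; rewrite lee_fin expR_ge0.
have -> : \int[gam]_x (expR (a * (Num.sqrt v * x) ^+ 2))%:E =
    \int[gam]_x (expR (a * v * x ^+ 2))%:E.
  by apply: eq_integral => x _; rewrite exprMn sqr_sqrtr// mulrA.
rewrite stdnormal_expR_sqr; last by lra.
rewrite lee_fin; have := invsqrt_le_expR av.
by rewrite exprMn (_ : 2 * (a * v) / 2 = a * v)%R; [rewrite -natrX|field].
Qed.

Lemma integrable_le X (g : T -> R) : measurable_fun setT X ->
  measurable_fun setT g -> (forall t, `|X t| <= g t)%R ->
  \int[P]_t (g t)%:E < +oo -> P.-integrable setT (EFin \o X).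
Proof.
move=> mX mg Xg fg; apply/integrableP; split; first exact/measurable_EFinP.
apply: le_lt_trans fg; apply: ge0_le_integral => //.
- apply/measurable_EFinP; exact: measurableT_comp.
- exact/measurable_EFinP.
- by move=> t _; rewrite lee_fin.
Qed.

Lemma gauss_sqr_integrable X v : gauss X v ->
  P.-integrable setT (fun t => (X t ^+ 2)%:E).
Proof.
move=> gX; have mX := gauss_meas gX; apply: (@integrable_le _ (fun t => X t ^+ 2)%R).
- by mfun.
- by mfun.
- by move=> t; rewrite ger0_norm ?sqr_ge0.
- by rewrite (gauss_sqr gX) ltry.
Qed.

Lemma gauss_pair_mulE X Y (t : T) :
  ((X t * Y t)%:E = (1 / 4)%:E * ((X t + Y t) ^+ 2)%:E -
    (1 / 4)%:E * ((X t - Y t) ^+ 2)%:E :> \bar R).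
Proof. by rewrite -!EFinM -EFinB; congr EFin; field. Qed.

Lemma gauss_pair_integrable X Y vx vy c : gauss_pair X Y vx vy c ->
  P.-integrable setT (fun t => (X t * Y t)%:E).
Proof.
case=> gX gY gS gD; under [X in _.-integrable _ X]funext do rewrite gauss_pair_mulE.
apply: integrableB => //; apply: integrableZl => //.
  exact: (gauss_sqr_integrable gS).
exact: (gauss_sqr_integrable gD).
Qed.

Lemma gauss_pair_int X Y vx vy c : gauss_pair X Y vx vy c ->
  \int[P]_t (X t * Y t)%:E = c%:E.
Proof.
case=> gX gY gS gD; under eq_integral do rewrite gauss_pair_mulE.
have iS := gauss_sqr_integrable gS; have iD := gauss_sqr_integrable gD.
rewrite integralB//=; [|exact: integrableZl|exact: integrableZl].
rewrite !integralZl//= (gauss_sqr gS) (gauss_sqr gD) -!EFinM -EFinB.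
by congr EFin; field.
Qed.

(** AM-GM with a free weight: for [k = vy] the bound is linear in [vy], as required for linear forms
    in W of arbitrary norm. *)
Lemma gauss_mul_sqr X Y vx vy (k : R) : (0 < k)%R -> gauss X vx -> gauss Y vy ->
  \int[P]_t ((X t * Y t) ^+ 2)%:E <= (32 * (k * vx ^+ 2 + vy ^+ 2 / k))%:E.
Proof.
move=> k0 gX gY; have mX := gauss_meas gX; have mY := gauss_meas gY.
apply: (@le_trans _ _ (\int[P]_t (k / 2 * X t ^+ 4 + (2 * k)^-1 * Y t ^+ 4)%:E)).
  apply: le_int; [by mfun|by mfun|move=> t].
  rewrite sqr_ge0/= -subr_ge0.
  rewrite (_ : _ - _ = (2 * k)^-1 * (k * X t ^+ 2 - Y t ^+ 2) ^+ 2)%R.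
    by rewrite mulr_ge0 ?sqr_ge0// invr_ge0; lra.
  by field; rewrite gt_eqF.
have k2 : (0 <= (2 * k)^-1)%R by rewrite invr_ge0; lra.
have p4 Z (t : T) : (0 <= Z t ^+ 4 :> R)%R by rewrite exprn_even_ge0.
rewrite intD; last 4 first.
- by mfun.
- by mfun.
- by move=> t; rewrite mulr_ge0 ?p4//; lra.
- by move=> t; rewrite mulr_ge0 ?p4.
rewrite (intZ P); [|by mfun|by lra|by move=> t; exact: p4].
rewrite (intZ P); [|by mfun|by []|by move=> t; exact: p4].
have := gauss_pow4 gX; have := gauss_pow4 gY => h4Y h4X.
have -> : (32 * (k * vx ^+ 2 + vy ^+ 2 / k) =
    k / 2 * (64 * vx ^+ 2) + (2 * k)^-1 * (64 * vy ^+ 2))%R.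
  by field; rewrite gt_eqF.
rewrite EFinD [X in _ <= X + _]EFinM [X in _ <= _ + X]EFinM.
by apply: leeD; apply: lee_wpmul2l => //; rewrite lee_fin; lra.
Qed.

(** By polarization [expR (t * X * Y)] is a product of exponentials of (X + Y)^2 and (X - Y)^2,
    whose joint law is not at hand. AM-GM separates them at the price of doubling the exponents, and
    [|t| <= (8 * K)^-1] keeps these in the range of [gauss_expR_sqr]. *)
Lemma gauss_pair_expR X Y vx vy c (K t : R) : gauss_pair X Y vx vy c ->
  (0 < K)%R -> (vx <= K)%R -> (vy <= K)%R -> (`|t| <= (8 * K)^-1)%R ->
  \int[P]_x (expR (t * (X x * Y x - c)))%:E <= (expR (16 * K ^+ 2 * t ^+ 2))%:E.
Proof.
case=> gX gY gS gD K0 vxK vyK tK.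
have mS := gauss_meas gS; have mD := gauss_meas gD.
have mX := gauss_meas gX; have mY := gauss_meas gY.
pose vS := (vx + vy + 2 * c)%R; pose vD := (vx + vy - 2 * c)%R.
have vS0 : (0 <= vS)%R := gauss_var_ge0 gS.
have vD0 : (0 <= vD)%R := gauss_var_ge0 gD.
have vSD : (vS + vD <= 4 * K)%R by rewrite /vS /vD; lra.
have tK1 : (`|t| * (8 * K) <= 1)%R by rewrite -ler_pdivlMr ?mul1r//; lra.
have /andP[tl tu] : (- (1 / 2) <= t * (4 * K) <= 1 / 2)%R.
  rewrite -ler_norml normrM (gtr0_norm (_ : 0 < 4 * K)%R); lra.
have tv v : (0 <= v)%R -> (v <= 4 * K)%R -> (`|t * v| <= 1 / 2)%R.
  move=> v0 vK; rewrite normrM (ger0_norm v0).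
  have : (`|t| * v <= `|t| * (4 * K))%R by rewrite ler_wpM2l.
  lra.
have /andP[tS1 tS2] : (- (1 / 2) <= t * vS <= 1 / 2)%R.
  by rewrite -ler_norml; apply: tv => //; lra.
have /andP[tD1 tD2] : (- (1 / 2) <= t * vD <= 1 / 2)%R.
  by rewrite -ler_norml; apply: tv => //; lra.
(* AM-GM, with weights making both terms equal to first order in t *)
pose ka := expR (- t * (vS + vD) / 4).
pose g1 x := (ka / 2 * expR (t / 2 * (X x + Y x) ^+ 2))%R.
pose g2 x := (ka^-1 / 2 * expR (- t / 2 * (X x - Y x) ^+ 2))%R.
have ka0 : (0 < ka)%R := expR_gt0 _.
apply: (@le_trans _ _ (\int[P]_x (expR (- t * c) * (g1 x + g2 x))%:E)).
  apply: le_int; [by mfun|by rewrite /g1 /g2; mfun|move=> x].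
  rewrite expR_ge0/= (_ : t * _ = - t * c + t * (X x * Y x))%R; last by ring.
  rewrite expRD ler_wpM2l ?expR_ge0//.
  pose u := expR (t / 4 * (X x + Y x) ^+ 2).
  pose w := expR (- t / 4 * (X x - Y x) ^+ 2).
  rewrite (_ : expR (t * _) = u * w)%R; last by rewrite -expRD; congr expR; field.
  rewrite /g1 /g2 (_ : expR (t / 2 * _) = u ^+ 2)%R; last first.
    by rewrite -expRM_natr; congr expR; field.
  rewrite (_ : expR (- t / 2 * _) = w ^+ 2)%R; last first.
    by rewrite -expRM_natr; congr expR; field.
  rewrite -subr_ge0 (_ : _ - _ = (2 * ka)^-1 * (ka * u - w) ^+ 2)%R.
    by rewrite mulr_ge0 ?sqr_ge0// invr_ge0; lra.
  by field; rewrite gt_eqF.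
have g10 x : (0 <= g1 x)%R by rewrite mulr_ge0 ?expR_ge0//; lra.
have ki0 : (0 <= ka^-1 / 2)%R by rewrite divr_ge0// invr_ge0 ltW.
have g20 x : (0 <= g2 x)%R by rewrite mulr_ge0 ?expR_ge0.
have mg1 : measurable_fun setT g1 by rewrite /g1; mfun.
have mg2 : measurable_fun setT g2 by rewrite /g2; mfun.
rewrite (intZ P); last 3 first.
- by mfun.
- exact: expR_ge0.
- by move=> x; exact: addr_ge0.
rewrite (intD P)// (intZ P); last 3 first.
- by mfun.
- by lra.
- by move=> x; exact: expR_ge0.
rewrite (intZ P); last 3 first.
- by mfun.
- exact: ki0.
- by move=> x; exact: expR_ge0.
have eS := gauss_expR_sqr (a := t / 2) gS.
have eD := gauss_expR_sqr (a := - t / 2) gD.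
have {}eS := eS ltac:(rewrite -/vS; lra).
have {}eD := eD ltac:(rewrite -/vD; lra).
pose ES := expR (t / 2 * vS + 4 * (t / 2 * vS) ^+ 2).
pose ED := expR (- t / 2 * vD + 4 * (- t / 2 * vD) ^+ 2).
apply: (@le_trans _ _ ((expR (- t * c))%:E * ((ka / 2)%:E * ES%:E + (ka^-1 / 2)%:E * ED%:E))).
  rewrite lee_wpmul2l ?lee_fin ?expR_ge0//.
  by apply: leeD; apply: lee_wpmul2l => //; rewrite lee_fin; lra.
rewrite -(EFinM (ka / 2)) -(EFinM (ka^-1 / 2)) -EFinD -EFinM lee_fin.
pose B := expR (16 * K ^+ 2 * t ^+ 2).
have tv2 v : (0 <= v)%R -> (v <= 4 * K)%R -> ((t * v) ^+ 2 <= 16 * K ^+ 2 * t ^+ 2)%R.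
  move=> v0 vK; rewrite exprMn mulrC ler_wpM2r ?sqr_ge0//; nra.
(* The terms linear in t cancel because [vS - vD = 4 * c]; only the square of [t * vS] remains. *)
have h1 : (expR (- t * c) * (ka * ES) <= B)%R.
  rewrite /ka /ES -!expRD ler_expR -/vS.
  have := tv2 vS vS0 ltac:(lra); rewrite /vS /vD; nra.
have h2 : (expR (- t * c) * (ka^-1 * ED) <= B)%R.
  rewrite /ka /ED -expRN -!expRD ler_expR -/vD.
  have := tv2 vD vD0 ltac:(lra); rewrite /vS /vD; nra.
rewrite -/B mulrDr.
rewrite (_ : _ * (ka / 2 * ES) = expR (- t * c) * (ka * ES) / 2)%R; last by field.
rewrite (_ : _ * (ka^-1 / 2 * ED) = expR (- t * c) * (ka^-1 * ED) / 2)%R; last first.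
  by field; rewrite gt_eqF.
lra.
Qed.

End gaussian_variables.

(** * The split-sample estimator *)

Section product_integrals.
Context d1 d2 (T1 : measurableType d1) (T2 : measurableType d2) (R : realType).
Context (P1 : probability T1 R) (P2 : probability T2 R).
Local Open Scope ereal_scope.

Lemma prod_int_le (G : T1 * T2 -> R) (g : T1 -> R) :
  measurable_fun setT G -> (forall z, 0 <= G z)%R ->
  measurable_fun setT g ->
  (forall x, \int[P2]_y (G (x, y))%:E <= (g x)%:E) ->
  \int[P1 \x P2]_z (G z)%:E <= \int[P1]_x (g x)%:E.
Proof.
move=> mG G0 mg Gg; have mGE : measurable_fun setT (EFin \o G).
  exact/measurable_EFinP.
rewrite (fubini_tonelli1 (EFin \o G)); [|exact: mGE|by move=> z; rewrite lee_fin].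
apply: ge0_le_integral => //.
- by move=> x _; apply: int_ge0.
- apply: (measurable_fun_fubini_tonelli_F _ mGE) => z.
  by rewrite lee_fin.
- exact/measurable_EFinP.
- by move=> x _; exact: Gg.
Qed.

Lemma prod_int_le_cst (G : T1 * T2 -> R) (k : R) :
  measurable_fun setT G -> (forall z, 0 <= G z)%R ->
  (forall x, \int[P2]_y (G (x, y))%:E <= k%:E) ->
  \int[P1 \x P2]_z (G z)%:E <= k%:E.
Proof.
by move=> mG G0 Gk; rewrite -[leRHS](integral_prob_cst P1); apply: prod_int_le.
Qed.

Lemma prod_int_fst (g : T1 -> R) : measurable_fun setT g ->
  (forall x, 0 <= g x)%R ->
  \int[P1 \x P2]_z (g z.1)%:E <= \int[P1]_x (g x)%:E.
Proof.
move=> mg g0; apply: (prod_int_le (G := fun z => g z.1)) => //.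
- exact: (measurableT_comp mg).
- by move=> x /=; rewrite integral_prob_cst.
Qed.

End product_integrals.

Section averages.
Context d (T : measurableType d) (R : realType) (P : probability T R).
Local Open Scope ereal_scope.

Definition avg m (f : T -> R) (t : m.-tuple T) : R :=
  (m%:R^-1 * \sum_(i < m) f (tnth t i))%R.

Lemma measurable_avg m (f : T -> R) : measurable_fun setT f ->
  measurable_fun setT (avg (m := m) f).
Proof.
by move=> mf; apply: measurable_funM => //; exact: measurable_sum_tnth.
Qed.

Lemma avgB m (f : T -> R) (c : R) (t : m.-tuple T) : (0 < m)%N ->
  (avg f t - c = m%:R^-1 * (0 + \sum_(i < m) (f (tnth t i) - c)))%R.
Proof.
move=> m0; rewrite /avg add0r sumrB sumr_const card_ord mulrBr -[(c *+ m)%R]mulr_natl.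
by rewrite mulrA mulVf ?mul1r// pnatr_eq0 -lt0n.
Qed.

Lemma int_centered_sqr (g : T -> R) (c q : R) : measurable_fun setT g ->
  P.-integrable setT (EFin \o g) -> \int[P]_x (g x)%:E = c%:E ->
  \int[P]_x (g x ^+ 2)%:E <= q%:E ->
  \int[P]_x ((g x - c) ^+ 2)%:E <= q%:E.
Proof.
move=> mg Ig gc gq.
have Ig2 : P.-integrable setT (fun x => (g x ^+ 2)%:E).
  apply: (@integrable_le _ _ _ _ (fun x => g x ^+ 2)%R (fun x => g x ^+ 2)%R).
  - by mfun.
  - by mfun.
  - by move=> t; rewrite ger0_norm ?sqr_ge0.
  - exact: le_lt_trans gq (ltry _).
have Ic k : P.-integrable setT (fun=> (k : R)%:E).
  by apply/integrableP; split=> //; rewrite integral_prob_cst abse_EFin ltry.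
have Ig' : P.-integrable setT (fun x => (- (2 * c))%:E * (g x)%:E).
  exact: integrableZl.
have -> : \int[P]_x ((g x - c) ^+ 2)%:E =
  \int[P]_x (((- (2 * c))%:E * (g x)%:E + (c ^+ 2)%:E) + (g x ^+ 2)%:E).
  apply: eq_integral => x _; rewrite -EFinM -!EFinD; congr EFin; ring.
rewrite integralD//=; last exact: integrableD.
rewrite integralD//= integralZl//= gc integral_prob_cst -EFinM -EFinD.
rewrite (_ : - (2 * c) * c + c ^+ 2 = - c ^+ 2)%R; last by ring.
apply: le_trans gq; rewrite -[leRHS]add0e; apply: leeD2r.
by rewrite lee_fin oppr_le0 sqr_ge0.
Qed.

Lemma int_avg_sqr m (f : T -> R) (c q : R) : (0 < m)%N ->
  measurable_fun setT f -> P.-integrable setT (EFin \o f) ->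
  \int[P]_x (f x)%:E = c%:E -> \int[P]_x (f x ^+ 2)%:E <= q%:E ->
  \int[iid_power P m]_t ((avg f t - c) ^+ 2)%:E <= (q / m%:R)%:E.
Proof.
move=> m0 mf If fc fq; have mR : (0 < m%:R :> R)%R by rewrite ltr0n.
have mfc : measurable_fun setT (fun x => f x - c)%R by mfun.
have -> : \int[iid_power P m]_t ((avg f t - c) ^+ 2)%:E =
    \int[iid_power P m]_t
      ((m%:R^-1 ^+ 2) * (0 + \sum_(i < m) (f (tnth t i) - c)) ^+ 2)%R%:E.
  by apply: eq_integral => t _; rewrite avgB// exprMn.
rewrite (intZ (iid_power P m)); last 3 first.
- apply: measurable_funX; apply: measurable_funD => //.
  exact: (measurable_sum_tnth (n := m) mfc).
- exact: sqr_ge0.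
- by move=> t; exact: sqr_ge0.
apply: (@le_trans _ _ ((m%:R^-1 ^+ 2)%:E * (0 ^+ 2 + m%:R * q)%:E)).
  apply: lee_wpmul2l; first by rewrite lee_fin sqr_ge0.
  have Ifc : P.-integrable setT (fun x => (f x - c)%:E).
    have Ic : P.-integrable setT (fun=> c%:E).
      by apply/integrableP; split=> //; rewrite integral_prob_cst abse_EFin ltry.
    by under [X in _.-integrable _ X]funext do rewrite EFinB; exact: integrableB.
  apply: (@iid_power_sqr_sum _ _ _ P m (fun x => f x - c)%R 0%R q mfc Ifc);
    last exact: int_centered_sqr.
  have Ic : P.-integrable setT (fun=> c%:E).
    by apply/integrableP; split=> //; rewrite integral_prob_cst abse_EFin ltry.
  under eq_integral do rewrite EFinB.
  by rewrite integralB//= fc integral_prob_cst subee.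
rewrite -EFinM lee_fin le_eqVlt; apply/orP; left; apply/eqP.
by field; rewrite gt_eqF.
Qed.

Lemma int_avg_expR m (f : T -> R) (c tau e : R) : (0 < m)%N ->
  measurable_fun setT f -> \int[P]_x (expR (tau * (f x - c)))%:E <= e%:E ->
  \int[iid_power P m]_t (expR (tau * m%:R * (avg f t - c)))%:E <= (e ^+ m)%:E.
Proof.
move=> m0 mf he; have mR : (0 < m%:R :> R)%R by rewrite ltr0n.
have -> : \int[iid_power P m]_t (expR (tau * m%:R * (avg f t - c)))%:E =
    \int[iid_power P m]_t (\prod_(i < m) expR (tau * (f (tnth t i) - c)))%R%:E.
  apply: eq_integral => t _; rewrite avgB// add0r -expR_sum -mulr_sumr.
  by congr (expR _)%:E; field; rewrite gt_eqF.
apply: (@iid_power_prod_le _ _ _ P m (fun x => expR (tau * (f x - c)))%R e) => //.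
- by mfun.
Qed.

End averages.

Section estimator.
Context {dT} {T : measurableType dT} {R : realType} {d : nat}.
Implicit Types (Z V : T -> R) (W : 'I_d -> T -> R).

(** With a disjunction, a dropped coordinate has both empirical covariances below [lam], on which
    [dropped_le] rests. *)
Definition kept m lam Z V W (j : 'I_d) (t : m.-tuple T) : R :=
  ((lam <= `|avg (fun o => Z o * W j o) t|) ||
   (lam <= `|avg (fun o => V o * W j o) t|))%:R.

(** The average of [Z * V] may share the second part of the sample, since its error is never
    multiplied by another one. *)
Definition estimator m1 m2 m3 lam Z V W
    (z : m1.-tuple T * (m2.-tuple T * m3.-tuple T)) : R :=
  avg (fun o => Z o * V o) z.2.1 -
  \sum_(j < d) kept lam Z V W j z.1 *
    (avg (fun o => Z o * W j o) z.2.1 * avg (fun o => V o * W j o) z.2.2).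

Lemma measurable_kept m lam Z V W j :
  measurable_fun setT Z -> measurable_fun setT V ->
  (forall j, measurable_fun setT (W j)) ->
  measurable_fun setT (kept (m := m) lam Z V W j).
Proof.
move=> mZ mV mW; rewrite /kept.
have mW' := mW j.
have mn (X : T -> R) : measurable_fun setT X ->
    measurable_fun setT (fun t : m.-tuple T => lam <= `|avg (fun o => X o * W j o) t|).
  move=> mX; apply: measurable_fun_ler => //.
  apply: (measurableT_comp (@normr_measurable _ _)).
  by apply: measurable_avg; mfun.
have mb : measurable_fun setT (fun b : bool => b%:R : R) by [].
apply: (measurableT_comp mb); apply: measurable_or; exact: mn.
Qed.

Lemma kept01 m lam Z V W j (t : m.-tuple T) : 0 <= kept lam Z V W j t <= 1.
Proof. by rewrite /kept; case: (_ || _); rewrite !lexx ?ler01. Qed.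

Lemma kept_sqr m lam Z V W j (t : m.-tuple T) :
  kept lam Z V W j t ^+ 2 = kept lam Z V W j t.
Proof. by rewrite /kept; case: (_ || _); rewrite ?expr1n// expr0n. Qed.

(* A deviation by [lam / 2] is detected by one of the two exponentials. *)
Lemma ind_dev_le (x e lam k : R) : 0 < lam -> 0 <= k -> lam <= `|x| ->
  1 <= 4 * e ^+ 2 / lam ^+ 2 + expR (- (k * lam / 2)) *
    (expR (k * (x - e)) + expR (- k * (x - e))).
Proof.
move=> l0 k0 lx.
have l2 : 0 < lam ^+ 2 by rewrite exprn_gt0.
have [le|le] := lerP (lam / 2) `|e|.
  rewrite -[leLHS]addr0; apply: lerD; last first.
    by apply: mulr_ge0; [exact: expR_ge0|apply: addr_ge0; exact: expR_ge0].
  rewrite ler_pdivlMr// mul1r -[e ^+ 2]real_normK ?num_real//.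
  have e0 := normr_ge0 e.
  have : 0 <= (`|e| - lam / 2) * (`|e| + lam / 2) by apply: mulr_ge0; lra.
  nra.
have xe : lam / 2 <= `|x - e| by have := ler_normD (x - e) e; rewrite subrK; lra.
rewrite -[leLHS]add0r; apply: lerD.
  by apply: divr_ge0; [apply: mulr_ge0 => //; exact: sqr_ge0|exact: ltW].
rewrite mulrDr -!expRD.
have [h|h] := lerP 0 (x - e).
  rewrite -[leLHS]addr0; apply: lerD; last exact: expR_ge0.
  rewrite -[leLHS]expR0 ler_expR.
  by move: xe; rewrite ger0_norm// => xe; nra.
rewrite -[leLHS]add0r; apply: lerD; first exact: expR_ge0.
rewrite -[leLHS]expR0 ler_expR.
by move: xe; rewrite ltr0_norm// => xe; nra.
Qed.

(** The first term sums over j to order 1 / lam^2, the squared covariances being summable; the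
    second is exponentially small in mean and pays for the d coordinates. *)
Lemma kept_le m lam Z V W j (t : m.-tuple T) (e x k : R) :
  0 < lam -> 0 <= k ->
  kept lam Z V W j t <=
  4 * (e ^+ 2 + x ^+ 2) / lam ^+ 2 + expR (- (k * lam / 2)) *
    ((expR (k * (avg (fun o => Z o * W j o) t - e)) +
      expR (- k * (avg (fun o => Z o * W j o) t - e))) +
     (expR (k * (avg (fun o => V o * W j o) t - x)) +
      expR (- k * (avg (fun o => V o * W j o) t - x)))).
Proof.
move=> l0 k0; rewrite /kept mulrDr mulrDl mulrDr addrACA.
have nn (y : R) (u : R) : 0 <= 4 * y ^+ 2 / lam ^+ 2 + expR (- (k * lam / 2)) *
    (expR (k * (u - y)) + expR (- k * (u - y))).
  apply: addr_ge0.
    by apply: divr_ge0; [apply: mulr_ge0 => //; exact: sqr_ge0|exact: sqr_ge0].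
  by apply: mulr_ge0; [exact: expR_ge0|apply: addr_ge0; exact: expR_ge0].
case: (boolP (_ || _)) => [/orP[h|h]|_] /=; last by rewrite addr_ge0.
  by rewrite -[leLHS]addr0; apply: lerD; [exact: ind_dev_le|exact: nn].
by rewrite -[leLHS]add0r; apply: lerD; [exact: nn|exact: ind_dev_le].
Qed.

(** For a dropped coordinate each true covariance is at most [lam] plus its own error. Then [(lam +
    A) * (lam + B) <= 2 * lam ^+ 2 + A ^+ 2 + B ^+ 2], so second moments of the errors suffice. *)
Lemma dropped_le m lam Z V W j (t : m.-tuple T) (e x : R) : 0 < lam ->
  `|(1 - kept lam Z V W j t) * (e * x)| <=
  2 * lam ^+ 2 + (avg (fun o => Z o * W j o) t - e) ^+ 2 +
    (avg (fun o => V o * W j o) t - x) ^+ 2.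
Proof.
move=> l0; rewrite /kept; case: (boolP (_ || _)) => [_|] /=.
  rewrite subrr mul0r normr0; apply: addr_ge0; last exact: sqr_ge0.
  by apply: addr_ge0; [apply: mulr_ge0 => //|]; exact: sqr_ge0.
rewrite negb_or -!ltNge => /andP[h1 h2]; rewrite subr0 mul1r normrM.
set a := avg _ _ in h1 *; set b := avg _ _ in h2 *.
have he : `|e| <= lam + `|a - e|.
  by have := ler_normB a (a - e); rewrite subKr; lra.
have hx : `|x| <= lam + `|b - x|.
  by have := ler_normB b (b - x); rewrite subKr; lra.
rewrite -[(a - e) ^+ 2]real_normK ?num_real// -[(b - x) ^+ 2]real_normK ?num_real//.
move: he hx; set A := `|a - e|; set B := `|b - x|.
have A0 : 0 <= A := normr_ge0 _; have B0 : 0 <= B := normr_ge0 _.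
have e0 := normr_ge0 e; have x0 := normr_ge0 x.
move=> he hx; apply: (@le_trans _ _ ((lam + A) * (lam + B))).
  by rewrite ler_pM.
by have := sqr_ge0 (A - B); have := sqr_ge0 (lam - A);
  have := sqr_ge0 (lam - B); nra.
Qed.

End estimator.

(** Plays the part of Cauchy-Schwarz: with w = sqrt n, second moments of order 1 / n give a first
    absolute moment of order n^(-1/2). *)
Lemma le_amgm (R : realType) (w a b c e m : R) : 0 < w ->
  `|a - (b + c + e) + m| <=
  2 * w * (a ^+ 2 + b ^+ 2 + c ^+ 2 + e ^+ 2) + (2 * w)^-1 + `|m|.
Proof.
move=> w0; apply: le_trans (ler_normD _ _) _; rewrite lerD2r.
set y := a - (b + c + e).
have y2 : y ^+ 2 <= 4 * (a ^+ 2 + b ^+ 2 + c ^+ 2 + e ^+ 2).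
  rewrite /y -subr_ge0 (_ : _ - _ = (a + b) ^+ 2 + (a + c) ^+ 2 + (a + e) ^+ 2 +
    (b - c) ^+ 2 + (b - e) ^+ 2 + (c - e) ^+ 2); last by ring.
  by rewrite !addr_ge0 ?sqr_ge0.
have : 0 <= (2 * w)^-1 * (w * `|y| - 1) ^+ 2.
  by rewrite mulr_ge0 ?sqr_ge0// invr_ge0; lra.
rewrite (_ : (2 * w)^-1 * _ = w / 2 * `|y| ^+ 2 - `|y| + (2 * w)^-1); last first.
  by field; rewrite gt_eqF.
rewrite real_normK ?num_real//.
have : w / 2 * y ^+ 2 <= w / 2 * (4 * (a ^+ 2 + b ^+ 2 + c ^+ 2 + e ^+ 2)).
  by rewrite ler_wpM2l//; lra.
lra.
Qed.

Section estimator_error.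
Context {dT} {T : measurableType dT} {R : realType} {d : nat}.
Context (P : probability T R) (Z V : T -> R) (W : 'I_d -> T -> R).
Context (vz vv c0 K : R) (eta xi : 'I_d -> R).
Hypothesis gZW : forall j, gauss_pair P Z (W j) vz 1 (eta j).
Hypothesis gVW : forall j, gauss_pair P V (W j) vv 1 (xi j).
Hypothesis gZV : gauss_pair P Z V vz vv c0.
Hypothesis gW : forall v : 'I_d -> R,
  gauss P (fun o => \sum_(j < d) v j * W j o) (\sum_(j < d) v j ^+ 2).
Hypotheses (K1 : 1 <= K) (vzK : vz <= K) (vvK : vv <= K).
Hypotheses (etaK : \sum_(j < d) eta j ^+ 2 <= K)
  (xiK : \sum_(j < d) xi j ^+ 2 <= K).

Let mZ : measurable_fun setT Z. Proof. by case: gZV => /gauss_meas. Qed.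
Let mV : measurable_fun setT V. Proof. by case: gZV => _ /gauss_meas. Qed.
Let mW j : measurable_fun setT (W j). Proof. by case: (gZW j) => _ /gauss_meas. Qed.
Let K0 : 0 < K. Proof. by apply: lt_le_trans K1. Qed.
Let vz0 : 0 <= vz. Proof. by case: gZV => /gauss_var_ge0. Qed.
Let vv0 : 0 <= vv. Proof. by case: gZV => _ /gauss_var_ge0. Qed.

(** Bounds the second moment of every product of two normal variables of variance at most [K], by
    [mul_sqr_le]. *)
Let Q := 64 * K ^+ 2.
Let Q0 : 0 <= Q. Proof. by rewrite /Q mulr_ge0// sqr_ge0. Qed.

Local Open Scope ereal_scope.

Lemma mul_sqr_le (X Y : T -> R) vx vy : gauss P X vx -> gauss P Y vy ->
  (vx <= K)%R -> (vy <= K)%R -> \int[P]_o ((X o * Y o) ^+ 2)%:E <= Q%:E.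
Proof.
move=> gX gY xK yK; have x0 := gauss_var_ge0 gX; have y0 := gauss_var_ge0 gY.
apply: (le_trans (gauss_mul_sqr ltr01 gX gY)).
by rewrite lee_fin /Q divr1 mul1r; nra.
Qed.

Section linear.
Context (X : T -> R) (vx : R) (c : 'I_d -> R).
Hypothesis gX : gauss P X vx.
Hypothesis gXW : forall j, gauss_pair P X (W j) vx 1 (c j).
Hypothesis vxK : (vx <= K)%R.

Lemma int_dev_sqr m j : (0 < m)%N ->
  \int[iid_power P m]_t ((avg (fun o => X o * W j o) t - c j) ^+ 2)%:E <=
  (Q / m%:R)%:E.
Proof.
move=> m0; have gWj : gauss P (W j) 1 by case: (gXW j).
have mX := gauss_meas gX; have mWj := gauss_meas gWj.
apply: int_avg_sqr => //.
- by mfun.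
- exact: (gauss_pair_integrable (gXW j)).
- exact: (gauss_pair_int (gXW j)).
- exact: (mul_sqr_le gX gWj).
Qed.

(** A combination of empirical covariances is one empirical covariance of X with the normal variable
    [\sum_j v j * W j]. The bound therefore carries the squared norm of [v] and not the
    dimension. *)
Lemma int_lin_dev_sqr m (v : 'I_d -> R) : (0 < m)%N ->
  \int[iid_power P m]_t
    ((\sum_(j < d) v j * (avg (fun o => X o * W j o) t - c j)) ^+ 2)%:E <=
  (Q * (\sum_(j < d) v j ^+ 2) / m%:R)%:E.
Proof.
move=> m0; have mX := gauss_meas gX.
set q := (\sum_(j < d) v j ^+ 2)%R.
pose f o := (\sum_(j < d) v j * (X o * W j o))%R.
have fE o : (f o = X o * \sum_(j < d) v j * W j o)%R.
  by rewrite mulr_sumr; apply: eq_bigr => j _; rewrite mulrCA.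
have -> : \int[iid_power P m]_t
    ((\sum_(j < d) v j * (avg (fun o => X o * W j o) t - c j)) ^+ 2)%:E =
  \int[iid_power P m]_t ((avg f t - \sum_(j < d) v j * c j) ^+ 2)%:E.
  apply: eq_integral => t _; congr (_ ^+ 2)%:E.
  rewrite (_ : avg f t = \sum_(j < d) v j * avg (fun o => X o * W j o) t)%R.
    by rewrite -sumrB; apply: eq_bigr => j _; rewrite mulrBr.
  rewrite /avg /f exchange_big /= mulr_sumr; apply: eq_bigr => j _.
  by rewrite -mulr_sumr mulrCA.
have Ij j : P.-integrable setT (fun o => (v j * (X o * W j o))%:E).
  under [X in _.-integrable _ X]funext do rewrite EFinM.
  by apply: integrableZl => //; exact: (gauss_pair_integrable (gXW j)).
have mf : measurable_fun setT f by rewrite /f; mfun.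
apply: int_avg_sqr => //.
- have -> : EFin \o f = fun o => \sum_(j <- index_enum 'I_d) (v j * (X o * W j o))%:E.
    by apply/funext => o /=; rewrite /f -sumEFin.
  exact: integrable_sum.
- have -> : \int[P]_o (f o)%:E =
      \int[P]_o (\sum_(j <- index_enum 'I_d) (v j * (X o * W j o))%:E).
    by apply: eq_integral => o _; rewrite /f -sumEFin.
  rewrite integral_sum// -sumEFin; apply: eq_bigr => j _.
  under eq_integral do rewrite EFinM.
  rewrite integralZl//; last exact: (gauss_pair_integrable (gXW j)).
  by rewrite (gauss_pair_int (gXW j)) EFinM.
- have -> : \int[P]_o (f o ^+ 2)%:E =
      \int[P]_o ((X o * \sum_(j < d) v j * W j o) ^+ 2)%:E.
    by apply: eq_integral => o _; rewrite fE.
  have q0 : (0 <= q)%R by apply: sumr_ge0 => j _; exact: sqr_ge0.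
  (* The weight of [gauss_mul_sqr] must be positive. *)
  have [qz|qz] := eqVneq q 0%R.
    have v0 j : v j = 0%R.
      have /psumr_eq0P : q = 0%R by [].
      move=> /(_ (fun j _ => sqr_ge0 (v j))) /(_ j isT) /eqP.
      by rewrite sqrf_eq0 => /eqP.
    have -> : \int[P]_o ((X o * \sum_(j < d) v j * W j o) ^+ 2)%:E = \int[P]_o 0.
      apply: eq_integral => o _; rewrite big1 ?mulr0 ?expr0n//.
      by move=> j _; rewrite v0 mul0r.
    by rewrite integral_prob_cst lee_fin mulr_ge0.
  have qp : (0 < q)%R by rewrite lt_neqAle eq_sym qz.
  have vx0 := gauss_var_ge0 gX.
  apply: (le_trans (gauss_mul_sqr qp gX (gW v))).
  rewrite lee_fin -/q (_ : 32 * _ = q * (32 * (vx ^+ 2 + 1)))%R; last first.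
    by field.
  have v2 : (vx ^+ 2 <= K ^+ 2)%R by rewrite ler_pXn2r ?nnegrE// ltW.
  have k2 : (1 <= K ^+ 2)%R by rewrite exprn_ege1.
  by rewrite mulrC ler_wpM2r// /Q; lra.
Qed.

Lemma int_dev_expR m j (k : R) : (0 < m)%N -> (`|k| <= (8 * K)^-1)%R ->
  \int[iid_power P m]_t
    (expR (k * m%:R * (avg (fun o => X o * W j o) t - c j)))%:E <=
  (expR (16 * K ^+ 2 * k ^+ 2 * m%:R))%:E.
Proof.
move=> m0 kK; have gWj : gauss P (W j) 1 by case: (gXW j).
have mX := gauss_meas gX; have mWj := gauss_meas gWj.
rewrite expRM_natr; apply: int_avg_expR => //; first by mfun.
exact: (gauss_pair_expR (gXW j)).
Qed.

End linear.

Let gZ : gauss P Z vz. Proof. by case: gZV. Qed.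
Let gV : gauss P V vv. Proof. by case: gZV. Qed.

Section errors.
Context (m1 m2 m3 : nat) (lam tau w : R).
Hypotheses (m10 : (0 < m1)%N) (m20 : (0 < m2)%N) (m30 : (0 < m3)%N).
Hypotheses (lam0 : (0 < lam)%R) (tau0 : (0 <= tau)%R)
  (tauK : (tau <= (8 * K)^-1)%R) (w0 : (0 < w)%R).

Let k := kept (m := m1) lam Z V W.
Let devZ m j (t : m.-tuple T) := (avg (fun o => Z o * W j o) t - eta j)%R.
Let devV m j (t : m.-tuple T) := (avg (fun o => V o * W j o) t - xi j)%R.

Let mdZ m j : measurable_fun setT (devZ (m := m) j).
Proof. by apply: measurable_funB => //; apply: measurable_avg; mfun. Qed.
Let mdV m j : measurable_fun setT (devV (m := m) j).
Proof. by apply: measurable_funB => //; apply: measurable_avg; mfun. Qed.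
Let mk j : measurable_fun setT (k j).
Proof. exact: measurable_kept. Qed.
Let k0 j t : (0 <= k j t)%R. Proof. by case/andP: (kept01 lam Z V W j t). Qed.
Let k1 j t : (k j t <= 1)%R. Proof. by case/andP: (kept01 lam Z V W j t). Qed.

Let tail := expR (16 * K ^+ 2 * tau ^+ 2 * m1%:R - tau * m1%:R * lam / 2).
(** Bounds the expected number of kept coordinates: those whose covariances are large, counted by
    Chebyshev, plus the false detections. *)
Let B := (8 * K / lam ^+ 2 + 4 * d%:R * tail)%R.

Lemma int_kept_le j : \int[iid_power P m1]_t (k j t)%:E <=
  (4 * (eta j ^+ 2 + xi j ^+ 2) / lam ^+ 2 + 4 * tail)%:E.
Proof.
have tm0 : (0 <= tau * m1%:R)%R by rewrite mulr_ge0.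
pose E := expR (- (tau * m1%:R * lam / 2)).
pose g a (dv : m1.-tuple T -> R) t := expR (a * m1%:R * dv t).
have mg a dv : measurable_fun setT dv -> measurable_fun setT (g a dv).
  by move=> mdv; rewrite /g; mfun.
have g0 a dv t : (0 <= g a dv t)%R by exact: expR_ge0.
pose U := expR (16 * K ^+ 2 * tau ^+ 2 * m1%:R).
have tauN : (`|tau| <= (8 * K)^-1)%R by rewrite ger0_norm.
have tauNN : (`|- tau| <= (8 * K)^-1)%R by rewrite normrN.
have gle a X vx c : (a = tau \/ a = - tau)%R -> gauss P X vx ->
    (forall j, gauss_pair P X (W j) vx 1 (c j)) -> (vx <= K)%R ->
    \int[iid_power P m1]_t (g a (fun t => avg (fun o => X o * W j o) t - c j)%R t)%:E <= U%:E.
  move=> at_ gX gXW xK; rewrite /g /U.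
  rewrite (_ : tau ^+ 2 = a ^+ 2)%R; last by case: at_ => ->; rewrite ?sqrrN.
  by apply: (int_dev_expR gX gXW xK) => //; case: at_ => ->.
have c4 : (0 <= 4 * (eta j ^+ 2 + xi j ^+ 2) / lam ^+ 2)%R.
  by apply: divr_ge0; rewrite ?sqr_ge0// mulr_ge0// addr_ge0 ?sqr_ge0.
apply: (@le_trans _ _ (\int[iid_power P m1]_t
   (4 * (eta j ^+ 2 + xi j ^+ 2) / lam ^+ 2 + E *
    ((g tau (devZ j) t + g (- tau)%R (devZ j) t) +
     (g tau (devV j) t + g (- tau)%R (devV j) t)))%:E)).
  apply: le_int.
  - exact: mk.
  - apply: measurable_funD => //; apply: measurable_funM => //.
    by apply: measurable_funD; apply: measurable_funD; exact: mg.
  - move=> t; rewrite k0/=.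
    have := kept_le Z V W j t (eta j) (xi j) lam0 tm0.
    by rewrite -/(k j t) /g /E !mulNr.
rewrite intD; last 4 first.
- by [].
- apply: measurable_funM => //.
  by apply: measurable_funD; apply: measurable_funD; exact: mg.
- by [].
- by move=> t; rewrite mulr_ge0 ?expR_ge0// !addr_ge0.
rewrite integral_prob_cst EFinD; apply: leeD2l.
rewrite intZ; last 3 first.
- by apply: measurable_funD; apply: measurable_funD; exact: mg.
- exact: expR_ge0.
- by move=> t; rewrite !addr_ge0.
rewrite intD; last 4 first.
- by apply: measurable_funD; exact: mg.
- by apply: measurable_funD; exact: mg.
- by move=> t; rewrite !addr_ge0.
- by move=> t; rewrite !addr_ge0.
rewrite intD; [|exact: mg|exact: mg|by []|by []].
rewrite intD; [|exact: mg|exact: mg|by []|by []].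
apply: (@le_trans _ _ (E%:E * ((U%:E + U%:E) + (U%:E + U%:E)))).
  apply: lee_wpmul2l; first by rewrite lee_fin expR_ge0.
  by apply: leeD; apply: leeD;
    [apply: (gle tau Z vz)|apply: (gle (- tau)%R Z vz)|
     apply: (gle tau V vv)|apply: (gle (- tau)%R V vv)] => //; [left|right|left|right].
rewrite -!EFinD -EFinM lee_fin /tail expRD -/U -/E.
by rewrite le_eqVlt; apply/orP; left; apply/eqP; ring.
Qed.

Let P1 := iid_power P m1.
Let P2 := iid_power P m2.
Let P3 := iid_power P m3.
Let data3 := (m1.-tuple T * (m2.-tuple T * m3.-tuple T))%type.

Let mz1 : measurable_fun setT (fun z : data3 => z.1). Proof. exact: measurable_fst. Qed.
Let mz2 : measurable_fun setT (fun z : data3 => z.2.1).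
Proof. exact: (measurableT_comp measurable_fst measurable_snd). Qed.
Let mz3 : measurable_fun setT (fun z : data3 => z.2.2).
Proof. exact: (measurableT_comp measurable_snd measurable_snd). Qed.

Let mR n : (0 < n)%N -> (0 < n%:R :> R)%R. Proof. by rewrite ltr0n. Qed.

(** The expansion of [(eta_j + devZ_j) * (xi_j + devV_j)] over the kept coordinates: [A1] and [A2]
    are linear in the errors, [A3] collects the products of two errors. *)
Let e0 (z : data3) := (avg (fun o => Z o * V o) z.2.1 - c0)%R.
Let A1 (z : data3) := (\sum_(j < d) (k j z.1 * xi j) * devZ j z.2.1)%R.
Let A2 (z : data3) := (\sum_(j < d) (k j z.1 * eta j) * devV j z.2.2)%R.
Let A3 (z : data3) := (\sum_(j < d) (k j z.1 * devZ j z.2.1) * devV j z.2.2)%R.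

Let mdZ' j (f : data3 -> m2.-tuple T) : measurable_fun setT f ->
  measurable_fun setT (fun z => devZ j (f z)).
Proof. by move=> mf; exact: (measurableT_comp (mdZ (m := m2) j)). Qed.
Let mdV' j (f : data3 -> m3.-tuple T) : measurable_fun setT f ->
  measurable_fun setT (fun z => devV j (f z)).
Proof. by move=> mf; exact: (measurableT_comp (mdV (m := m3) j)). Qed.
Let mk' j : measurable_fun setT (fun z : data3 => k j z.1).
Proof. exact: (measurableT_comp (mk j)). Qed.

Ltac mdev := repeat lazymatch goal with
  | |- measurable_fun _ (fun x => _ + _)%R => apply: measurable_funD
  | |- measurable_fun _ (fun x => _ * _)%R => apply: measurable_funM
  | |- measurable_fun _ (fun x => _ ^+ _)%R => apply: measurable_funX
  | |- measurable_fun _ (fun x => \sum_(_ <- _) _)%R => apply: measurable_sum => ?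
  | |- measurable_fun _ _ => first
    [ exact: measurable_cst | exact: mk | exact: mk' | exact: mdZ | exact: mdV
    | exact: mdZ' | exact: mdV'
    | exact: (measurableT_comp (mdZ (m := m2) _) measurable_fst)
    | exact: (measurableT_comp (mdV (m := m3) _) measurable_snd) ]
  end.

Let me0 : measurable_fun setT e0.
Proof.
apply: measurable_funB => //.
by apply: (measurableT_comp _ mz2); apply: measurable_avg; mfun.
Qed.
Let mA1 : measurable_fun setT A1.
Proof. by rewrite /A1; mdev. Qed.
Let mA2 : measurable_fun setT A2.
Proof. by rewrite /A2; mdev. Qed.
Let mA3 : measurable_fun setT A3.
Proof. by rewrite /A3; mdev. Qed.

Let int_e0 : \int[P1 \x (P2 \x P3)]_z (e0 z ^+ 2)%:E <= (Q / m2%:R)%:E.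
Proof.
apply: prod_int_le_cst; [by mfun|by move=> z; exact: sqr_ge0|move=> t1].
have mf : measurable_fun setT (fun o => Z o * V o)%R by mfun.
pose g (t : m2.-tuple T) := ((avg (fun o => Z o * V o)%R t - c0) ^+ 2)%R.
have mg : measurable_fun setT g.
  by apply: measurable_funX; apply: measurable_funB => //; exact: measurable_avg.
apply: (le_trans (prod_int_fst P2 P3 mg (fun t => sqr_ge0 _))).
apply: int_avg_sqr => //.
- exact: (gauss_pair_integrable gZV).
- exact: (gauss_pair_int gZV).
- exact: (mul_sqr_le gZ gV).
Qed.

Let sum_kept_le (x : 'I_d -> R) t : (\sum_(j < d) x j ^+ 2 <= K)%R ->
  (\sum_(j < d) (k j t * x j) ^+ 2 <= K)%R.
Proof.
apply: le_trans; apply: ler_sum => j _.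
by rewrite exprMn ler_piMl ?sqr_ge0// expr_le1.
Qed.

Let int_A1 : \int[P1 \x (P2 \x P3)]_z (A1 z ^+ 2)%:E <= (Q * K / m2%:R)%:E.
Proof.
apply: prod_int_le_cst; [by mfun|by move=> z; exact: sqr_ge0|move=> t1].
pose g (t : m2.-tuple T) := ((\sum_(j < d) (k j t1 * xi j) * devZ j t) ^+ 2)%R.
have mg : measurable_fun setT g.
  by rewrite /g; mdev.
apply: (le_trans (prod_int_fst P2 P3 mg (fun t => sqr_ge0 _))).
apply: (le_trans (int_lin_dev_sqr gZ gZW vzK _ m20)).
by rewrite lee_fin ler_wpM2r ?invr_ge0// ler_wpM2l// sum_kept_le.
Qed.

Let int_A2 : \int[P1 \x (P2 \x P3)]_z (A2 z ^+ 2)%:E <= (Q * K / m3%:R)%:E.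
Proof.
apply: prod_int_le_cst; [by mfun|by move=> z; exact: sqr_ge0|move=> t1].
apply: prod_int_le_cst.
- by rewrite /A2 /=; mdev.
- by move=> z; exact: sqr_ge0.
move=> t2.
apply: (le_trans (int_lin_dev_sqr gV gVW vvK (fun j => k j t1 * eta j)%R m30)).
by rewrite lee_fin ler_wpM2r ?invr_ge0// ler_wpM2l// sum_kept_le.
Qed.

(** The parts are integrated from last to first. Given the first two, [A3] is linear in the errors
    of the third, with coefficients of squared norm [\sum_j k_j * devZ_j ^+ 2]. The mean of this
    over the second part is at most [Q / m2] times the number of kept coordinates, which thus enters
    linearly. *)
Let int_A3 : \int[P1 \x (P2 \x P3)]_z (A3 z ^+ 2)%:E <=
  (Q ^+ 2 * B / (m2%:R * m3%:R))%:E.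
Proof.
pose c := (Q ^+ 2 / (m2%:R * m3%:R))%R.
have c_ge0 : (0 <= c)%R by rewrite divr_ge0 ?sqr_ge0// mulr_ge0.
have Qm3 : (0 <= Q / m3%:R)%R by rewrite divr_ge0.
apply: (@le_trans _ _ (\int[P1]_t (c * \sum_(j < d) k j t)%:E)).
  apply: prod_int_le.
  - by mfun.
  - by move=> z; exact: sqr_ge0.
  - by mdev.
  move=> t1.
  pose g t2 := (Q / m3%:R * \sum_(j < d) k j t1 * devZ (m := m2) j t2 ^+ 2)%R.
  have mgj j : measurable_fun setT (fun t2 => k j t1 * devZ (m := m2) j t2 ^+ 2)%R.
    by mdev.
  have gj0 j t2 : (0 <= k j t1 * devZ (m := m2) j t2 ^+ 2)%R.
    by rewrite mulr_ge0// sqr_ge0.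
  apply: (@le_trans _ _ (\int[P2]_t2 (g t2)%:E)).
    apply: prod_int_le.
    - by rewrite /A3 /=; mdev.
    - by move=> z; exact: sqr_ge0.
    - by rewrite /g; mdev.
    move=> t2.
    apply: (le_trans (int_lin_dev_sqr gV gVW vvK
      (fun j => k j t1 * devZ j t2)%R m30)).
    rewrite lee_fin /g mulrAC ler_wpM2l//; apply: ler_sum => j _.
    by rewrite exprMn kept_sqr.
  rewrite /g intZ; [|by mdev|exact: Qm3|]; last first.
    by move=> t2; apply: sumr_ge0 => j _.
  rewrite (int_sum P2 _ mgj gj0).
  apply: (@le_trans _ _ ((Q / m3%:R)%:E * \sum_(j < d) (k j t1 * (Q / m2%:R))%:E)).
    apply: lee_wpmul2l; first by rewrite lee_fin.
    apply: lee_sum => j _; rewrite intZ; last 3 first.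
    - by mdev.
    - exact: k0.
    - by move=> t2; exact: sqr_ge0.
    by rewrite [leRHS]EFinM; apply: lee_wpmul2l; [rewrite lee_fin|exact: (int_dev_sqr gZ gZW vzK)].
  rewrite sumEFin -EFinM lee_fin -mulr_suml.
  rewrite le_eqVlt; apply/orP; left; apply/eqP; rewrite /c.
  by field; rewrite !gt_eqF// mR.
rewrite intZ; [|by mdev|exact: c_ge0|]; last first.
  by move=> t; apply: sumr_ge0.
rewrite (int_sum P1 _ mk k0).
rewrite (_ : Q ^+ 2 * B / _ = c * B)%R; last by rewrite /c mulrAC.
rewrite [leRHS]EFinM; apply: lee_wpmul2l; first by rewrite lee_fin.
apply: (@le_trans _ _ (\sum_(j < d)
  (4 * (eta j ^+ 2 + xi j ^+ 2) / lam ^+ 2 + 4 * tail)%:E)).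
  by apply: lee_sum => j _; exact: int_kept_le.
rewrite sumEFin lee_fin big_split/= sumr_const card_ord -[(4 * tail *+ d)%R]mulr_natl.
rewrite -mulr_suml -mulr_sumr big_split/= /B [(d%:R * _)%R]mulrCA mulrA lerD2r.
rewrite ler_wpM2r// ?invr_ge0 ?sqr_ge0//.
have := etaK; have := xiK; lra.
Qed.

(** The contribution of the dropped coordinates vanishes outside the support of [eta], which is
    where the factor [s] comes from; [xi] may be dense. *)
Theorem int_estimator_error (s : R) :
  (\sum_(j < d) (eta j != 0)%:R <= s)%R ->
  \int[P1 \x (P2 \x P3)]_z
    (`|estimator lam Z V W z - (c0 - \sum_(j < d) eta j * xi j)|)%:E <=
  (2 * w * (Q / m2%:R + Q * K / m2%:R + Q * K / m3%:R
      + Q ^+ 2 * B / (m2%:R * m3%:R)) + (2 * w)^-1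
    + s * (2 * lam ^+ 2 + Q / m1%:R + Q / m1%:R))%:E.
Proof.
move=> etas.
pose M (t : m1.-tuple T) := (\sum_(j < d) (eta j != 0)%:R *
  (2 * lam ^+ 2 + devZ j t ^+ 2 + devV j t ^+ 2))%R.
have mMj j : measurable_fun setT (fun t : m1.-tuple T =>
    (eta j != 0)%:R * (2 * lam ^+ 2 + devZ j t ^+ 2 + devV j t ^+ 2))%R.
  by mdev.
have l2 : (0 <= 2 * lam ^+ 2)%R by rewrite mulr_ge0// sqr_ge0.
have Mj0 j (t : m1.-tuple T) :
    (0 <= (eta j != 0)%:R * (2 * lam ^+ 2 + devZ j t ^+ 2 + devV j t ^+ 2))%R.
  by rewrite mulr_ge0// !addr_ge0 ?sqr_ge0.
have mM : measurable_fun setT M by rewrite /M; mdev.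
have M0 t : (0 <= M t)%R by apply: sumr_ge0 => j _.
pose S (z : data3) := (e0 z ^+ 2 + A1 z ^+ 2 + A2 z ^+ 2 + A3 z ^+ 2)%R.
have S0 z : (0 <= S z)%R by rewrite !addr_ge0 ?sqr_ge0.
have mS : measurable_fun setT S by rewrite /S; mfun.
have mMz : measurable_fun setT (fun z : data3 => M z.1).
  exact: (measurableT_comp mM).
have w22 : (0 <= 2 * w)%R by rewrite mulr_ge0 // ltW.
have w2 : (0 <= (2 * w)^-1)%R by rewrite invr_ge0.
have mest : measurable_fun setT (estimator (m1 := m1) (m2 := m2) (m3 := m3) lam Z V W).
  rewrite /estimator; apply: measurable_funB.
    by apply: (measurableT_comp _ mz2); apply: measurable_avg; mfun.
  apply: measurable_sum => j; apply: measurable_funM; first exact: mk'.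
  apply: measurable_funM.
    by apply: (measurableT_comp _ mz2); apply: measurable_avg; mfun.
  by apply: (measurableT_comp _ mz3); apply: measurable_avg; mfun.
apply: (@le_trans _ _ (\int[P1 \x (P2 \x P3)]_z
    ((2 * w * S z + (2 * w)^-1) + M z.1)%:E)).
  apply: le_int.
  - by apply: (measurableT_comp (@normr_measurable _ _)); apply: measurable_funB.
  - by apply: measurable_funD => //; apply: measurable_funD => //; exact: measurable_funM.
  move=> z; rewrite normr_ge0/=.
  (* An exact decomposition into sampling errors and the products lost with the dropped
     coordinates. *)
  have -> : (estimator lam Z V W z - (c0 - \sum_(j < d) eta j * xi j) =
      e0 z - (A1 z + A2 z + A3 z) + \sum_(j < d) (1 - k j z.1) * (eta j * xi j))%R.
    have E1 : (\sum_(j < d) k j z.1 * (avg (fun o => Z o * W j o) z.2.1 *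
        avg (fun o => V o * W j o) z.2.2) =
      A1 z + A2 z + A3 z + \sum_(j < d) k j z.1 * (eta j * xi j))%R.
      rewrite /A1 /A2 /A3 -!big_split/=; apply: eq_bigr => j _.
      by rewrite /devZ /devV; ring.
    have E2 : (\sum_(j < d) (1 - k j z.1) * (eta j * xi j) =
      \sum_(j < d) eta j * xi j - \sum_(j < d) k j z.1 * (eta j * xi j))%R.
      by rewrite -sumrB; apply: eq_bigr => j _; ring.
    by rewrite /estimator E1 E2 /e0; ring.
  apply: le_trans (le_amgm _ _ _ _ _ w0) _; rewrite -/(S z) lerD2l.
  apply: le_trans (ler_norm_sum _ _ _) _; apply: ler_sum => j _.
  have [->|ej] := eqVneq (eta j) 0%R.
    by rewrite !mul0r mulr0 normr0.
  by rewrite mul1r; exact: dropped_le.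
rewrite intD; last 4 first.
- by apply: measurable_funD => //; exact: measurable_funM.
- exact: mMz.
- by move=> z; rewrite addr_ge0// mulr_ge0.
- by move=> z; exact: M0.
rewrite EFinD; apply: leeD; last first.
  apply: (le_trans (prod_int_fst P1 (P2 \x P3) mM M0)).
  rewrite (int_sum P1 _ mMj Mj0).
  pose C := (2 * lam ^+ 2 + Q / m1%:R + Q / m1%:R)%R.
  apply: (@le_trans _ _ (\sum_(j < d) ((eta j != 0)%:R * C)%:E)).
    apply: lee_sum => j _; rewrite intZ; last 3 first.
    - by mdev.
    - by [].
    - by move=> t; rewrite !addr_ge0 ?sqr_ge0.
    rewrite [leRHS]EFinM; apply: lee_wpmul2l; first by rewrite lee_fin.
    rewrite intD; last 4 first.
    - by mdev.
    - by mdev.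
    - by move=> t; rewrite addr_ge0 ?sqr_ge0.
    - by move=> t; exact: sqr_ge0.
    rewrite /C EFinD; apply: leeD; last exact: (int_dev_sqr gV gVW vvK).
    rewrite intD; last 4 first.
    - by mdev.
    - by mdev.
    - by [].
    - by move=> t; exact: sqr_ge0.
    rewrite EFinD integral_prob_cst; apply: leeD2l.
    exact: (int_dev_sqr gZ gZW vzK).
  rewrite sumEFin lee_fin -mulr_suml ler_wpM2r// /C.
  by rewrite !addr_ge0// divr_ge0.
rewrite intD; last 4 first.
- exact: measurable_funM.
- by [].
- by move=> z; rewrite mulr_ge0.
- by [].
rewrite integral_prob_cst EFinD; apply: leeD2r.
rewrite intZ; [|by []|exact: w22|by []].
rewrite [leRHS]EFinM; apply: lee_wpmul2l; first by rewrite lee_fin.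
have m2X (f : data3 -> R) : measurable_fun setT f ->
  measurable_fun setT (fun z => f z ^+ 2)%R by move=> mf; exact: measurable_funX.
rewrite /S.
rewrite intD; last 4 first.
- by mfun.
- exact: m2X.
- by move=> z; rewrite !addr_ge0 ?sqr_ge0.
- by move=> z; exact: sqr_ge0.
rewrite EFinD; apply: leeD; last exact: int_A3.
rewrite intD; last 4 first.
- by mfun.
- exact: m2X.
- by move=> z; rewrite !addr_ge0 ?sqr_ge0.
- by move=> z; exact: sqr_ge0.
rewrite EFinD; apply: leeD; last exact: int_A2.
rewrite intD; last 4 first.
- exact: m2X.
- exact: m2X.
- by move=> z; exact: sqr_ge0.
- by move=> z; exact: sqr_ge0.
by rewrite EFinD; apply: leeD; [exact: int_e0|exact: int_A1].
Qed.

End errors.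
End estimator_error.

(** * Consequences of the model *)

Section centered_normal_law.
Context {R : realType}.
Local Open Scope ereal_scope.

Lemma measurable_scale (s : R) : measurable_fun setT (fun x : R => s * x)%R.
Proof. by mfun. Qed.

Lemma centered_normalE (s : R) (B : set R) : (0 <= s)%R -> measurable B ->
  centered_normal s B = image_prob (stdnormal R) (measurable_scale s) B.
Proof.
move=> s0 mB; rewrite /centered_normal image_probE.
have [->|sn0] := eqVneq s 0%R.
  rewrite diracE; have [B0|B0] := boolP (0%R \in B).
    rewrite (_ : _ @^-1` B = setT) ?probability_setT//.
    by apply/seteqP; split => // x _ /=; rewrite mul0r; exact: set_mem.
  rewrite (_ : _ @^-1` B = set0) ?measure0//.
  apply/seteqP; split => // x /=; rewrite mul0r => Bx.
  by move: B0; rewrite mem_set.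
have sp : (0 < s)%R by rewrite lt_neqAle eq_sym sn0.
have mi : measurable_fun setT (fun x : R => (\1_B x)%:E : \bar R).
  exact/measurable_EFinP.
have i0 (x : R) : 0 <= (\1_B x)%:E :> \bar R by rewrite lee_fin.
have mpre : measurable ((fun x : R => s * x)%R @^-1` B).
  by rewrite -[X in measurable X]setTI; exact: measurable_scale.
transitivity (\int[normal_prob 0 s]_x (\1_B x)%:E).
  by rewrite integral_indic// setIT.
rewrite (@ge0_integral_normal_affine R 0 s (fun x => (\1_B x)%:E) sp mi i0).
transitivity (\int[stdnormal R]_x (\1_((fun x : R => s * x)%R @^-1` B) x)%:E).
  by apply: eq_integral => x _; rewrite add0r.
by rewrite integral_indic// setIT.
Qed.

Lemma gauss_of_law d (T : measurableType d) (P : probability T R) (X : T -> R)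
    (v : R) : measurable_fun setT X -> (0 <= v)%R ->
  (forall B, measurable B -> P (X @^-1` B) = centered_normal (Num.sqrt v) B) ->
  gauss P X v.
Proof.
move=> mX v0 PX; split => // F mF F0.
rewrite (ge0_integral_law (nu := image_prob (stdnormal R) (measurable_scale (Num.sqrt v))) mX _ mF F0).
  by rewrite ge0_integral_image.
by move=> B mB; apply: etrans (PX _ mB) _; apply: centered_normalE (sqrtr_ge0 _) mB.
Qed.

(** Independence on rectangles makes the joint law of [X] and [e] a product law, after which Tonelli
    and [stdnormal_conv] apply. [X] is the whole design vector, as in [obs_law], and [L] a linear
    form on it. *)
Lemma gauss_add_indep d d' (T : measurableType d) (U : measurableType d')
    (P : probability T R) (X : T -> U) (L : U -> R) (e : T -> R) (v w c : R) :
  measurable_fun setT X -> measurable_fun setT L ->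
  gauss P (L \o X) v -> gauss P e w ->
  (forall (A : set U) (B : set R), measurable A -> measurable B ->
    P [set t | A (X t) /\ B (e t)] = P [set t | A (X t)] * P [set t | B (e t)]) ->
  gauss P (fun t => L (X t) + c * e t)%R (v + c ^+ 2 * w)%R.
Proof.
move=> mX mL gL ge ind.
have me := gauss_meas ge; have w0 := gauss_var_ge0 ge; have v0 := gauss_var_ge0 gL.
split; first by apply: measurable_funD; [exact: measurableT_comp|exact: measurable_funM].
  by rewrite addr_ge0// mulr_ge0// sqr_ge0.
move=> F mF F0.
have mXe : measurable_fun setT (fun t => (X t, e t)) by exact: measurable_fun_pair.
pose PX := image_prob P mX; pose Pe := image_prob P me.
have mG : measurable_fun setT (fun z : U * R => F (L z.1 + c * z.2)%R).
  apply: (measurableT_comp mF); apply: measurable_funD.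
    exact: (measurableT_comp mL).
  by apply: measurable_funM.
have mFc (x : R) : measurable_fun setT (fun z : R => F (x + c * z)%R).
  by apply: (measurableT_comp mF); mfun.
transitivity (\int[PX \x Pe]_z F (L z.1 + c * z.2)%R).
  apply: (ge0_integral_law (nu := PX \x Pe) (X := fun t => (X t, e t)) mXe _ mG) => // A mA.
  transitivity (image_prob P mXe A); first by [].
  apply/esym/(product_measure_unique (m1 := PX) (m2 := Pe)) => //.
rewrite (fubini_tonelli1 (fun z => F (L z.1 + c * z.2)%R)) //.
pose H (u : R) := \int[stdnormal R]_y F (u + c * (Num.sqrt w * y))%R.
have mFH : measurable_fun setT (fun z : R * R => F (z.1 + c * (Num.sqrt w * z.2))%R).
  by apply: (measurableT_comp mF); mfun.
have mH : measurable_fun setT H.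
  exact: (measurable_fun_fubini_tonelli_F (m2 := stdnormal R)
    (fun z : R * R => F (z.1 + c * (Num.sqrt w * z.2))%R) mFH (fun=> F0 _)).
have H0 u : 0 <= H u by apply: integral_ge0 => y _; exact: F0.
transitivity (\int[PX]_x H (L x)).
  apply: eq_integral => x _; rewrite /fubini_F /Pe /=.
  rewrite ge0_integral_image; last 2 first.
  - exact: (mFc (L x)).
  - by move=> y; exact: F0.
  case: ge => _ _ hge; rewrite (hge (fun y => F (L x + c * y)%R)); [by []|exact: (mFc (L x))|].
  by move=> y; exact: F0.
rewrite /PX ge0_integral_image; last 2 first.
- exact: (measurableT_comp mH).
- by move=> y; exact: H0.
case: gL => _ _ hgL; rewrite (hgL H mH H0) /H.
transitivity (\int[stdnormal R]_x \int[stdnormal R]_y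
    F (Num.sqrt v * x + c * Num.sqrt w * y)%R).
  by apply: eq_integral => x _; apply: eq_integral => y _; rewrite mulrA.
by rewrite stdnormal_conv; [rewrite exprMn !sqr_sqrtr| exact: mF|exact: F0].
Qed.

End centered_normal_law.

Section sigma_entries.
Context {R : realType} {d : nat}.
Implicit Types (S : 'M[R]_(1 + d)).

Definition varZ S : R := ulsubmx S 0 0.
Definition covZW S (j : 'I_d) : R := ursubmx S 0 j.

Lemma SigmaE S : S^T = S -> drsubmx S = 1%:M ->
  S = block_mx (varZ S)%:M (ursubmx S) (ursubmx S)^T 1%:M.
Proof.
move=> sS dS; rewrite -[LHS]submxK dS; congr block_mx.
- by rewrite [LHS]mx11_scalar.
- by rewrite trmx_ursub sS.
Qed.

Lemma quad_Sigma S (a0 : R) (w : 'cV[R]_d) : S^T = S -> drsubmx S = 1%:M ->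
  ((col_mx a0%:M w)^T *m S *m col_mx a0%:M w) 0 0 =
  a0 ^+ 2 * varZ S + 2 * a0 * \sum_j covZW S j * w j 0 + \sum_j w j 0 ^+ 2.
Proof.
move=> sS dS; rewrite {1}(SigmaE sS dS) tr_col_mx tr_scalar_mx mul_row_block.
rewrite mul_row_col mulmx1 -scalar_mxM mul_mx_scalar mul_scalar_mx mulmxDl -scalemxAl.
rewrite !mxE /= !mulr1n.
have -> : \sum_(j < d) w^T 0 j * (ursubmx S)^T j 0 = \sum_(j < d) covZW S j * w j 0.
  by apply: eq_bigr => j _; rewrite /covZW !mxE mulrC.
have -> : \sum_(j < d) w^T 0 j * w j 0 = \sum_(j < d) w j 0 ^+ 2.
  by apply: eq_bigr => j _; rewrite !mxE expr2.
by rewrite /covZW; ring.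
Qed.

(** Completing the square in [w]. The coefficient [varZ S - \sum_j covZW S j ^+ 2] is the Schur
    complement, that is, the residual variance of Z given W. *)
Lemma quad_Sigma_sos S (a0 : R) (w : 'I_d -> R) :
  a0 ^+ 2 * varZ S + 2 * a0 * \sum_j covZW S j * w j + \sum_j w j ^+ 2 =
  a0 ^+ 2 * (varZ S - \sum_j covZW S j ^+ 2) + \sum_j (a0 * covZW S j + w j) ^+ 2.
Proof.
have -> : \sum_j (a0 * covZW S j + w j) ^+ 2 = a0 ^+ 2 * \sum_j covZW S j ^+ 2 +
    (2 * a0 * \sum_j covZW S j * w j + \sum_j w j ^+ 2).
  by rewrite !mulr_sumr -!big_split/=; apply: eq_bigr => j _; ring.
ring.
Qed.

(** [inf] and [sup] return 0 where they are undefined; the chain from [M^-1 > 0] to [lambda_max]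
    excludes this, so both really bound the eigenvalues. *)
Lemma eigen_bounds S (M : R) a : 0 < M ->
  [&& M^-1 <= lambda_min S, lambda_min S <= lambda_max S & lambda_max S <= M] ->
  eigenvalue S a -> M^-1 <= a <= M.
Proof.
move=> M0 /and3P[h1 h2 h3] Sa; have Mi : 0 < M^-1 by rewrite invr_gt0.
have hI : has_inf [set a | eigenvalue S a].
  apply: contrapT => /inf_out h; move: h1; rewrite /lambda_min h leNgt.
  by rewrite Mi.
have hS : has_sup [set a | eigenvalue S a].
  apply: contrapT => /sup_out h; move: h2; rewrite /lambda_max h => h2.
  by have := lt_le_trans Mi (le_trans h1 h2); rewrite ltxx.
apply/andP; split.
  by apply: le_trans h1 _; apply: ge_inf => //; case: hI.
by apply: le_trans _ h3; apply: ub_le_sup => //; case: hS.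
Qed.

Lemma mul_row_Sigma S (a0 : R) (w : 'rV[R]_d) : S^T = S -> drsubmx S = 1%:M ->
  row_mx a0%:M w *m S =
  row_mx (a0 * varZ S + \sum_j covZW S j * w 0 j)%:M (a0 *: ursubmx S + w).
Proof.
move=> sS dS; rewrite {1}(SigmaE sS dS) mul_row_block mulmx1 -scalar_mxM mul_scalar_mx.
congr row_mx; rewrite [w *m _]mx11_scalar -raddfD; congr (_ + _)%:M.
by rewrite mxE; apply: eq_bigr => j _; rewrite mxE mulrC.
Qed.

(** The plane spanned by the first basis vector and [(0, ursubmx S)] is invariant; the hypothesis is
    the characteristic equation on it, with eigenvector [(mu - 1, ursubmx S)]. *)
Lemma eigenvalue_Sigma S (mu : R) : S^T = S -> drsubmx S = 1%:M ->
  ursubmx S != 0 -> (mu - 1) * (mu - varZ S) = \sum_j covZW S j ^+ 2 ->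
  eigenvalue S mu.
Proof.
move=> sS dS u0 hmu; apply/eigenvalueP; exists (row_mx (mu - 1)%:M (ursubmx S)).
  rewrite mul_row_Sigma// scale_row_mx; congr row_mx.
    rewrite scale_scalar_mx; congr _%:M.
    have -> : \sum_j covZW S j * ursubmx S 0 j = \sum_j covZW S j ^+ 2.
      by apply: eq_bigr.
    by rewrite -hmu; ring.
  by rewrite scalerBl scale1r subrK.
by apply: contraNneq u0; rewrite -row_mx0 => /eq_row_mx[_ ->].
Qed.

(** The two eigenvalues on the invariant plane have the Schur complement as product and [varZ S + 1]
    as sum, and both lie between [M^-1] and [M]. Without covariance, [varZ S] is itself an
    eigenvalue. *)
Lemma Sigma_bounds S (M : R) : 1 < M -> S^T = S -> drsubmx S = 1%:M ->
  [&& M^-1 <= lambda_min S, lambda_min S <= lambda_max S & lambda_max S <= M] ->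
  M^-1 ^+ 2 <= varZ S - \sum_j covZW S j ^+ 2 /\ varZ S <= 2 * M.
Proof.
move=> M1 sS dS hl; have M0 : 0 < M by lra.
have Mi : 0 < M^-1 by rewrite invr_gt0.
have Mi1 : M^-1 <= 1 by rewrite invf_le1//; lra.
set E := \sum_j _.
have E0 : 0 <= E by apply: sumr_ge0 => j _; exact: sqr_ge0.
have [u0|u0] := eqVneq (ursubmx S) 0.
  have Ez : E = 0 by apply: big1 => j _; rewrite /covZW u0 mxE expr0n.
  have eS : eigenvalue S (varZ S).
    apply/eigenvalueP; exists (row_mx 1%:M 0).
      rewrite mul_row_Sigma// u0 scaler0 addr0 scale_row_mx scaler0.
      rewrite scale_scalar_mx big1; first by rewrite addr0 mulrC.
      by move=> j _; rewrite mxE mulr0.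
    apply/eqP; rewrite -row_mx0 => /eq_row_mx[/matrixP/(_ 0 0)].
    by rewrite !mxE => /eqP; rewrite oner_eq0.
  have /andP[h1 h2] := eigen_bounds M0 hl eS.
  by rewrite Ez subr0; split; [nra|lra].
pose z := varZ S; pose D := (z - 1) ^+ 2 + 4 * E; pose r := Num.sqrt D.
have D0 : 0 <= D by rewrite /D addr_ge0 ?sqr_ge0 ?mulr_ge0.
have r2 : r ^+ 2 = D by rewrite sqr_sqrtr.
have ep : eigenvalue S ((z + 1 + r) / 2).
  apply: eigenvalue_Sigma => //; rewrite -/E -/z.
  rewrite (_ : _ * _ = (r ^+ 2 - (z - 1) ^+ 2) / 4); last by field.
  by rewrite r2 /D; field.
have em : eigenvalue S ((z + 1 - r) / 2).
  apply: eigenvalue_Sigma => //; rewrite -/E -/z.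
  rewrite (_ : _ * _ = (r ^+ 2 - (z - 1) ^+ 2) / 4); last by field.
  by rewrite r2 /D; field.
have /andP[p1 p2] := eigen_bounds M0 hl ep.
have /andP[m1 m2] := eigen_bounds M0 hl em.
split; last by rewrite -/z; lra.
rewrite -/z (_ : z - E = (z + 1 + r) / 2 * ((z + 1 - r) / 2)).
  by rewrite expr2 ler_pM// ltW.
rewrite (_ : _ * _ = ((z + 1) ^+ 2 - r ^+ 2) / 4); last by field.
by rewrite r2 /D; field.
Qed.

Lemma row_inv_Sigma S : S^T = S -> drsubmx S = 1%:M ->
  0 < varZ S - \sum_j covZW S j ^+ 2 ->
  row 0 (invmx S) = (varZ S - \sum_j covZW S j ^+ 2)^-1 *: row_mx 1%:M (- ursubmx S).
Proof.
set t := _ - _ => sS dS t0.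
have uS : S \in unitmx.
  rewrite -row_free_unit; apply: inj_row_free => v.
  rewrite -[v]hsubmxK [lsubmx v]mx11_scalar mul_row_Sigma//.
  set v0 := lsubmx v 0 0; set w := rsubmx v.
  rewrite -[X in _ = X]row_mx0 => /eq_row_mx[h1 h2].
  have wE : w = - (v0 *: ursubmx S).
    by apply/eqP; rewrite -addr_eq0 addrC h2.
  move: h1 => /matrixP/(_ 0 0); rewrite !mxE mulr1n wE => h1.
  have v00 : v0 = 0.
    apply/eqP; rewrite -(mulrI_eq0 _ (lregP (lt0r_neq0 t0))) /t mulrC mulrBr.
    apply/eqP; rewrite -[RHS]h1; congr (_ + _).
    rewrite mulr_sumr -sumrN; apply: eq_bigr => j _.
    by rewrite mxE mxE /covZW; ring.
  by rewrite v00 scale0r oppr0 raddf0 row_mx0.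
have -> : invmx S = 1%:M *m invmx S by rewrite mul1mx.
rewrite row_mul; apply: (canLR (mulmxK uS)).
rewrite -scalemxAl mul_row_Sigma// scale1r subrr scale_row_mx scaler0 mul1r.
have -> : varZ S + \sum_j covZW S j * (- ursubmx S) 0 j = t.
  rewrite /t -sumrN; congr (_ + _); apply: eq_bigr => j _.
  by rewrite mxE mulrN expr2.
rewrite scale_scalar_mx mulVf ?gt_eqF//.
apply/rowP => j; rewrite !mxE; case: fintype.splitP => i ij; rewrite mxE.
  by rewrite (_ : j = 0) ?eqxx ?ord1//; apply: val_inj; rewrite /= ij ord1.
by rewrite (_ : (0 == j) = false)//; apply/negbTE/eqP => /(congr1 val)/=; rewrite ij.
Qed.

Lemma norm0_row_inv_Sigma S : S^T = S -> drsubmx S = 1%:M ->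
  0 < varZ S - \sum_j covZW S j ^+ 2 ->
  norm0 (row 0 (invmx S)) = (1 + \sum_j (covZW S j != 0%R))%N.
Proof.
move=> sS dS t0; rewrite /norm0 row_inv_Sigma//; set t := _^-1.
have tn0 : t != 0 by rewrite invr_eq0 gt_eqF.
set r := _ *: _.
have -> : #|[set j | r 0 j != 0]%classic| = #|[pred j | r 0 j != 0]|.
  apply: eq_card => j; rewrite !inE.
  by apply/idP/idP => [/set_mem|h]; [|exact: mem_set].
rewrite -sum1_card big_mkcond/= big_split_ord/= big_ord1.
have r0 i : r 0 (lshift d i) = t.
  by rewrite /r mxE row_mxEl mxE ord1 eqxx mulr1.
have rS j : r 0 (rshift 1 j) = - (t * covZW S j).
  by rewrite /r mxE row_mxEr mxE mulrN.
rewrite inE r0 tn0; congr (_ + _)%N.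
by apply: eq_bigr => j _; rewrite inE rS oppr_eq0 mulf_eq0 (negbTE tn0)/=; case: eqP.
Qed.

End sigma_entries.

Section obs_gauss.
Context {R : realType} {d : nat}.
Variables (theta : param (R := R) d) (P : probability (obs (R := R) d) R).
Let S := Sigma theta.
Hypothesis hP : obs_law theta P.
Hypotheses (sS : S^T = S) (dS : drsubmx S = 1%:M).
Hypothesis tau0 : 0 <= varZ S - \sum_j covZW S j ^+ 2.
Hypothesis sig0 : 0 <= sigma theta.

Definition obs_Wj (j : 'I_d) (o : obs (R := R) d) : R := tnth o.2.2 j.

Lemma measurable_obs_y : measurable_fun setT (@obs_y R d).
Proof. exact: measurable_fst. Qed.
Lemma measurable_obs_Z : measurable_fun setT (@obs_Z R d).
Proof. exact: (measurableT_comp measurable_fst measurable_snd). Qed.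
Lemma measurable_obs_Wj j : measurable_fun setT (obs_Wj j).
Proof.
apply: (measurableT_comp (measurable_tnth (T := R) j)).
exact: (measurableT_comp measurable_snd measurable_snd).
Qed.

Lemma noiseE o : noise theta o =
  obs_y o - obs_Z o * beta theta - \sum_j obs_Wj j o * gamma theta j 0.
Proof.
rewrite /noise; congr (_ - _); rewrite mxE; apply: eq_bigr => j _.
by rewrite !mxE.
Qed.

Lemma measurable_noise : measurable_fun setT (noise theta).
Proof.
rewrite (_ : noise theta = fun o => obs_y o - obs_Z o * beta theta -
    \sum_j obs_Wj j o * gamma theta j 0); last by apply/funext => o; exact: noiseE.
have := measurable_obs_y; have := measurable_obs_Z => mz my.
have mw := measurable_obs_Wj.
apply: measurable_funB; first by apply: measurable_funB => //; exact: measurable_funM.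
by apply: measurable_sum => j; apply: measurable_funM.
Qed.

(** Z, each W_j and y all have this form, and the family is stable under sums and differences, which
    is what [gauss_pair] requires. *)
Definition obs_lin (a : R) (w : 'I_d -> R) (e : R) o : R :=
  a * obs_Z o + \sum_j w j * obs_Wj j o + e * noise theta o.

Definition obs_cov (a : R) (w : 'I_d -> R) (e : R) a' (w' : 'I_d -> R) e' : R :=
  a * a' * varZ S + a * (\sum_j covZW S j * w' j) + a' * (\sum_j covZW S j * w j) +
  \sum_j w j * w' j + e * e' * sigma theta ^+ 2.

Lemma gauss_noise : gauss P (noise theta) (sigma theta ^+ 2).
Proof.
apply: gauss_of_law; [exact: measurable_noise|exact: sqr_ge0|].
by move=> B mB; rewrite sqrtr_sqr ger0_norm//; case: hP => _ h _; exact: h.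
Qed.

Lemma gauss_obs_ZW a (w : 'I_d -> R) :
  gauss P (fun o => a * obs_Z o + \sum_j w j * obs_Wj j o)
    (a ^+ 2 * varZ S + 2 * a * (\sum_j covZW S j * w j) + \sum_j w j ^+ 2).
Proof.
apply: gauss_of_law.
- apply: measurable_funD.
    by apply: measurable_funM => //; exact: measurable_obs_Z.
  apply: measurable_sum => j; apply: measurable_funM => //.
  exact: measurable_obs_Wj.
- rewrite quad_Sigma_sos; apply: addr_ge0; first by rewrite mulr_ge0 ?sqr_ge0.
  by apply: sumr_ge0 => j _; exact: sqr_ge0.
move=> B mB; case: hP => hX _ _.
pose wv := \col_j w j; have := hX (col_mx a%:M wv) B mB.
rewrite (quad_Sigma _ _ sS dS).
have -> : \sum_j covZW S j * wv j 0 = \sum_j covZW S j * w j.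
  by apply: eq_bigr => j _; rewrite mxE.
have -> : \sum_j wv j 0 ^+ 2 = \sum_j w j ^+ 2.
  by apply: eq_bigr => j _; rewrite mxE.
move=> <-; congr (P _); apply/seteqP.
have E o : ((col_mx a%:M wv)^T *m obs_X o) 0 0 =
    a * obs_Z o + \sum_j w j * obs_Wj j o.
  rewrite /obs_X tr_col_mx tr_scalar_mx mul_row_col -scalar_mxM !mxE eqxx mulr1n.
  by congr (_ + _); apply: eq_bigr => j _; rewrite !mxE.
by split => o /=; rewrite E.
Qed.

Lemma gauss_obs_lin a w e :
  gauss P (obs_lin a w e) (obs_cov a w e a w e).
Proof.
have g1 := gauss_obs_ZW a w.
pose L (u : R * d.-tuple R) := a * u.1 + \sum_j w j * tnth u.2 j.
have mL : measurable_fun setT L.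
  apply: measurable_funD; first by apply: measurable_funM => //; exact: measurable_fst.
  apply: measurable_sum => j; apply: measurable_funM => //.
  apply: (measurableT_comp (measurable_tnth (T := R) j)).
  exact: measurable_snd.
have gL : gauss P (L \o snd) (a ^+ 2 * varZ S +
    2 * a * (\sum_j covZW S j * w j) + \sum_j w j ^+ 2) by exact: g1.
have := gauss_add_indep e measurable_snd mL gL gauss_noise.
case: hP => _ _ ind /(_ ind); rewrite /obs_cov.
have -> : \sum_j w j * w j = \sum_j w j ^+ 2.
  by apply: eq_bigr => j _; rewrite expr2.
set v1 := (X in gauss P _ X -> _); set v2 := (X in _ -> gauss P _ X).
by have -> : v1 = v2 by rewrite /v1 /v2; ring.
Qed.

Lemma obs_linD a w e a' w' e' o : obs_lin a w e o + obs_lin a' w' e' o =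
  obs_lin (a + a') (fun j => w j + w' j) (e + e') o.
Proof.
rewrite /obs_lin.
have -> : \sum_j (w j + w' j) * obs_Wj j o =
    \sum_j w j * obs_Wj j o + \sum_j w' j * obs_Wj j o.
  by rewrite -big_split/=; apply: eq_bigr => j _; rewrite mulrDl.
ring.
Qed.

Lemma obs_linB a w e a' w' e' o : obs_lin a w e o - obs_lin a' w' e' o =
  obs_lin (a - a') (fun j => w j - w' j) (e - e') o.
Proof.
rewrite /obs_lin.
have -> : \sum_j (w j - w' j) * obs_Wj j o =
    \sum_j w j * obs_Wj j o - \sum_j w' j * obs_Wj j o.
  by rewrite -sumrB; apply: eq_bigr => j _; rewrite mulrBl.
ring.
Qed.

Lemma obs_gauss_pair a w e a' w' e' :
  gauss_pair P (obs_lin a w e) (obs_lin a' w' e')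
    (obs_cov a w e a w e) (obs_cov a' w' e' a' w' e')
    (obs_cov a w e a' w' e').
Proof.
have sumE (f g : 'I_d -> R) : \sum_j f j + \sum_j g j = \sum_j (f j + g j).
  by rewrite big_split.
split; [exact: gauss_obs_lin|exact: gauss_obs_lin| |].
- rewrite (_ : (fun _ => _) =
      obs_lin (a + a') (fun j => w j + w' j) (e + e')); last first.
    by apply/funext => o; rewrite obs_linD.
  have -> : obs_cov a w e a w e + obs_cov a' w' e' a' w' e' +
      2 * obs_cov a w e a' w' e' =
    obs_cov (a + a') (fun j => w j + w' j) (e + e')
      (a + a') (fun j => w j + w' j) (e + e'); last exact: gauss_obs_lin.
  rewrite /obs_cov.
  have -> : \sum_j covZW S j * (w j + w' j) =
      \sum_j covZW S j * w j + \sum_j covZW S j * w' j.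
    by rewrite sumE; apply: eq_bigr => j _; rewrite mulrDr.
  have -> : \sum_j (w j + w' j) * (w j + w' j) =
      \sum_j w j * w j + \sum_j w' j * w' j + 2 * \sum_j w j * w' j.
    by rewrite mulr_sumr !sumE; apply: eq_bigr => j _; ring.
  ring.
- rewrite (_ : (fun _ => _) =
      obs_lin (a - a') (fun j => w j - w' j) (e - e')); last first.
    by apply/funext => o; rewrite obs_linB.
  have -> : obs_cov a w e a w e + obs_cov a' w' e' a' w' e' -
      2 * obs_cov a w e a' w' e' =
    obs_cov (a - a') (fun j => w j - w' j) (e - e')
      (a - a') (fun j => w j - w' j) (e - e'); last exact: gauss_obs_lin.
  rewrite /obs_cov.
  have -> : \sum_j covZW S j * (w j - w' j) =
      \sum_j covZW S j * w j - \sum_j covZW S j * w' j.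
    by rewrite -sumrB; apply: eq_bigr => j _; rewrite mulrBr.
  have -> : \sum_j (w j - w' j) * (w j - w' j) =
      \sum_j w j * w j + \sum_j w' j * w' j - 2 * \sum_j w j * w' j.
    by rewrite mulr_sumr sumE -sumrB; apply: eq_bigr => j _; ring.
  ring.
Qed.

Definition single (i j : 'I_d) : R := (j == i)%:R.

Lemma sum_single (f : 'I_d -> R) i : \sum_j f j * single i j = f i.
Proof.
rewrite (bigD1 i)//= /single eqxx mulr1 big1 ?addr0// => j /negbTE->.
by rewrite mulr0.
Qed.

Lemma sum_single_l (f : 'I_d -> R) i : \sum_j single i j * f j = f i.
Proof. by rewrite -[RHS](sum_single f); apply: eq_bigr => j _; rewrite mulrC. Qed.

Lemma obs_Z_lin : @obs_Z R d = obs_lin 1 (fun=> 0) 0.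
Proof.
apply/funext => o; rewrite /obs_lin big1 ?mul1r ?mul0r ?addr0//.
by move=> j _; rewrite mul0r.
Qed.

Lemma obs_Wj_lin i : obs_Wj i = obs_lin 0 (single i) 0.
Proof. by apply/funext => o; rewrite /obs_lin sum_single_l !mul0r add0r addr0. Qed.

Lemma obs_y_lin : @obs_y R d = obs_lin (beta theta) (fun j => gamma theta j 0) 1.
Proof.
apply/funext => o; rewrite /obs_lin mul1r noiseE.
have -> : \sum_j obs_Wj j o * gamma theta j 0 = \sum_j gamma theta j 0 * obs_Wj j o.
  by apply: eq_bigr => j _; rewrite mulrC.
ring.
Qed.

Lemma obs_W_lin (v : 'I_d -> R) : (fun o => \sum_j v j * obs_Wj j o) = obs_lin 0 v 0.
Proof. by apply/funext => o; rewrite /obs_lin !mul0r add0r addr0. Qed.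

Definition covyW (j : 'I_d) : R := beta theta * covZW S j + gamma theta j 0.

Definition vary : R := obs_cov (beta theta) (fun j => gamma theta j 0) 1
  (beta theta) (fun j => gamma theta j 0) 1.

Lemma pair_Z_W j : gauss_pair P (@obs_Z R d) (obs_Wj j) (varZ S) 1 (covZW S j).
Proof.
rewrite obs_Z_lin obs_Wj_lin.
have := obs_gauss_pair 1 (fun=> 0) 0 0 (single j) 0; rewrite /obs_cov !sum_single.
rewrite /single eqxx !(big1 _ _ (fun j => covZW S j * 0)); last by move=> *; rewrite mulr0.
rewrite !(big1 _ _ (fun j => 0 * _)); last by move=> *; rewrite mul0r.
by rewrite !(mul0r, mul1r, mulr0, addr0, add0r, mulr1).
Qed.

Lemma pair_y_W j : gauss_pair P (@obs_y R d) (obs_Wj j) vary 1 (covyW j).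
Proof.
rewrite obs_y_lin obs_Wj_lin.
have := obs_gauss_pair (beta theta) (fun j => gamma theta j 0) 1 0 (single j) 0.
rewrite -/vary /obs_cov !sum_single.
by rewrite {1 2}/single eqxx !(mul0r, mul1r, mulr0, addr0, add0r, mulr1).
Qed.

Lemma pair_Z_y : gauss_pair P (@obs_Z R d) (@obs_y R d) (varZ S) vary
  (beta theta * varZ S + \sum_j covZW S j * gamma theta j 0).
Proof.
rewrite obs_Z_lin obs_y_lin.
have := obs_gauss_pair 1 (fun=> 0) 0 (beta theta) (fun j => gamma theta j 0) 1.
rewrite -/vary /obs_cov.
rewrite !(big1 _ _ (fun j => covZW S j * 0)); last by move=> *; rewrite mulr0.
rewrite !(big1 _ _ (fun j => 0 * _)); try by move=> *; rewrite mul0r.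
by rewrite !(mul0r, mul1r, mulr0, addr0, add0r, mulr1).
Qed.

Lemma pair_Z_Z : gauss_pair P (@obs_Z R d) (@obs_Z R d) (varZ S) (varZ S) (varZ S).
Proof.
rewrite obs_Z_lin.
have := obs_gauss_pair 1 (fun=> 0) 0 1 (fun=> 0) 0.
rewrite /obs_cov.
rewrite !(big1 _ _ (fun j => covZW S j * 0)); last by move=> *; rewrite mulr0.
rewrite !(big1 _ _ (fun j => 0 * _)); try by move=> *; rewrite mul0r.
by rewrite !(mul0r, mul1r, mulr0, addr0, add0r, mulr1).
Qed.

Lemma gauss_W (v : 'I_d -> R) :
  gauss P (fun o => \sum_j v j * obs_Wj j o) (\sum_j v j ^+ 2).
Proof.
rewrite obs_W_lin; have := gauss_obs_lin 0 v 0.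
rewrite /obs_cov !(mul0r, add0r, addr0).
by rewrite (eq_bigr (fun j => v j ^+ 2))// => j _; rewrite expr2.
Qed.

End obs_gauss.

(** * Splitting the sample, and integrals under the law of the data *)

Lemma ge0_integral_prod d1 d2 (T1 : measurableType d1) (T2 : measurableType d2)
    (R : realType) (P1 : probability T1 R) (P2 : probability T2 R)
    (F : T1 * T2 -> \bar R) :
  measurable_fun setT F -> (forall z, 0 <= F z)%E ->
  (\int[P1 \x P2]_z F z = \int[P1]_x \int[P2]_y F (x, y))%E.
Proof. by move=> mF F0; rewrite fubini_tonelli1. Qed.

Section splitting.
Context {dT} {T : measurableType dT} {R : realType} (P : probability T R).
Context (m1 m2 m3 : nat).
Local Open Scope ereal_scope.

Definition split3 (D : (m1 + (m2 + m3)).-tuple T) :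
    m1.-tuple T * (m2.-tuple T * m3.-tuple T) :=
  ([tuple tnth D (lshift (m2 + m3) i) | i < m1],
   ([tuple tnth D (rshift m1 (lshift m3 i)) | i < m2],
    [tuple tnth D (rshift m1 (rshift m2 i)) | i < m3])).

Lemma measurable_split3 : measurable_fun setT split3.
Proof.
have mt n (f : 'I_n -> 'I_(m1 + (m2 + m3))) :
    measurable_fun setT (fun D : (m1 + (m2 + m3)).-tuple T => [tuple tnth D (f i) | i < n]).
  apply/measurable_fun_tnthP => i.
  rewrite (_ : _ \o _ = fun D : (m1 + (m2 + m3)).-tuple T => tnth D (f i)).
    exact: measurable_tnth.
  by apply/funext => D /=; rewrite tnth_mktuple.
by apply: measurable_fun_pair; [exact: mt|apply: measurable_fun_pair; exact: mt].
Qed.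

Lemma split3_cat (t : m1.-tuple T) (u : m2.-tuple T) (v : m3.-tuple T) :
  split3 [tuple of t ++ [tuple of u ++ v]] = (t, (u, v)).
Proof.
congr (_, (_, _)); apply: eq_from_tnth => i; rewrite tnth_mktuple.
- by rewrite tnth_lshift.
- by rewrite tnth_rshift tnth_lshift.
- by rewrite tnth_rshift tnth_rshift.
Qed.

Lemma integral_split3 (F : m1.-tuple T * (m2.-tuple T * m3.-tuple T) -> \bar R) :
  measurable_fun setT F -> (forall z, 0 <= F z) ->
  \int[iid_power P (m1 + (m2 + m3))]_D F (split3 D) =
  \int[iid_power P m1 \x (iid_power P m2 \x iid_power P m3)]_z F z.
Proof.
move=> mF F0; rewrite (iid_power_cat P (m := m1)); last 2 first.
- by apply: (measurableT_comp mF); exact: measurable_split3.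
- by move=> D; exact: F0.
rewrite (ge0_integral_prod _ _ mF F0); apply: eq_integral => t _.
have mFt : measurable_fun setT (fun u => F (t, u)).
  by apply: (measurableT_comp mF); exact: measurable_fun_pair.
have mcat : measurable_fun setT
    (fun u : (m2 + m3).-tuple T => [tuple of t ++ u]).
  have mp : measurable_fun setT (fun u : (m2 + m3).-tuple T => (t, u)).
    exact: measurable_fun_pair.
  exact: (measurableT_comp (measurable_cat (n := m2 + m3)) mp).
rewrite (ge0_integral_prod _ _ mFt (fun u => F0 _)).
rewrite (iid_power_cat P (m := m2)); last 2 first.
- exact: (measurableT_comp (measurableT_comp mF measurable_split3) mcat).
- by move=> D; exact: F0.
apply: eq_integral => u _.
apply: eq_integral => v _.
rewrite -split3_cat.
by [].
Qed.

End splitting.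

Lemma integral_iid_law (R : realType) n d (P : probability (obs (R := R) d) R)
    (Q : probability (data n d) R) (F : data n d -> \bar R) :
  iid_law P Q -> (\int[Q]_D F D = \int[iid_power P n]_D F D)%E.
Proof.
move=> PQ; apply: eq_measure_integral => A mA _; exact: iid_power_unique.
Qed.

Lemma markov_le d (T : measurableType d) (R : realType) (P : probability T R)
    (e : T -> R) (A : set T) (k h : R) : measurable A -> measurable_fun setT e ->
  0 < h -> (forall t, 0 <= e t) -> (forall t, A t -> h <= e t) ->
  (\int[P]_t (e t)%:E <= k%:E)%E -> (P A <= (k / h)%:E)%E.
Proof.
move=> mA me h0 e0 Ae ek.
have hi0 : 0 <= h^-1 by rewrite invr_ge0 ltW.
rewrite -[A]setIT -integral_indic//.
apply: (@le_trans _ _ (\int[P]_t (h^-1 * e t)%:E)%E).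
  apply: le_int; [by []|by apply: measurable_funM|move=> t].
  rewrite indicE; case: (boolP (t \in A)) => tA /=.
    by rewrite ler01/= mulrC ler_pdivlMr// mul1r; apply: Ae; exact: set_mem.
  by rewrite lexx/= mulr_ge0.
rewrite (intZ P)// mulrC EFinM; apply: lee_wpmul2l => //.
Qed.

(** * Upper bound *)

Section rate.
Context {R : realType}.

(** In [error_rate] the first four terms multiply [w^-1] and the last two multiply
    [s * N^-1 * L]. *)
Definition rate_cst (K : R) : R :=
  8 * (64 * K ^+ 2) + 16 * (64 * K ^+ 2 * K) + 64 * (64 * K ^+ 2) ^+ 2 + 1 +
  2 * (80 * K) ^+ 2 + 8 * (64 * K ^+ 2).

(** With these [lam] and [tau] the exponent of [tail] is [- (19 / 4) * (a1 / N) * L <= - L], so the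
    false detections among at most [expR L] coordinates have total mass of order 1. Hence
    [B <= 2 * N], and division by [a2 * a3] brings the products of errors down to order 1 / N. *)
Lemma error_rate (K N L s a1 a2 a3 dR : R) : 1 <= K -> 4 <= N -> 1 <= L ->
  0 <= s -> L <= N -> 0 <= dR <= expR L ->
  N / 4 <= a1 -> N / 4 <= a2 -> N / 4 <= a3 ->
  forall lam tau w Q tail B,
  lam = 80 * K * Num.sqrt (L / N) ->
  tau = Num.sqrt (L / N) / (8 * K) ->
  w = Num.sqrt N ->
  Q = 64 * K ^+ 2 ->
  tail = expR (16 * K ^+ 2 * tau ^+ 2 * a1 - tau * a1 * lam / 2) ->
  B = 8 * K / lam ^+ 2 + 4 * dR * tail ->
  is_true (2 * w * (Q / a2 + Q * K / a2 + Q * K / a3 + Q ^+ 2 * B / (a2 * a3)) +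
    (2 * w)^-1 + s * (2 * lam ^+ 2 + Q / a1 + Q / a1) <=
    rate_cst K * (w^-1 + s * N^-1 * L)).
Proof.
move=> K1 N4 L1 s0 LN /andP[d0 dL] h1 h2 h3 lam tau w Q tail B El Et Ew EQ Etl EB.
have K0 : 0 < K by lra. have N0 : 0 < N by lra. have L0 : 0 < L by lra.
have LN0 : 0 < L / N by rewrite divr_gt0.
have w0 : 0 < w by rewrite Ew sqrtr_gt0.
have w2 : w ^+ 2 = N by rewrite Ew sqr_sqrtr// ltW.
have q2 : Num.sqrt (L / N) ^+ 2 = L / N by rewrite sqr_sqrtr// ltW.
have lam2 : lam ^+ 2 = (80 * K) ^+ 2 * (L / N) by rewrite El exprMn q2.
have Q0 : 0 <= Q by rewrite EQ mulr_ge0// sqr_ge0.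
have inv a : N / 4 <= a -> 0 < a /\ a^-1 <= 4 / N.
  move=> ha; have a0 : 0 < a by apply: lt_le_trans ha; rewrite divr_gt0.
  split=> //; rewrite -[4 / N]invf_div lef_pV2 ?posrE// divr_gt0//.
have [a10 i1] := inv _ h1; have [a20 i2] := inv _ h2; have [a30 i3] := inv _ h3.
have tailE : tail <= expR (- L).
  rewrite Etl ler_expR.
  have -> : 16 * K ^+ 2 * tau ^+ 2 * a1 - tau * a1 * lam / 2 =
      - (19 / 4) * (a1 / N) * L.
    rewrite Et El expr_div_n q2.
    rewrite (_ : _ / (8 * K) * a1 * _ / 2 = 5 * a1 * Num.sqrt (L / N) ^+ 2); last first.
      by field; rewrite gt_eqF.
    by rewrite q2; field; rewrite !gt_eqF.
  have : 1 / 4 <= a1 / N by rewrite ler_pdivlMr//; lra.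
  move: (a1 / N) => x hx.
  have : 0 <= (x - 1 / 4) * L by apply: mulr_ge0; lra.
  nra.
have dtail : dR * tail <= 1.
  apply: (@le_trans _ _ (expR L * expR (- L))).
    by apply: ler_pM => //; rewrite Etl expR_ge0.
  by rewrite expRxMexpNx_1.
have BN : B <= 2 * N.
  have : 8 * K / lam ^+ 2 <= N.
    have K80 : 0 < 80 * K by apply: mulr_gt0.
    have lp : 0 < (80 * K) ^+ 2 * (L / N) by apply: mulr_gt0 => //; exact: exprn_gt0.
    rewrite lam2 ler_pdivrMr//.
    rewrite (_ : N * _ = 6400 * K ^+ 2 * L); last by field; rewrite gt_eqF.
    by nra.
  (* [4 * dR * tail <= 4 <= N]. *)
  by rewrite EB; lra.
have iN0 : 0 <= 4 / N by rewrite divr_ge0// ltW.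
have QK0 : 0 <= Q * K by rewrite mulr_ge0// ltW.
have t1 : Q / a2 <= Q * (4 / N) by rewrite ler_wpM2l.
have t2 : Q * K / a2 <= Q * K * (4 / N) by rewrite ler_wpM2l.
have t3 : Q * K / a3 <= Q * K * (4 / N) by rewrite ler_wpM2l.
have t4 : Q ^+ 2 * B / (a2 * a3) <= Q ^+ 2 * (32 / N).
  rewrite -mulrA ler_wpM2l ?sqr_ge0//.
  apply: (@le_trans _ _ (2 * N * ((4 / N) * (4 / N)))).
    rewrite invfM; apply: (@le_trans _ _ (2 * N * (a2^-1 * a3^-1))).
      apply: ler_wpM2r => //; apply: mulr_ge0; rewrite invr_ge0; exact: ltW.
    apply: ler_wpM2l; first by apply: mulr_ge0 => //; exact: ltW.
    by apply: ler_pM => //; rewrite invr_ge0 ltW.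
  by rewrite le_eqVlt; apply/orP; left; apply/eqP; field; rewrite gt_eqF.
have t5 : Q / a1 <= Q * (4 * (L / N)).
  rewrite ler_wpM2l//; apply: le_trans i1 _.
  by rewrite mulrA ler_pM2r ?invr_gt0//; lra.
have hw : 2 * w * (Q / a2 + Q * K / a2 + Q * K / a3 + Q ^+ 2 * B / (a2 * a3)) <=
    (8 * Q + 16 * (Q * K) + 64 * Q ^+ 2) * w^-1.
  rewrite (_ : (_ + 64 * Q ^+ 2) * w^-1 =
    2 * w * (Q * (4 / N) + Q * K * (4 / N) + Q * K * (4 / N) + Q ^+ 2 * (32 / N))).
    by apply: ler_wpM2l; [apply: mulr_ge0 => //; exact: ltW|lra].
  by rewrite -w2; field; rewrite gt_eqF.
have hs : s * (2 * lam ^+ 2 + Q / a1 + Q / a1) <=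
    (2 * (80 * K) ^+ 2 + 8 * Q) * (s * N^-1 * L).
  rewrite (_ : (_ + 8 * Q) * _ = s * (2 * ((80 * K) ^+ 2 * (L / N)) +
    Q * (4 * (L / N)) + Q * (4 * (L / N)))); last by field; rewrite gt_eqF.
  by apply: ler_wpM2l => //; rewrite lam2; lra.
have wi0 : 0 <= w^-1 by rewrite invr_ge0 ltW.
have sl0 : 0 <= s * N^-1 * L by apply: mulr_ge0;
  [apply: mulr_ge0 => //; rewrite invr_ge0|]; exact: ltW.
have Q20 : 0 <= Q ^+ 2 by exact: sqr_ge0.
have K20 : 0 <= (80 * K) ^+ 2 by exact: sqr_ge0.
rewrite /rate_cst -EQ invfM.
nra.
Qed.

End rate.

(** The arithmetic behind [vary_le_cst]: [bc] stands for beta times the inner product of [eta] and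
    gamma, and its bound is Young's inequality. *)
Lemma vary_le_arith (R : realType) (M e g z m1 m2 s2 b2 bc : R) : 1 < M ->
  0 <= b2 -> 0 <= e -> 0 <= g -> z <= 2 * M -> e <= 2 * M -> b2 + g <= m2 ->
  s2 <= m1 -> 2 * bc <= b2 * e + g ->
  b2 * z + bc + bc + g + s2 <= 1 + 2 * M + m2 * (4 * M + 2) + m1.
Proof.
move=> M1 b0 e0 g0 zM eM bg sm h.
have : b2 * e <= m2 * (2 * M) by apply: ler_pM => //; lra.
have : b2 * z <= b2 * (2 * M) by apply: ler_wpM2l.
have : b2 * (2 * M) <= m2 * (2 * M) by apply: ler_wpM2r; lra.
lra.
Qed.

Section theta_facts.
Context {R : realType} {d : nat}.
Variables (M M1 M2 : R) (theta : param (R := R) d).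
Hypotheses (hM : 1 < M) (hM1 : 0 < M1) (hM2 : 0 < M2) (hT : Theta M M1 M2 theta).
Local Notation S := (Sigma theta).

Local Ltac slra := have := hM; lra.

Lemma Theta_trmx : S^T = S. Proof. by case: hT. Qed.
Lemma Theta_drsubmx : drsubmx S = 1%:M. Proof. by case: hT. Qed.
Lemma Theta_tau : M^-1 ^+ 2 <= varZ S - \sum_j covZW S j ^+ 2.
Proof. by case: hT => sS hl dS _ _; case: (Sigma_bounds hM sS dS hl). Qed.
Lemma Theta_varZ : varZ S <= 2 * M.
Proof. by case: hT => sS hl dS _ _; case: (Sigma_bounds hM sS dS hl). Qed.
Lemma Theta_tau_gt0 : 0 < varZ S - \sum_j covZW S j ^+ 2.
Proof. by apply: lt_le_trans Theta_tau; rewrite exprn_gt0// invr_gt0; slra. Qed.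
Lemma Theta_cov : \sum_j covZW S j ^+ 2 <= 2 * M.
Proof. by have := Theta_tau_gt0; have := Theta_varZ; slra. Qed.
Lemma Theta_sigma : 0 <= sigma theta <= M1. Proof. by case: hT. Qed.

Lemma Theta_norm : beta theta ^+ 2 + \sum_j gamma theta j 0 ^+ 2 <= M2 ^+ 2.
Proof.
case: hT => _ _ _ _; rewrite /norm2 big_split_ord/= big_ord1 col_mxEu mxE eqxx mulr1n.
under eq_bigr do rewrite col_mxEd.
set x := _ + _ => h; have x0 : 0 <= x.
  by rewrite /x addr_ge0 ?sqr_ge0//; apply: sumr_ge0 => j _; exact: sqr_ge0.
by rewrite -(sqr_sqrtr x0) ler_pXn2r ?nnegrE ?sqrtr_ge0// ltW.
Qed.

(** One bound for Var Z, Var y and the squared norms of their covariances with W; it serves as [K]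
    in the error of the estimator. *)
Definition moment_cst : R := 1 + 2 * M + M2 ^+ 2 * (4 * M + 2) + M1 ^+ 2.

Lemma moment_cst_ge1 : 1 <= moment_cst.
Proof.
rewrite /moment_cst; have := sqr_ge0 M1.
have : 0 <= M2 ^+ 2 * (4 * M + 2) by rewrite mulr_ge0 ?sqr_ge0//; slra.
slra.
Qed.

Lemma Theta_beta_abs : `|beta theta| <= M2.
Proof.
rewrite -(@ler_pXn2r _ 2) ?nnegrE ?normr_ge0 ?(ltW hM2)// real_normK ?num_real//.
have : 0 <= \sum_j gamma theta j 0 ^+ 2 by apply: sumr_ge0 => j _; exact: sqr_ge0.
by have := Theta_norm; lra.
Qed.

Lemma varZ_le_cst : varZ S <= moment_cst.
Proof.
rewrite /moment_cst; have := Theta_varZ; have := sqr_ge0 M1.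
have : 0 <= M2 ^+ 2 * (4 * M + 2) by rewrite mulr_ge0 ?sqr_ge0//; slra.
slra.
Qed.

Lemma cov_le_cst : \sum_j covZW S j ^+ 2 <= moment_cst.
Proof. by have := Theta_tau_gt0; have := varZ_le_cst; slra. Qed.

Lemma covyW_le_cst : \sum_j covyW theta j ^+ 2 <= moment_cst.
Proof.
apply: (@le_trans _ _ (2 * beta theta ^+ 2 * (\sum_j covZW S j ^+ 2) +
    2 * \sum_j gamma theta j 0 ^+ 2)).
  rewrite !mulr_sumr -big_split/=; apply: ler_sum => j _; rewrite /covyW.
  have := sqr_ge0 (beta theta * covZW S j - gamma theta j 0); nra.
have := Theta_norm; have := Theta_cov.
have : 0 <= \sum_j gamma theta j 0 ^+ 2 by apply: sumr_ge0 => j _; exact: sqr_ge0.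
have : 0 <= \sum_j covZW S j ^+ 2 by apply: sumr_ge0 => j _; exact: sqr_ge0.
have := sqr_ge0 (beta theta); have := sqr_ge0 M1.
rewrite /moment_cst; move: (hM); clear.
move: (\sum_j _ ^+ 2) (\sum_j _ ^+ 2) (beta theta ^+ 2) (M1 ^+ 2) (M2 ^+ 2).
move=> g e b m1 m2 h1 h2 h3 h4 h5 h6 h7.
have : b * e <= m2 * (2 * M) by apply: ler_pM => //; lra.
nra.
Qed.

Lemma vary_le_cst : vary theta <= moment_cst.
Proof.
rewrite /vary /obs_cov.
have -> : \sum_j gamma theta j 0 * gamma theta j 0 = \sum_j gamma theta j 0 ^+ 2.
  by apply: eq_bigr => j _; rewrite expr2.
have h : 2 * beta theta * (\sum_j covZW S j * gamma theta j 0) <=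
    beta theta ^+ 2 * (\sum_j covZW S j ^+ 2) + \sum_j gamma theta j 0 ^+ 2.
  rewrite !mulr_sumr -big_split/=; apply: ler_sum => j _.
  have := sqr_ge0 (beta theta * covZW S j - gamma theta j 0); nra.
have s2 : sigma theta ^+ 2 <= M1 ^+ 2.
  by case/andP: Theta_sigma => s0 s1; rewrite ler_pXn2r ?nnegrE// ltW.
have e0 : 0 <= \sum_j covZW S j ^+ 2 by apply: sumr_ge0 => j _; exact: sqr_ge0.
have g0 : 0 <= \sum_j gamma theta j 0 ^+ 2.
  by apply: sumr_ge0 => j _; exact: sqr_ge0.
rewrite -mulrA in h.
have := vary_le_arith hM (sqr_ge0 (beta theta)) e0 g0 Theta_varZ Theta_cov Theta_norm s2 h.
by rewrite /moment_cst expr2 !mulr1 mul1r.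
Qed.

Lemma Theta_support (s : R) :
  (norm0 (row 0 (invmx S)))%:R <= s -> \sum_j (covZW S j != 0)%:R <= s.
Proof.
rewrite norm0_row_inv_Sigma; [|exact: Theta_trmx|exact: Theta_drsubmx|exact: Theta_tau_gt0].
by rewrite natrD natr_sum; lra.
Qed.

End theta_facts.

Section upper.
Context {R : realType}.
Variables (M M1 M2 alpha : R).
Hypotheses (hM : 1 < M) (hM1 : 0 < M1) (hM2 : 0 < M2) (ha : 0 < alpha).
Local Notation K := (moment_cst M M1 M2).

Section one_law.
Context {d m1 m2 m3 : nat}.
Local Notation n := (m1 + (m2 + m3))%N.
Variables (theta : param (R := R) d) (s L : R) (Q : probability (data (R := R) n d) R).
Hypotheses (hT : Theta_sparse M M1 M2 s theta) (hQ : data_law theta Q).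
Hypotheses (n4 : 4 <= n%:R :> R) (L1 : 1 <= L) (s0 : 0 <= s) (LN : L <= n%:R)
  (dL : d%:R <= expR L).
Hypotheses (h1 : n%:R / 4 <= m1%:R :> R) (h2 : n%:R / 4 <= m2%:R :> R)
  (h3 : n%:R / 4 <= m3%:R :> R).

Let lam : R := 80 * K * Num.sqrt (L / n%:R).

Definition est (V : obs (R := R) d -> R) (D : data (R := R) n d) : R :=
  estimator lam (@obs_Z R d) V (@obs_Wj R d) (split3 D).

Lemma measurable_est V : measurable_fun setT V -> measurable_fun setT (est V).
Proof.
move=> mV; have mZ := @measurable_obs_Z R d; have mW := @measurable_obs_Wj R d.
have ms3 := measurable_split3 (T := obs (R := R) d) (m1 := m1) (m2 := m2) (m3 := m3).
have mz2 : measurable_fun setT (fun D : data (R := R) n d => (split3 D).2.1).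
  exact: (measurableT_comp measurable_fst
    (measurableT_comp measurable_snd ms3)).
have mz3 : measurable_fun setT (fun D : data (R := R) n d => (split3 D).2.2).
  exact: (measurableT_comp measurable_snd
    (measurableT_comp measurable_snd ms3)).
have mz1 : measurable_fun setT (fun D : data (R := R) n d => (split3 D).1).
  exact: (measurableT_comp measurable_fst
    ms3).
rewrite /est /estimator; apply: measurable_funB.
  by apply: (measurableT_comp _ mz2); apply: measurable_avg; exact: measurable_funM.
apply: measurable_sum => j; apply: measurable_funM.
  exact: (measurableT_comp (measurable_kept lam j mZ mV mW) mz1).
apply: measurable_funM.
  by apply: (measurableT_comp _ mz2); apply: measurable_avg; exact: measurable_funM.
by apply: (measurableT_comp _ mz3); apply: measurable_avg; exact: measurable_funM.
Qed.

Let N0 : (0 < n%:R :> R). Proof. by have := n4; lra. Qed.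
Let pos m : n%:R / 4 <= m%:R :> R -> (0 < m)%N.
Proof. by rewrite -(ltr0n R); have := N0; lra. Qed.

Lemma est_error V (vv c0 : R) (xi : 'I_d -> R) (P : probability (obs (R := R) d) R) :
  iid_law P Q ->
  (forall j, gauss_pair P (@obs_Z R d) (obs_Wj j) (varZ (Sigma theta)) 1
     (covZW (Sigma theta) j)) ->
  (forall j, gauss_pair P V (obs_Wj j) vv 1 (xi j)) ->
  gauss_pair P (@obs_Z R d) V (varZ (Sigma theta)) vv c0 ->
  (forall v : 'I_d -> R, gauss P (fun o => \sum_j v j * obs_Wj j o) (\sum_j v j ^+ 2)) ->
  vv <= K -> \sum_j xi j ^+ 2 <= K ->
  (\int[Q]_D (`|est V D - (c0 - \sum_j covZW (Sigma theta) j * xi j)|)%:E <=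
   (rate_cst K * ((Num.sqrt n%:R)^-1 + s * n%:R^-1 * L))%:E)%E.
Proof.
case: hT => hTh hsp.
move=> iidQ gZW gVW gZV gW vvK xiK.
have K1 : 1 <= K by exact: moment_cst_ge1.
have K0 : 0 < K by lra.
have mV : measurable_fun setT V by case: gZV => _ /gauss_meas.
rewrite (integral_iid_law _ iidQ).
set N := c0 - _.
have mF : measurable_fun setT (fun z => (`|estimator (m1 := m1) (m2 := m2) (m3 := m3)
    lam (@obs_Z R d) V (@obs_Wj R d) z - N|)%:E).
  apply/measurable_EFinP; apply: (measurableT_comp (@normr_measurable _ _)).
  apply: measurable_funB => //.
  have mZ := @measurable_obs_Z R d; have mW := @measurable_obs_Wj R d.
  rewrite /estimator; apply: measurable_funB.
    apply: (measurableT_comp (f := avg _)).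
      by apply: measurable_avg; exact: measurable_funM.
    exact: (measurableT_comp measurable_fst measurable_snd).
  apply: measurable_sum => j; apply: measurable_funM.
    exact: (measurableT_comp (measurable_kept lam j mZ mV mW) measurable_fst).
  apply: measurable_funM; apply: (measurableT_comp (f := avg _)).
  - by apply: measurable_avg; exact: measurable_funM.
  - exact: (measurableT_comp measurable_fst measurable_snd).
  - by apply: measurable_avg; exact: measurable_funM.
  - exact: (measurableT_comp measurable_snd measurable_snd).
rewrite (integral_split3 P mF); last by move=> z; rewrite lee_fin.
have LN0 : 0 < L / n%:R by rewrite divr_gt0//; have := L1; lra.
have sq0 : 0 < Num.sqrt (L / n%:R) by rewrite sqrtr_gt0.
have sq1 : Num.sqrt (L / n%:R) <= 1.
  rewrite -(@ler_pXn2r _ 2) ?nnegrE ?sqrtr_ge0// (sqr_sqrtr (ltW LN0)) expr1n.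
  by rewrite ler_pdivrMr// mul1r.
pose tau := Num.sqrt (L / n%:R) / (8 * K).
have K8 : 0 < 8 * K by rewrite mulr_gt0.
have tau0 : 0 <= tau by apply: divr_ge0; exact: ltW.
have tauK : tau <= (8 * K)^-1 by rewrite /tau ler_pdivrMr// mulVf ?gt_eqF.
have lam0 : 0 < lam by rewrite /lam mulr_gt0// mulr_gt0.
have w0 : 0 < Num.sqrt (n%:R : R) by rewrite sqrtr_gt0.
have := int_estimator_error gZW gVW gZV gW K1 (varZ_le_cst hM hTh) vvK
  (cov_le_cst hM hTh) xiK (pos h1) (pos h2) (pos h3) lam0 tau0 tauK w0
  (Theta_support hM hTh hsp).
move=> /le_trans; apply; rewrite lee_fin.
by apply: (@error_rate _ K n%:R L s m1%:R m2%:R m3%:R d%:R) => //; rewrite ler0n.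
Qed.

Lemma est_errors :
  (\int[Q]_D (`|est (@obs_y R d) D - beta theta *
      (varZ (Sigma theta) - \sum_j covZW (Sigma theta) j ^+ 2)|)%:E <=
   (rate_cst K * ((Num.sqrt n%:R)^-1 + s * n%:R^-1 * L))%:E)%E /\
  (\int[Q]_D (`|est (@obs_Z R d) D -
      (varZ (Sigma theta) - \sum_j covZW (Sigma theta) j ^+ 2)|)%:E <=
   (rate_cst K * ((Num.sqrt n%:R)^-1 + s * n%:R^-1 * L))%:E)%E.
Proof.
case: (hT) => hTh _; case: hQ => P oP iidQ.
have sS := Theta_trmx hTh; have dS := Theta_drsubmx hTh.
have t0 := ltW (Theta_tau_gt0 hM hTh).
have /andP[sg0 _] := Theta_sigma hTh.
have gZW := pair_Z_W oP sS dS t0 sg0.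
have gW := gauss_W oP sS dS t0 sg0.
split.
- rewrite (_ : _ * (_ - _) = beta theta * varZ (Sigma theta) +
      \sum_j covZW (Sigma theta) j * gamma theta j 0 -
      \sum_j covZW (Sigma theta) j * covyW theta j); last first.
    have -> : \sum_j covZW (Sigma theta) j * covyW theta j =
        beta theta * (\sum_j covZW (Sigma theta) j ^+ 2) +
        \sum_j covZW (Sigma theta) j * gamma theta j 0.
      rewrite mulr_sumr -big_split/=; apply: eq_bigr => j _.
      by rewrite /covyW; ring.
    ring.
  apply: (est_error iidQ gZW (pair_y_W oP sS dS t0 sg0) (pair_Z_y oP sS dS t0 sg0) gW).
  + exact: (vary_le_cst hM hM1 hM2 hTh).
  + exact: (covyW_le_cst hM hM2 hTh).
- have -> : \sum_j covZW (Sigma theta) j ^+ 2 =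
      \sum_j covZW (Sigma theta) j * covZW (Sigma theta) j.
    by apply: eq_bigr => j _; rewrite expr2.
  apply: (est_error iidQ gZW gZW (pair_Z_Z oP sS dS t0 sg0) gW).
  + exact: (varZ_le_cst hM hTh).
  + exact: (cov_le_cst hM hTh).
Qed.

End one_law.
End upper.

(** * From the two estimates to a confidence interval *)

Lemma minimax_diam_le (R : realType) n d (alpha H : R)
    (Theta0 Theta1 : set (param (R := R) d)) (c : data n d -> R) :
  measurable_fun setT c -> 0 <= H ->
  (forall theta (Q : probability (data n d) R), Theta0 theta -> data_law theta Q ->
    ((1 - alpha)%:E <= Q [set D | (c D - H <= beta theta <= c D + H)%R])%E) ->
  (minimax_diam n alpha Theta0 Theta1 <= (2 * H)%:E)%E.
Proof.
move=> mc H0 cov.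
(* The length is deterministic, so its mean is [2 * H] under every law, whatever [Theta1], and only
   coverage has to be checked. *)
pose CI : (data n d -> R) * (data n d -> R) := (fun D => c D - H, fun D => c D + H).
apply: (@le_trans _ _ (max_expected_diam (n := n) Theta1 CI)).
  apply: ereal_inf_lbound; exists CI => //; split => /=.
  - exact: measurable_funB.
  - exact: measurable_funD.
  - by move=> D; lra.
  - apply: le_ereal_inf_tmp => _ [theta [Q [h1 h2 ->]]]; exact: cov.
apply: ge_ereal_sup => _ [theta [Q [_ _ ->]]].
rewrite (_ : (\int[Q]_D _)%E = (\int[Q]_D (2 * H)%:E)%E).
  by rewrite integral_prob_cst.
by apply: eq_integral => D _ /=; congr EFin; ring.
Qed.

(** In [y / z - b = (y - b * z) / z] the numerator is at most [(1 + M2) * h], and the denominator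
    stays above half of the lower bound on [t]. *)
Lemma ratio_error (R : realType) (M M2 b t h y z : R) : 1 < M -> 0 <= h ->
  M^-1 ^+ 2 <= t -> `|b| <= M2 -> h <= M^-1 ^+ 2 / 2 ->
  `|y - b * t| <= h -> `|z - t| <= h ->
  y / z - 2 * M ^+ 2 * (1 + M2) * h <= b <= y / z + 2 * M ^+ 2 * (1 + M2) * h.
Proof.
move=> M1 h0 tM bM hM hy hz; have M0 : 0 < M by lra.
have zt : M^-1 ^+ 2 / 2 <= z by move: hz; rewrite ler_norml; lra.
have Mi0 : 0 < M^-1 ^+ 2 by rewrite exprn_gt0// invr_gt0.
have z0 : 0 < z by lra.
have hd : `|y - b * z| <= (1 + M2) * h.
  rewrite (_ : y - b * z = (y - b * t) - b * (z - t)); last by ring.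
  apply: le_trans (ler_normB _ _) _; rewrite mulrDl mul1r lerD// normrM.
  by apply: ler_pM.
have zi : z^-1 <= 2 * M ^+ 2.
  rewrite -[leRHS]invrK lef_pV2 ?posrE ?invr_gt0 ?mulr_gt0 ?exprn_gt0//.
  by rewrite invfM mulrC -exprVn.
have : `|y / z - b| <= 2 * M ^+ 2 * (1 + M2) * h.
  rewrite (_ : y / z - b = z^-1 * (y - b * z)); last by field; rewrite gt_eqF.
  rewrite normrM gtr0_norm ?invr_gt0// -mulrA.
  by apply: ler_pM => //; rewrite invr_ge0 ltW.
by rewrite ler_norml => /andP[h1 h2]; apply/andP; split; lra.
Qed.

(* [powR] makes the measurability of the inverse immediate. *)
Definition safe_ratio (R : realType) (q y z : R) : R := y * (Num.max z q) `^ (-1).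

Lemma measurable_safe_ratio (R : realType) d (T : measurableType d) (q : R)
    (y z : T -> R) : measurable_fun setT y -> measurable_fun setT z ->
  measurable_fun setT (fun D => safe_ratio q (y D) (z D)).
Proof.
move=> my mz; apply: measurable_funM => //.
apply: (measurableT_comp (@measurable_powR R (-1))).
by apply: measurable_maxr.
Qed.

Lemma safe_ratioE (R : realType) (q y z : R) : 0 <= q -> q <= z ->
  safe_ratio q y z = y / z.
Proof.
move=> q0 qz; rewrite /safe_ratio max_l// powR_inv1//.
exact: le_trans qz.
Qed.

(** Markov's inequality for the sum of the two errors. Where the sum is below [h], the floor in
    [safe_ratio] is inactive and [ratio_error] applies. *)
Lemma ratio_coverage (R : realType) n d (Q : probability (data (R := R) n d) R)
    (M M2 b t h alpha k : R) (y z : data n d -> R) : 1 < M -> 0 < h ->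
  M^-1 ^+ 2 <= t -> `|b| <= M2 -> h <= M^-1 ^+ 2 / 2 ->
  measurable_fun setT y -> measurable_fun setT z ->
  (\int[Q]_D (`|y D - b * t|)%:E <= k%:E)%E ->
  (\int[Q]_D (`|z D - t|)%:E <= k%:E)%E -> 2 * k / h <= alpha ->
  ((1 - alpha)%:E <= Q [set D |
    (safe_ratio (M^-1 ^+ 2 / 2) (y D) (z D) - 2 * M ^+ 2 * (1 + M2) * h <= b <=
     safe_ratio (M^-1 ^+ 2 / 2) (y D) (z D) + 2 * M ^+ 2 * (1 + M2) * h)%R])%E.
Proof.
move=> M1 h0 tM bM hM my mz ey ez ka.
set A := [set D | _].
pose e D := `|y D - b * t| + `|z D - t|.
have me1 : measurable_fun setT (fun D => `|y D - b * t|).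
  by apply: (measurableT_comp (@normr_measurable _ _)); exact: measurable_funB.
have me2 : measurable_fun setT (fun D => `|z D - t|).
  by apply: (measurableT_comp (@normr_measurable _ _)); exact: measurable_funB.
have me : measurable_fun setT e by exact: measurable_funD.
pose G := [set D | e D < h].
have mG : measurable G.
  rewrite (_ : G = e @^-1` `]-oo, h[%classic).
    by rewrite -[X in measurable X]setTI; apply: me => //; exact: measurable_itv.
  by apply/seteqP; split => D; rewrite /G/= in_itv.
pose r D := safe_ratio (M^-1 ^+ 2 / 2) (y D) (z D).
have mr : measurable_fun setT r by exact: measurable_safe_ratio.
pose H := 2 * M ^+ 2 * (1 + M2) * h.
have mA : measurable A.
  rewrite (_ : A = r @^-1` `[(b - H), (b + H)]%classic).
    by rewrite -[X in measurable X]setTI; apply: mr => //; exact: measurable_itv.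
  apply/seteqP; split => D; rewrite /A/= in_itv/= -/(r D) -/H => /andP[h1 h2];
    apply/andP; split; lra.
have GA : G `<=` A.
  move=> D; rewrite /G /e /A /= => eh.
  have := normr_ge0 (y D - b * t); have := normr_ge0 (z D - t) => n1 n2.
  have hy : `|y D - b * t| <= h by lra.
  have hz : `|z D - t| <= h by lra.
  rewrite safe_ratioE; first exact: (ratio_error M1 (ltW h0) tM bM hM hy hz).
    by rewrite divr_ge0// sqr_ge0.
  by move: hz; rewrite ler_norml => /andP[hz _]; lra.
have QG : (Q (~` G) <= (2 * k / h)%:E)%E.
  apply: (@markov_le _ _ _ Q e (~` G) (2 * k) h) => //.
  - exact: measurableC.
  - by move=> D; rewrite addr_ge0.
  - by move=> D; rewrite /G /= => /negP; rewrite -leNgt.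
  rewrite intD;
    [|exact: me1|exact: me2|by move=> D; exact: normr_ge0|by move=> D; exact: normr_ge0].
  by rewrite mulr_natl mulr2n EFinD; exact: leeD.
apply: (@le_trans _ _ (Q G)); last by apply: le_measure => //; rewrite inE.
have -> : Q G = (1 - Q (~` G))%E.
  by rewrite -[in LHS](setCK G) probability_setC//; exact: measurableC.
rewrite EFinB; apply: leeB => //; apply: (le_trans QG); by rewrite lee_fin.
Qed.

Lemma split_in_three n : (8 <= n)%N -> exists m1 m2 m3 : nat,
  [/\ n = (m1 + (m2 + m3))%N, (n <= 4 * m1)%N, (n <= 4 * m2)%N & (n <= 4 * m3)%N].
Proof.
move=> n8; exists (n %/ 3)%N, (n %/ 3)%N, (n - (n %/ 3 + n %/ 3))%N.
have := divn_eq n 3; have := ltn_mod n 3; rewrite /=.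
move: (n %/ 3)%N (n %% 3)%N => q r r3 nq.
by split; lia.
Qed.

Theorem upper_bound (R : realType) (M M1 M2 alpha : R) : 1 < M -> 0 < M1 ->
  0 < M2 -> 0 < alpha ->
  exists2 C : R, 0 < C & forall (n d : nat) (s L : R)
    (Theta1 : set (param (R := R) d)),
    (8 <= n)%N -> 1 <= L -> 0 <= s -> L <= n%:R -> d%:R <= expR L ->
    (minimax_diam n alpha (Theta_sparse M M1 M2 s) Theta1 <=
      (C * ((Num.sqrt n%:R)^-1 + s * n%:R^-1 * L))%:E)%E.
Proof.
move=> hM hM1 hM2 ha; have M0 : 0 < M by lra.
pose C0 := rate_cst (moment_cst M M1 M2).
have C00 : 0 < C0.
  rewrite /C0 /rate_cst; have := @moment_cst_ge1 _ M M1 M2 hM.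
  move: (moment_cst M M1 M2) => K K1; have := sqr_ge0 (64 * K ^+ 2).
  have := sqr_ge0 (80 * K); have : 0 <= K ^+ 2 * K by apply: mulr_ge0; [exact: sqr_ge0|lra].
  have := sqr_ge0 K; nra.
pose A := 2 * M ^+ 2 * (1 + M2).
have A0 : 0 < A by rewrite /A mulr_gt0//; [rewrite mulr_gt0// exprn_gt0|lra].
have C1 : 0 < 2 * A * (2 * C0 / alpha).
  by apply: mulr_gt0; [exact: mulr_gt0|apply: divr_gt0 => //; exact: mulr_gt0].
exists (2 * A * (2 * C0 / alpha)) => // n d s L Theta1 n8 L1 s0 Ln dL.
have [m1 [m2 [m3 [nE l1 l2 l3]]]] := split_in_three n8.
have quarter m : (n <= 4 * m)%N -> n%:R / 4 <= m%:R :> R.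
  by rewrite -(ler_nat R) natrM; lra.
have {l1} h1 := quarter _ l1; have {l2} h2 := quarter _ l2.
have {quarter l3} h3 := quarter _ l3.
subst n; set n := (m1 + (m2 + m3))%N in n8 Ln h1 h2 h3 *.
set rt := _ + _.
have N8 : 8 <= n%:R :> R by rewrite (ler_nat R 8).
have rt0 : 0 < rt.
  rewrite /rt; apply: ltr_pwDl; first by rewrite invr_gt0 sqrtr_gt0; lra.
  by apply: mulr_ge0; [apply: mulr_ge0 => //; rewrite invr_ge0|]; lra.
(* Makes the Markov bound [2 * (C0 * rt) / h] equal to [alpha]. *)
pose h := 2 * C0 / alpha * rt.
have h0 : 0 < h by rewrite /h; apply: mulr_gt0 => //; apply: divr_gt0 => //; exact: mulr_gt0.
have -> : 2 * A * (2 * C0 / alpha) * rt = 2 * (A * h) by rewrite /h; ring.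
have n4 : 4 <= n%:R :> R by lra.
(* If [h] is too large to keep the denominator away from 0, the rate is bounded below and the
   interval from - M2 to M2 is short enough, because [A * (M^-1 ^+ 2 / 2) = 1 + M2]. *)
have [hs|hb] := lerP h (M^-1 ^+ 2 / 2).
  pose y := est M M1 M2 (m1 := m1) (m2 := m2) (m3 := m3) L (@obs_y R d).
  pose z := est M M1 M2 (m1 := m1) (m2 := m2) (m3 := m3) L (@obs_Z R d).
  have my : measurable_fun setT y by apply: measurable_est; exact: measurable_obs_y.
  have mz : measurable_fun setT z by apply: measurable_est; exact: measurable_obs_Z.
  apply: (@minimax_diam_le _ _ _ _ (A * h) _ _
    (fun D => safe_ratio (M^-1 ^+ 2 / 2) (y D) (z D))).
  - exact: measurable_safe_ratio.
  - by rewrite mulr_ge0// ltW.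
  move=> theta Q hT hQ; have [ey ez] :=
    est_errors hM hM1 hM2 hT hQ n4 L1 s0 Ln dL h1 h2 h3.
  have hTh : Theta M M1 M2 theta by case: hT.
  apply: (ratio_coverage hM h0 (Theta_tau hM hTh) (Theta_beta_abs hM2 hTh) hs my mz ey ez).
  rewrite -/C0 -/rt /h le_eqVlt; apply/orP; left; apply/eqP.
  by field; rewrite !gt_eqF.
apply: (@le_trans _ _ (2 * M2)%:E).
  apply: (@minimax_diam_le _ _ _ _ M2 _ _ (fun=> 0)) => //; first exact: ltW.
  move=> theta Q [hTh _] _.
  rewrite (_ : [set D | _] = setT) ?probability_setT.
    by rewrite lee_fin; lra.
  apply/seteqP; split => // D _ /=; rewrite sub0r add0r -ler_norml.
  exact: (Theta_beta_abs hM2 hTh).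
rewrite lee_fin ler_pM2l//.
have Mi : M ^+ 2 * M^-1 ^+ 2 = 1 by rewrite -exprMn divff ?gt_eqF// expr1n.
apply: (@le_trans _ _ (A * (M^-1 ^+ 2 / 2))); last by rewrite ler_wpM2l// ltW.
rewrite /A (_ : _ * _ = (M ^+ 2 * M^-1 ^+ 2) * (1 + M2)); last by field; rewrite gt_eqF.
by rewrite Mi; lra.
Qed.

(** * Lower bound by second moments *)

(* Second moment method: the chi-square distance of the mixture of the [Q i] to
   [Q0] bounds their difference on the event that the interval contains [b]. *)
Theorem minimax_diam_ge (R : realType) n d (alpha b : R)
    (Theta0 Theta1 : set (param (R := R) d)) (Q0 : probability (data n d) R)
    (theta0 : param d) (I : finType) (Q : I -> probability (data n d) R)
    (theta : I -> param d) (lam : I -> data n d -> R) :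
  alpha < 1 / 4 -> (0 < #|I|)%N ->
  Theta0 theta0 -> Theta1 theta0 -> beta theta0 = 0 -> data_law theta0 Q0 ->
  (forall i, Theta0 (theta i)) -> (forall i, beta (theta i) = b) ->
  (forall i, data_law (theta i) (Q i)) ->
  (forall i, measurable_fun setT (lam i)) -> (forall i D, 0 <= lam i D) ->
  (forall i (F : data n d -> \bar R), measurable_fun setT F ->
    (forall D, 0 <= F D)%E ->
    (\int[Q i]_D F D = \int[Q0]_D (F D * (lam i D)%:E))%E) ->
  (\sum_i \sum_j \int[Q0]_D (lam i D * lam j D)%:E <=
    (17 / 16 * #|I|%:R ^+ 2)%:E)%E ->
  ((`|b| / 4)%:E <= minimax_diam n alpha Theta0 Theta1)%E.
Proof.
move=> a4 I0 h00 h01 b0 dl0 hT hb dl mlam lam0 dens mom.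
have N0 : 0 < #|I|%:R :> R by rewrite ltr0n.
apply: le_ereal_inf_tmp => _ [[l u] [/= ml mu lu cov] <-].
apply: le_ereal_sup_tmp; exists (\int[Q0]_D (u D - l D)%:E)%E.
  by exists theta0, Q0.
have cov1 th P : Theta0 th -> data_law th P ->
    ((1 - alpha)%:E <= P [set D | (l D <= beta th <= u D)%R])%E.
  move=> h1 h2; apply: (le_trans cov); apply: ereal_inf_lbound.
  by exists th, P.
have mE x : measurable [set D | (l D <= x <= u D)%R].
  rewrite (_ : [set D | _] = (l @^-1` `]-oo, x]%classic) `&`
      (u @^-1` `[x, +oo[%classic)).
    by apply: measurableI; rewrite -[X in measurable X]setTI;
      [apply: ml|apply: mu] => //; exact: measurable_itv.
  by apply/seteqP; split => D /=; rewrite !in_itv/= ?andbT => /andP.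
set E := [set D | (l D <= b <= u D)%R]; set E0 := [set D | (l D <= 0 <= u D)%R].
have mI : measurable_fun setT (\1_E : data n d -> R) by apply: measurable_indic; exact: mE.
have i0 D : 0 <= \1_E D :> R by rewrite indicE.
have intI (P : probability (data n d) R) :
    (\int[P]_D (\1_E D)%:E = P E)%E.
  by rewrite integral_indic ?setIT//; exact: mE.
pose Lb D := #|I|%:R^-1 * \sum_i lam i D.
have S0 D : 0 <= \sum_i lam i D by apply: sumr_ge0.
have Lb0 D : 0 <= Lb D by rewrite mulr_ge0// invr_ge0 ltW.
have mS : measurable_fun setT (fun D => \sum_i lam i D).
  exact: measurable_sum.
have mLb : measurable_fun setT Lb by apply: measurable_funM.
have iLE : ((1 - alpha)%:E <= \int[Q0]_D (\1_E D * Lb D)%:E)%E.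
  rewrite (_ : (\int[Q0]_D _)%E = \int[Q0]_D (#|I|%:R^-1 * \sum_i \1_E D * lam i D)%:E)%E; last first.
    by apply: eq_integral => D _; rewrite /Lb -mulr_sumr mulrCA.
  rewrite intZ;
    [|by apply: measurable_sum => i; exact: measurable_funM|by rewrite invr_ge0 ltW
     |by move=> D; apply: sumr_ge0 => i _; exact: mulr_ge0].
  rewrite int_sum; [|by move=> i; exact: measurable_funM|by move=> i D; exact: mulr_ge0].
  rewrite (_ : 1 - alpha = #|I|%:R^-1 * (#|I|%:R * (1 - alpha))); last first.
    by rewrite mulrA mulVf ?mul1r// gt_eqF.
  rewrite EFinM; apply: lee_wpmul2l; first by rewrite lee_fin invr_ge0 ltW.
  rewrite mulr_natl -sumr_const -sumEFin; apply: lee_sum => i _.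
  apply: le_trans (cov1 _ _ (hT i) (dl i)) _.
  rewrite (hb i) -/E -intI dens; [|by apply/measurable_EFinP|by move=> D; rewrite lee_fin].
  exact: le_refl.
have iL : (\int[Q0]_D (Lb D)%:E = 1)%E.
  rewrite intZ//.
  rewrite int_sum//.
  rewrite (eq_bigr (fun=> 1%:E)).
    by rewrite sumEFin sumr_const -EFinM mulVf// gt_eqF.
  move=> i _; have := @dens i (fun=> 1%:E) (measurable_cst _) (fun=> lee01).
  rewrite integral_prob_cst => ->; apply: eq_integral => D _; by rewrite mul1e.
have iL2 : (\int[Q0]_D (Lb D ^+ 2)%:E <= (17 / 16)%:E)%E.
  rewrite (_ : (\int[Q0]_D _)%E = \int[Q0]_D ((#|I|%:R ^+ 2)^-1 *
      \sum_i \sum_j lam i D * lam j D)%:E)%E; last first.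
    apply: eq_integral => D _; rewrite /Lb exprMn exprVn; congr (_ * _)%:E.
    by rewrite expr2 mulr_suml; apply: eq_bigr => i _; rewrite mulr_sumr.
  have m2 i j : measurable_fun setT (fun D => lam i D * lam j D).
    exact: measurable_funM.
  have p2 i j D : 0 <= lam i D * lam j D by exact: mulr_ge0.
  have m1 i : measurable_fun setT (fun D => \sum_j lam i D * lam j D).
    exact: measurable_sum.
  have p1 i D : 0 <= \sum_j lam i D * lam j D by apply: sumr_ge0.
  rewrite intZ;
    [|exact: measurable_sum|by rewrite invr_ge0 exprn_ge0// ltW|by move=> D; apply: sumr_ge0].
  rewrite int_sum//.
  under eq_bigr do rewrite int_sum//.
  apply: le_trans (lee_wpmul2l _ mom) _; first by rewrite lee_fin invr_ge0 exprn_ge0// ltW.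
  by rewrite -EFinM lee_fin mulrCA mulVf ?mulr1// gt_eqF// exprn_gt0.
have fE0 : (Q0 E \is a fin_num)%E by apply: fin_num_measure; exact: mE.
(* The difference of the integrands is [2 * (Lb - 5/4) ^+ 2] on [E] and [2 * (Lb - 1) ^+ 2 + 1/8]
   off [E]. As [Lb] has mean 1 and second moment at most 17/16, integration yields
   [Q0 E >= 1 - alpha - 1/4]. The term [4 * Lb] stands on the left to keep both sides
   nonnegative. *)
have key : (\int[Q0]_D (\1_E D * Lb D + 4 * Lb D)%:E <=
    \int[Q0]_D (\1_E D + (2 * Lb D ^+ 2 + 17 / 8))%:E)%E.
  apply: le_int.
  - by apply: measurable_funD; apply: measurable_funM.
  - apply: measurable_funD => //; apply: measurable_funD => //.
    by apply: measurable_funM => //; exact: measurable_funX.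
  move=> D; rewrite addr_ge0 ?mulr_ge0//=.
  rewrite indicE; case: (D \in E) => /=; rewrite ?mul1r ?mul0r.
    by have := sqr_ge0 (4 * Lb D - 5); nra.
  by have := sqr_ge0 (Lb D - 1); nra.
have QE : ((3 / 4 - alpha)%:E <= Q0 E)%E.
  move: key; rewrite intD;
    [|by apply: measurable_funM|by apply: measurable_funM|by move=> D; exact: mulr_ge0
     |by move=> D; exact: mulr_ge0].
  rewrite (@intZ _ _ _ Q0 4 Lb)// iL.
  rewrite intD//; first last.
    by move=> D; rewrite addr_ge0// mulr_ge0// sqr_ge0.
    by apply: measurable_funD => //; apply: measurable_funM => //; exact: measurable_funX.
  rewrite intI intD//; first last.
    by move=> D; rewrite mulr_ge0// sqr_ge0.
    by apply: measurable_funM => //; exact: measurable_funX.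
  rewrite integral_prob_cst intZ//; first last.
    by move=> D; rewrite sqr_ge0.
    exact: measurable_funX.
  move=> key.
  have h1 : ((1 - alpha)%:E + 4%:E * 1 <= Q0 E + (2%:E * (17 / 16)%:E + (17 / 8)%:E))%E.
    apply: le_trans (le_trans (leeD iLE (le_refl _)) key) _.
    by apply: leeD => //; apply: leeD => //; apply: lee_wpmul2l.
  move: h1; rewrite -(fineK fE0) mule1 -!EFinM -!EFinD !lee_fin; lra.
have QE0 := cov1 _ _ h00 dl0; rewrite b0 -/E0 in QE0.
(* Here [alpha < 1 / 4] enters: [(3 / 4 - alpha) + (1 - alpha) - 1 > 1 / 4]. *)
have QI : ((1 / 4)%:E <= Q0 (E `&` E0))%E.
  have fI : (Q0 (E `&` E0) \is a fin_num)%E by apply: fin_num_measure; apply: measurableI; exact: mE.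
  have f0 : (Q0 E0 \is a fin_num)%E by apply: fin_num_measure; exact: mE.
  have : (Q0 E <= Q0 (E `&` E0) + (1 - Q0 E0))%E.
    rewrite -probability_setC; last exact: mE.
    have mI0 : measurable (E `&` E0) by apply: measurableI; exact: mE.
    apply: le_trans (measureU2 _ mI0 (measurableC (mE 0))) => //.
    apply: le_measure; rewrite ?inE;
      [exact: mE|by apply: measurableU => //; exact: measurableC (mE 0)|].
    by move=> D hD; have [|] := pselect (E0 D); [left|right].
  move: QE QE0; rewrite -(fineK fE0) -(fineK fI) -(fineK f0) -EFinB -EFinD !lee_fin; lra.
apply: (@le_trans _ _ (\int[Q0]_D (`|b| * \1_(E `&` E0) D)%:E)%E).
  rewrite intZ;
    [|by apply: measurable_indic; apply: measurableI; exact: mE|exact: normr_ge0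
     |by move=> D; rewrite indicE].
  rewrite integral_indic; [|exact: measurableT|by apply: measurableI; exact: mE].
  by rewrite setIT EFinM; apply: lee_wpmul2l => //; rewrite -[X in X%:E]div1r.
apply: le_int.
- by apply: measurable_funM => //; apply: measurable_indic; apply: measurableI; exact: mE.
- exact: measurable_funB.
move=> D; rewrite mulr_ge0 ?indicE//=; have := lu D.
case: (boolP (D \in E `&` E0)) => [|_] /=; last by lra.
rewrite inE => -[]; rewrite /E /E0 /= => /andP[h1 h2] /andP[h3 h4] _.
by rewrite mulr1; have := ler_norml b (u D - l D) => ->; apply/andP; split; lra.
Qed.

(** * Linear forms in independent normal variables *)

Lemma measurable_integral_snd d1 d2 (T1 : measurableType d1)
    (T2 : measurableType d2) (R : realType) (P : probability T2 R)
    (f : T1 -> T2 -> \bar R) :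
  measurable_fun [set: T1 * T2] (fun z => f z.1 z.2) ->
  (forall x y, 0 <= f x y)%E ->
  measurable_fun [set: T1] (fun x => \int[P]_y f x y)%E.
Proof.
move=> mf f0.
by apply: (measurable_fun_fubini_tonelli_F (m2 := P) _ mf) => z; exact: f0.
Qed.

Lemma measurable_comp_fun d1 d2 d3 (T1 : measurableType d1)
    (T2 : measurableType d2) (T3 : measurableType d3) (F : T2 -> T3) (f : T1 -> T2) :
  measurable_fun setT F -> measurable_fun setT f ->
  measurable_fun setT (fun t => F (f t)).
Proof. by move=> mF mf; exact: (measurableT_comp mF mf). Qed.

Section iid_normal.
Context {R : realType}.
Local Notation gam := (stdnormal R).
Local Open Scope ereal_scope.

Lemma iid_normal_lin n (v : 'I_n -> R) (F : R -> \bar R) :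
  measurable_fun [set: R] F -> (forall x, 0 <= F x) ->
  \int[iid_power gam n]_w F (\sum_i v i * tnth w i)%R =
  \int[gam]_x F (Num.sqrt (\sum_i v i ^+ 2) * x)%R.
Proof.
elim: n => [|n IH] in v F * => mF F0.
all: have mFc d (T : measurableType d) (f : T -> R) : measurable_fun setT f ->
  measurable_fun setT (fun t => F (f t)) by move=> mf; exact: (measurable_comp_fun mF mf).
  rewrite iid_power0; last by apply: mFc; mfun; apply: measurable_tnth.
  rewrite !big_ord0 sqrtr0; transitivity (\int[gam]_x F 0%R); last first.
    by apply: eq_integral => x _; rewrite mul0r.
  by rewrite integral_prob_cst.
rewrite iid_power_cons; [|by apply: mFc; mfun; apply: measurable_tnth|by []].
rewrite big_ord_recl; have S0 : (0 <= \sum_(i < n) v (lift ord0 i) ^+ 2)%R.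
  by apply: sumr_ge0 => i _; exact: sqr_ge0.
rewrite -[X in (_ + X)%R](sqr_sqrtr S0) -stdnormal_conv//.
apply: eq_integral => x _.
rewrite -(IH _ (fun y => F (v ord0 * x + y)%R))//; last by apply: mFc; mfun.
apply: eq_integral => w _; rewrite big_ord_recl tnth0; congr (F (_ + _)%R).
by apply: eq_bigr => i _; rewrite tnthS.
Qed.

(** One step of an orthogonal triangularization: rotating (p1, p2) to the first axis removes a
    variable from the first form, and [stdnormal_conv] merges the other two in the second form. The
    three identities say that the Gram matrix is preserved. *)
Lemma stdnormal_conv2 (p1 p2 q1 q2 q3 : R) : exists a b c : R,
  [/\ (a ^+ 2 = p1 ^+ 2 + p2 ^+ 2)%R, (a * b = p1 * q1 + p2 * q2)%R,
    (b ^+ 2 + c ^+ 2 = q1 ^+ 2 + (q2 ^+ 2 + q3 ^+ 2))%R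
  & forall F : R * R -> \bar R, measurable_fun [set: R * R] F ->
    (forall x, 0 <= F x) ->
    \int[gam]_x \int[gam]_g \int[gam]_h
      F (p1 * x + p2 * g, q1 * x + (q2 * g + q3 * h))%R =
    \int[gam]_g \int[gam]_h F (a * g, b * g + c * h)%R].
Proof.
have sq x y : (Num.sqrt (x ^+ 2 + y ^+ 2) ^+ 2 = x ^+ 2 + y ^+ 2 :> R)%R.
  by rewrite sqr_sqrtr// addr_ge0 ?sqr_ge0.
have mF2 (F : R * R -> \bar R) d (T : measurableType d) (f g : T -> R) :
    measurable_fun [set: R * R] F -> measurable_fun [set: T] f ->
    measurable_fun [set: T] g -> measurable_fun [set: T] (fun t => F (f t, g t)).
  by move=> mF mf mg; apply: (measurableT_comp mF); exact: measurable_fun_pair.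
set n := Num.sqrt (p1 ^+ 2 + p2 ^+ 2); have n2 := sq p1 p2; rewrite -/n in n2.
have [n0|n0] := eqVneq n 0%R.
  have /eqP : (p1 ^+ 2 + p2 ^+ 2 = 0)%R by rewrite -n2 n0 expr0n.
  rewrite paddr_eq0 ?sqr_ge0// !sqrf_eq0 => /andP[/eqP-> /eqP->].
  set m := Num.sqrt (q2 ^+ 2 + q3 ^+ 2).
  exists 0%R, 0%R, (Num.sqrt (q1 ^+ 2 + m ^+ 2)); split.
  - by rewrite expr0n addr0.
  - by rewrite !mul0r addr0.
  - by rewrite sq /m sq expr0n add0r.
  move=> F mF F0.
  transitivity (\int[gam]_x \int[gam]_g F (0%R, (q1 * x + m * g)%R)).
    apply: eq_integral => x _.
    rewrite -(@stdnormal_conv _ q2 q3 (fun y => F (0%R, (q1 * x + y)%R)));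
      [|by apply: mF2 => //; mfun|by []].
    by apply: eq_integral => g _; apply: eq_integral => h _; rewrite !mul0r addr0.
  rewrite (@stdnormal_conv _ q1 m (fun y => F (0%R, y)))//; last by apply: mF2 => //; mfun.
  rewrite -[LHS](integral_prob_cst gam).
  by apply: eq_integral => g _; apply: eq_integral => h _; rewrite !mul0r add0r.
set b := (q1 * (p1 / n) + q2 * (p2 / n))%R.
set d := (- q1 * (p2 / n) + q2 * (p1 / n))%R.
have CS : ((p1 / n) ^+ 2 + (p2 / n) ^+ 2 = 1)%R.
  by rewrite !expr_div_n -mulrDl -n2 divff// expf_neq0.
exists n, b, (Num.sqrt (d ^+ 2 + q3 ^+ 2)); split.
- exact: n2.
- by rewrite /b; field.
- rewrite sq addrA addrA; congr (_ + _)%R.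
  rewrite -[RHS]mulr1 -CS /b /d; ring.
move=> F mF F0.
pose G (z : R * R) := \int[gam]_h F (n * z.1, b * z.1 + (d * z.2 + q3 * h))%R.
transitivity (\int[gam]_x \int[gam]_y G (p1 / n * x + p2 / n * y,
    - (p2 / n) * x + p1 / n * y)%R).
  apply: eq_integral => x _; apply: eq_integral => y _; apply: eq_integral => h _.
  congr (F (_, _)); rewrite /=; first by field.
  rewrite addrA addrA; congr (_ + _)%R.
  rewrite -[LHS]mulr1 -CS /b /d; ring.
rewrite (@stdnormal_rotation _ (p1 / n) (p2 / n) G CS); first last.
- by move=> z; apply: integral_ge0 => h _.
- apply: measurable_integral_snd => //; apply: mF2 => //; mfun;
    exact: (measurableT_comp _ measurable_fst).
apply: eq_integral => x _; rewrite /G /=.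
by rewrite -(@stdnormal_conv _ d q3 (fun y => F (n * x, b * x + y)%R))//; apply: mF2 => //; mfun.
Qed.

(** Cholesky form of a pair of linear forms: their joint law depends on [v] and [w] through the Gram
    matrix alone, which the three identities record. *)
Lemma iid_normal_lin2 n (v w : 'I_n -> R) : exists a b c : R,
  [/\ (a ^+ 2 = \sum_i v i ^+ 2)%R, (a * b = \sum_i v i * w i)%R,
    (b ^+ 2 + c ^+ 2 = \sum_i w i ^+ 2)%R
  & forall F : R * R -> \bar R, measurable_fun [set: R * R] F ->
    (forall x, 0 <= F x) ->
    \int[iid_power gam n]_t F (\sum_i v i * tnth t i, \sum_i w i * tnth t i)%R =
    \int[gam]_g \int[gam]_h F (a * g, b * g + c * h)%R].
Proof.
have mF2 (F : R * R -> \bar R) d (T : measurableType d) (f g : T -> R) :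
    measurable_fun [set: R * R] F -> measurable_fun [set: T] f ->
    measurable_fun [set: T] g -> measurable_fun [set: T] (fun t => F (f t, g t)).
  by move=> mF mf mg; apply: (measurableT_comp mF); exact: measurable_fun_pair.
elim: n => [|n IH] in v w *.
  exists 0%R, 0%R, 0%R; rewrite !big_ord0 !expr0n !mul0r !addr0; split => // F mF F0.
  rewrite iid_power0; last by apply: mF2 => //; mfun; apply: measurable_tnth.
  rewrite !big_ord0 -[LHS](integral_prob_cst gam); apply: eq_integral => g _.
  rewrite -[LHS](integral_prob_cst gam); apply: eq_integral => h _.
  by rewrite !mul0r addr0.
have [a [b [c [ha hab hbc hF]]]] := IH (v \o lift ord0) (w \o lift ord0).
have [a' [b' [c' [ha' hab' hbc' hF']]]] := stdnormal_conv2 (v ord0) a (w ord0) b c.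
exists a', b', c'; rewrite !big_ord_recl; split.
- by rewrite ha' ha.
- by rewrite hab' hab.
- by rewrite hbc' hbc.
move=> F mF F0; rewrite -hF'//.
rewrite iid_power_cons; [|by apply: mF2 => //; mfun; apply: measurable_tnth|by []].
apply: eq_integral => x _.
rewrite -(hF (fun z => F (v ord0 * x + z.1, w ord0 * x + z.2)%R))//; last by apply: mF2 => //; mfun.
apply: eq_integral => t _; rewrite !big_ord_recl !tnth0.
by congr (F (_ + _, _ + _)%R); apply: eq_bigr => i _; rewrite tnthS.
Qed.

Lemma mehler_expand (c r x y : R) : (0 < c)%R -> (c ^+ 2 + r ^+ 2 = 1)%R ->
  (mehler c r x y = c^-1 * expR (- (r ^+ 2 / c ^+ 2) / 2 * (x ^+ 2 + y ^+ 2) +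
    r / c ^+ 2 * (x * y)))%R.
Proof.
move=> c0 cr; rewrite /mehler; congr (_ * expR _)%R.
apply/eqP; rewrite -subr_eq0; apply/eqP.
transitivity ((c ^+ 2 + r ^+ 2 - 1) * x ^+ 2 / (2 * c ^+ 2))%R.
  by field; rewrite gt_eqF.
by rewrite cr subrr !mul0r.
Qed.

(* [p * g + q * h] and [p * g - q * h] are standard normal variables with
   correlation [p ^+ 2 - q ^+ 2]. *)
Lemma mehler_second_moment (c r p q : R) : (0 < c)%R -> (c ^+ 2 + r ^+ 2 = 1)%R ->
  (p ^+ 2 + q ^+ 2 = 1)%R ->
  \int[gam]_h \int[gam]_u \int[gam]_g
    (mehler c r u (p * g + q * h) * mehler c r u (p * g - q * h))%:E =
  ((1 - r ^+ 2 * (p ^+ 2 - q ^+ 2))^-1)%:E.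
Proof.
move=> c0 cr pq.
have c20 : (0 < c ^+ 2)%R by rewrite exprn_gt0.
have r20 := sqr_ge0 r; have p20 := sqr_ge0 p; have q20 := sqr_ge0 q.
pose lam := (r ^+ 2 / c ^+ 2)%R; pose mu := (r / c ^+ 2)%R.
have lam0 : (0 <= lam)%R by rewrite divr_ge0// ltW.
(* The integrals in g, u and h produce the inverse roots of [A], [1 - 2 * a] and [B]. Since
   [(1 - 2 * a) * A = B = D / c ^+ 2], the three roots multiply to [D / c ^+ 2]. *)
pose A := (1 + 2 * lam * p ^+ 2)%R.
pose B := (1 + 2 * lam * q ^+ 2)%R.
pose D := (1 - r ^+ 2 * (p ^+ 2 - q ^+ 2))%R.
have A0 : (0 < A)%R by rewrite /A; nra.
have B0 : (0 < B)%R by rewrite /B; nra.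
have D0 : (0 < D)%R by rewrite /D; nra.
have EB : (B = D / c ^+ 2)%R.
  rewrite /B /D /lam; apply: (@mulIf _ (c ^+ 2)); first by rewrite gt_eqF.
  rewrite divfK ?gt_eqF// mulrDl mul1r.
  rewrite (_ : 2 * (r ^+ 2 / c ^+ 2) * q ^+ 2 * c ^+ 2 = 2 * r ^+ 2 * q ^+ 2)%R; last first.
    by field; rewrite gt_eqF.
  by have := cr; have := pq; nra.
pose a := (- lam + 2 * mu ^+ 2 * p ^+ 2 / A)%R.
have EA : ((1 - 2 * a) * A = D / c ^+ 2)%R.
  have -> : ((1 - 2 * a) * A = (1 + 2 * lam) * A - 4 * mu ^+ 2 * p ^+ 2)%R.
    by rewrite /a; field; rewrite gt_eqF.
  rewrite /A /D /lam /mu; have Ec : (c ^+ 2 = 1 - r ^+ 2)%R by have := cr; lra.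
  rewrite (_ : q ^+ 2 = 1 - p ^+ 2)%R; last by have := pq; lra.
  by rewrite Ec; field; rewrite -Ec gt_eqF.
have a1 : (0 < 1 - 2 * a)%R.
  by rewrite -(@pmulr_lgt0 _ A)// EA divr_gt0.
transitivity (\int[gam]_h ((c^-1 ^+ 2 * (Num.sqrt A)^-1 * (Num.sqrt (1 - 2 * a))^-1) *
    expR (- lam * q ^+ 2 * h ^+ 2))%:E).
  apply: eq_integral => h _.
  transitivity (\int[gam]_u ((c^-1 ^+ 2 * expR (- lam * q ^+ 2 * h ^+ 2) * (Num.sqrt A)^-1) *
      expR (a * u ^+ 2))%:E).
    apply: eq_integral => u _.
    transitivity (\int[gam]_g (c^-1 ^+ 2 * expR (- lam * q ^+ 2 * h ^+ 2) *
       expR (- lam * u ^+ 2) * expR ((- lam * p ^+ 2) * g ^+ 2 + (2 * mu * p * u) * g))%:E).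
      apply: eq_integral => g _; rewrite !mehler_expand//; congr EFin.
      rewrite mulrACA -expRD -expr2.
      set e1 := (- lam * q ^+ 2 * h ^+ 2)%R; set e2 := (- lam * u ^+ 2)%R.
      set e3 := (_ * g ^+ 2 + _)%R.
      have -> : (c^-1 ^+ 2 * expR e1 * expR e2 * expR e3 =
          c^-1 ^+ 2 * expR (e1 + e2 + e3))%R by rewrite !expRD; ring.
      congr (_ * expR _)%R; rewrite /e1 /e2 /e3.
      by rewrite -/lam -/mu; field.
    rewrite intZ;
      [|by mfun|by rewrite !mulr_ge0 ?expR_ge0 ?sqr_ge0 ?invr_ge0 ?(ltW c0)
       |by move=> x; exact: expR_ge0].
    rewrite stdnormal_expR_quad; last first.
      by move: A0; rewrite /A; lra.
    rewrite -EFinM; congr EFin.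
    rewrite (_ : 1 - 2 * (- lam * p ^+ 2) = A)%R; last by rewrite /A; ring.
    rewrite (_ : a * u ^+ 2 = - lam * u ^+ 2 + (2 * mu * p * u) ^+ 2 / (2 * A))%R; last first.
      by rewrite /a; field; rewrite gt_eqF.
    by rewrite expRD; ring.
  rewrite intZ;
    [|by mfun|by rewrite !mulr_ge0 ?expR_ge0 ?sqr_ge0 ?invr_ge0 ?(ltW c0)
     |by move=> x; exact: expR_ge0].
  rewrite stdnormal_expR_sqr; last by lra.
  by rewrite -EFinM; congr EFin; ring.
rewrite intZ;
  [|by mfun|by rewrite !mulr_ge0 ?sqr_ge0 ?invr_ge0 ?(ltW c0)|by move=> x; exact: expR_ge0].
rewrite stdnormal_expR_sqr; last by move: B0; rewrite /B; lra.
rewrite -EFinM; congr EFin.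
rewrite (_ : 1 - 2 * (- lam * q ^+ 2) = B)%R; last by rewrite /B; ring.
have key : (Num.sqrt A * Num.sqrt (1 - 2 * a) * Num.sqrt B = D / c ^+ 2)%R.
  rewrite -(sqrtrM _ (ltW A0)) -sqrtrM; last by rewrite mulr_ge0// ltW.
  rewrite [(A * _)%R]mulrC EA EB -expr2 sqrtr_sqr ger0_norm//.
  by rewrite divr_ge0// ltW.
transitivity (c^-1 ^+ 2 * (D / c ^+ 2)^-1)%R; first by rewrite -key !invfM; ring.
by rewrite -/D; field; rewrite !gt_eqF.
Qed.
End iid_normal.

(** * The laws of the lower bound *)

Lemma prob_preimage d d' (T : measurableType d) (U : measurableType d')
    (R : realType) (P : probability T R) (f : T -> U) (B : set U) :
  measurable_fun setT f -> measurable B ->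
  (P [set t | B (f t)] = \int[P]_t (\1_B (f t))%:E)%E.
Proof.
move=> mf mB.
have mB' : measurable [set t | B (f t)].
  by rewrite -[X in measurable X]setTI; exact: mf.
rewrite -[X in P X]setIT -(@integral_indic _ _ _ P setT)//.
Qed.

Section generated_model.
Context {R : realType} {d : nat}.
Local Notation gam := (stdnormal R).
Local Open Scope ereal_scope.

(** The three blocks drive the noise, the part of Z not explained by W, and W; they are nested in
    the shape of an observation so that [gen_obs] acts within one type. *)
Definition std_obs : probability (obs (R := R) d) R :=
  (gam \x (gam \x iid_power gam d)).

Lemma std_obs_setX (A : set R) (B : set (R * d.-tuple R)) :
  measurable A -> measurable B ->
  std_obs (A `*` B) = gam A * (gam \x iid_power gam d) B.
Proof. exact: product_measure1E. Qed.

Lemma integral_std_obs (F : obs d -> \bar R) : measurable_fun setT F ->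
  (forall o, 0 <= F o) ->
  \int[std_obs]_o F o =
  \int[gam]_e \int[gam]_z \int[iid_power gam d]_w F (e, (z, w)).
Proof.
move=> mF F0; rewrite ge0_integral_prod//; apply: eq_integral => e _.
rewrite ge0_integral_prod//.
by apply: (measurableT_comp mF); apply: measurable_fun_pair.
Qed.

Variables (b sg tau : R) (eta g : 'I_d -> R).

Definition gen_Z (o : R * d.-tuple R) : R :=
  (tau * o.1 + \sum_j eta j * tnth o.2 j)%R.

Definition gen_obs (o : obs (R := R) d) : obs (R := R) d :=
  ((b * gen_Z o.2 + \sum_j g j * tnth o.2.2 j + sg * o.1)%R,
   (gen_Z o.2, o.2.2)).

Definition gen_param : param (R := R) d :=
  Param b (\col_j g j)
    (block_mx (tau ^+ 2 + \sum_j eta j ^+ 2)%R%:M (\row_j eta j)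
       (\row_j eta j)^T 1%:M) sg.

Lemma measurable_gen_Z : measurable_fun setT gen_Z.
Proof.
rewrite /gen_Z; mfun.
exact: (measurable_comp_fun (@measurable_tnth _ _ _ _) measurable_snd).
Qed.

Lemma measurable_gen_obs : measurable_fun setT gen_obs.
Proof.
have m2 : measurable_fun setT (fun o : obs (R := R) d => gen_Z o.2).
  exact: (measurable_comp_fun measurable_gen_Z measurable_snd).
apply: measurable_fun_pair; last first.
  apply: measurable_fun_pair => //.
  exact: (measurableT_comp measurable_snd measurable_snd).
apply: measurable_funD; last by apply: measurable_funM.
apply: measurable_funD; first exact: measurable_funM.
apply: measurable_sum => j; apply: measurable_funM => //.
exact: (measurable_obs_Wj j).
Qed.

Definition gen_law : probability (obs (R := R) d) R :=
  image_prob std_obs measurable_gen_obs.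

Lemma gen_sym : (Sigma gen_param)^T%R = Sigma gen_param.
Proof.
rewrite /= (@tr_block_mx _ 1 d 1 d) trmxK tr_scalar_mx; congr block_mx.
by rewrite trmx1.
Qed.

Lemma gen_drsubmx : drsubmx (Sigma gen_param) = 1%:M%R.
Proof. exact: block_mxKdr. Qed.

Lemma gen_varZ : varZ (Sigma gen_param) = (tau ^+ 2 + \sum_j eta j ^+ 2)%R.
Proof. by rewrite /varZ (@block_mxKul _ 1 d 1 d) mxE. Qed.

Lemma gen_covZW j : covZW (Sigma gen_param) j = eta j.
Proof. by rewrite /covZW (@block_mxKur _ 1 d 1 d) mxE. Qed.

Lemma noise_gen_obs o : noise gen_param (gen_obs o) = (sg * o.1)%R.
Proof.
rewrite noiseE /obs_y /obs_Z /obs_Wj /=.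
rewrite [X in (_ - X)%R](eq_bigr (fun j => g j * tnth o.2.2 j)%R); last first.
  by move=> j _; rewrite mxE mulrC.
by ring.
Qed.

(** A combination of X splits into the residual of Z and a linear form in W, reduced by
    [iid_normal_lin] and merged by [stdnormal_conv]. Independence holds because the noise depends on
    the first component only. *)
Lemma obs_law_gen : (0 <= sg)%R -> obs_law gen_param gen_law.
Proof.
move=> sg0.
have mT : measurable_fun setT (fun o : R * d.-tuple R => (gen_Z o, o.2)).
  by apply: measurable_fun_pair => //; exact: measurable_gen_Z.
have mpre (A : set (R * d.-tuple R)) : measurable A ->
    measurable [set o : R * d.-tuple R | A (gen_Z o, o.2)].
  by move=> mA; rewrite -[X in measurable X]setTI; exact: mT.
have mscale (B : set R) : measurable B -> measurable [set x : R | B (sg * x)%R].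
  by move=> mB; rewrite -[X in measurable X]setTI; apply: (measurable_scale sg).
have Pnoise (B : set R) : measurable B ->
    gen_law [set o | B (noise gen_param o)] = gam [set x | B (sg * x)%R].
  move=> mB; rewrite image_probE.
  rewrite (_ : _ @^-1` _ = [set x : R | B (sg * x)%R] `*` [set: R * d.-tuple R]).
    rewrite std_obs_setX//; last exact: mscale.
    by rewrite [X in _ * X]probability_setT mule1.
  apply/seteqP; split => o /=; rewrite noise_gen_obs//.
  by case.
split.
- move=> a B mB.
  rewrite -(vsubmxK a); set a0 := usubmx a; set w := dsubmx a.
  rewrite (_ : a0 = (a0 0%R 0%R)%:M)%R; last exact: mx11_scalar.
  move: (a0 0%R 0%R) => {a0} a0.
  rewrite (quad_Sigma a0 w gen_sym gen_drsubmx) (quad_Sigma_sos _ a0 (fun j => w j 0%R)).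
  rewrite gen_varZ.
  rewrite [X in (_ - X)%R](eq_bigr (fun j => eta j ^+ 2)%R); last first.
    by move=> j _; rewrite gen_covZW.
  rewrite addrK (eq_bigr (fun j => (a0 * eta j + w j 0) ^+ 2)%R); last first.
    by move=> j _; rewrite gen_covZW.
  set q := (\sum_j (a0 * eta j + w j 0) ^+ 2)%R.
  have q0 : (0 <= q)%R by apply: sumr_ge0 => j _; exact: sqr_ge0.
  have E o : ((col_mx a0%:M w)^T *m obs_X (gen_obs o))%R 0%R 0%R =
      (a0 * tau * o.2.1 + \sum_j (a0 * eta j + w j 0) * tnth o.2.2 j)%R.
    rewrite /obs_X tr_col_mx mul_row_col tr_scalar_mx mul_scalar_mx mxE !mxE /=.
    rewrite mulr1n /obs_Z /= /gen_Z mulrDr mulrA -addrA; congr (_ + _)%R.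
    rewrite mulr_sumr -big_split /=; apply: eq_bigr => j _.
    by rewrite !mxE mulrDl mulrA.
  have mL : measurable_fun setT (fun o : obs (R := R) d => (a0 * tau * o.2.1 +
      \sum_j (a0 * eta j + w j 0) * tnth o.2.2 j)%R).
    apply: measurable_funD.
      by apply: measurable_funM => //; exact: measurable_obs_Z.
    apply: measurable_sum => j; apply: measurable_funM => //.
    exact: (measurable_obs_Wj j).
  rewrite image_probE.
  rewrite (_ : _ @^-1` _ = [set o : obs (R := R) d | B (a0 * tau * o.2.1 +
      \sum_j (a0 * eta j + w j 0) * tnth o.2.2 j)%R]); last first.
    by apply/seteqP; split => o /=; rewrite E.
  have mi (f : R -> R) : measurable_fun setT f -> measurable_fun setT (fun x => (\1_B (f x))%:E : \bar R).
    move=> mf; apply/measurable_EFinP; apply: (measurable_comp_fun _ mf).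
    exact: measurable_indic.
  have i0 x : 0 <= (\1_B x)%:E :> \bar R by rewrite lee_fin indicE.
  rewrite prob_preimage// integral_std_obs//; last first.
    apply/measurable_EFinP; apply: (measurable_comp_fun _ mL).
    exact: measurable_indic.
  rewrite /= [LHS]integral_prob_cst.
  rewrite centered_normalE ?sqrtr_ge0// image_probE.
  rewrite (prob_preimage gam (measurable_scale _) mB).
  rewrite (_ : a0 ^+ 2 * tau ^+ 2 + q = (a0 * tau) ^+ 2 + (Num.sqrt q) ^+ 2)%R; last first.
    by rewrite (sqr_sqrtr q0) exprMn.
  rewrite -(@stdnormal_conv _ _ _ (fun x => (\1_B x)%:E))//; last exact: (mi id).
  apply: eq_integral => z _.
  rewrite (@iid_normal_lin _ d (fun j => a0 * eta j + w j 0)%R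
    (fun x => (\1_B (a0 * tau * z + x)%R)%:E))//.
  by apply: mi; mfun.
- by move=> B mB; rewrite Pnoise// centered_normalE// image_probE.
move=> A B mA mB; rewrite Pnoise//.
rewrite !image_probE.
rewrite (_ : gen_obs @^-1` [set o | A o.2 /\ _] =
    [set x : R | B (sg * x)%R] `*` [set o : R * d.-tuple R | A (gen_Z o, o.2)]); last first.
  by apply/seteqP; split => o /=; rewrite noise_gen_obs => -[].
rewrite (_ : gen_obs @^-1` _ =
    [set: R] `*` [set o : R * d.-tuple R | A (gen_Z o, o.2)]); last first.
  by apply/seteqP; split => o /=; tauto.
rewrite !std_obs_setX//; try (exact: mpre); try exact: mscale.
by rewrite [X in X * _ * _]probability_setT mul1e muleC.
Qed.

End generated_model.

Lemma data_law_iid (R : realType) n d (theta : param (R := R) d) (P : probability (obs d) R) :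
  obs_law theta P -> data_law theta (iid_power P n).
Proof. by move=> hP; exists P => // B mB; exact: iid_power_rectangle. Qed.

Section gen_param_space.
Context {R : realType} {d : nat}.
Variables (b sg tau : R) (eta g : 'I_d -> R).
Local Notation theta := (gen_param b sg tau eta g).

(** With Var Z = 1 the matrix Sigma - 1 consists of the two off-diagonal copies of [eta], so its
    eigenvalues are among 0 and plus or minus the norm of [eta]. *)
Lemma gen_eigenvalue (mu : R) : tau ^+ 2 + \sum_j eta j ^+ 2 = 1 ->
  eigenvalue (Sigma theta) mu -> (mu - 1) ^+ 2 <= \sum_j eta j ^+ 2.
Proof.
move=> v1 /eigenvalueP[v vS v0].
have V0 : 0 <= \sum_j eta j ^+ 2 by apply: sumr_ge0 => j _; exact: sqr_ge0.
move: vS v0; rewrite -(@hsubmxK _ 1 1 d v).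
rewrite [lsubmx v]mx11_scalar; move: (lsubmx v 0 0) (rsubmx v) => a0 w.
rewrite (mul_row_Sigma a0 w (gen_sym _ _ _ _ _) (gen_drsubmx _ _ _ _ _)) gen_varZ v1 mulr1.
rewrite scale_row_mx => /eq_row_mx[e1 e2] v0.
have {}e1 : a0 + \sum_j eta j * w 0 j = mu * a0.
  have := congr1 (fun A : 'M[R]_1 => A 0 0) e1; rewrite !mxE/= !mulr1n => <-.
  by congr (_ + _); apply: eq_bigr => j _; rewrite gen_covZW.
have {}e2 j : (mu - 1) * w 0 j = a0 * eta j.
  have := congr1 (fun A : 'rV[R]_d => A 0 j) e2; rewrite mxE [X in X + _]mxE [RHS]mxE.
  by have := gen_covZW b sg tau eta g j; rewrite /covZW => ->; lra.
have [a00|a00] := eqVneq a0 0.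
  have [->|m1] := eqVneq mu 1; first by rewrite subrr expr0n.
  case/eqP: v0; rewrite a00 raddf0.
  rewrite (_ : w = 0) ?row_mx0//; apply/rowP => j; rewrite mxE.
  have := e2 j; rewrite a00 mul0r => /eqP; rewrite mulf_eq0 subr_eq0 (negPf m1).
  by move=> /eqP.
rewrite le_eqVlt; apply/orP; left; apply/eqP; apply: (mulIf a00).
rewrite expr2 -mulrA (_ : (mu - 1) * a0 = \sum_j eta j * w 0 j); last first.
  by have := e1; lra.
rewrite mulr_sumr mulr_suml; apply: eq_bigr => j _.
by rewrite mulrCA e2; ring.
Qed.

(** [lambda_min] and [lambda_max] mean something only for a nonempty spectrum. For nonzero [eta] the
    witness is one plus the norm of [eta], with eigenvector (norm of [eta], [eta]). *)
Lemma gen_eigenvalue_exists : tau ^+ 2 + \sum_j eta j ^+ 2 = 1 ->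
  exists mu : R, eigenvalue (Sigma theta) mu.
Proof.
move=> v1; set V := \sum_j eta j ^+ 2.
have V0 : 0 <= V by apply: sumr_ge0 => j _; exact: sqr_ge0.
have eg (a0 mu : R) (w : 'rV[R]_d) : (a0 != 0) ->
    a0 + \sum_j eta j * w 0 j = mu * a0 ->
    (forall j, a0 * eta j + w 0 j = mu * w 0 j) -> eigenvalue (Sigma theta) mu.
  move=> a00 h1 h2; apply/eigenvalueP; exists (row_mx a0%:M w); last first.
    apply/eqP => /(congr1 (fun A : 'M[R]_(1, 1 + d) => A 0 (lshift d 0))).
    by rewrite row_mxEl !mxE/= mulr1n => /eqP; rewrite (negPf a00).
  rewrite (mul_row_Sigma a0 w (gen_sym _ _ _ _ _) (gen_drsubmx _ _ _ _ _)) gen_varZ v1 mulr1.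
  rewrite scale_row_mx; congr row_mx.
    rewrite scale_scalar_mx -h1; congr (_ + _)%:M.
    by apply: eq_bigr => j _; rewrite gen_covZW.
  apply/rowP => j; rewrite mxE [X in X + _]mxE [RHS]mxE -h2.
  by have := gen_covZW b sg tau eta g j; rewrite /covZW => ->.
have [V00|Vn0] := eqVneq V 0.
  have e0 j : eta j = 0.
    apply/eqP; rewrite -sqrf_eq0; move/eqP: V00; rewrite /V psumr_eq0; last first.
      by move=> i _; exact: sqr_ge0.
    by move=> /allP/(_ j); rewrite mem_index_enum => /(_ isT).
  exists 1; apply: (@eg 1 1 0); rewrite ?oner_neq0//.
    by rewrite big1 ?addr0 ?mulr1// => j _; rewrite mxE mulr0.
  by move=> j; rewrite e0 mxE !mulr0 addr0.
have sV := sqr_sqrtr V0.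
exists (1 + Num.sqrt V); apply: (@eg (Num.sqrt V) _ (\row_j eta j)).
- by rewrite sqrtr_eq0 -ltNge lt_neqAle eq_sym Vn0.
- rewrite (eq_bigr (fun j => eta j ^+ 2)); last by move=> j _; rewrite mxE expr2.
  by rewrite -/V mulrDl mul1r -expr2 sV.
- by move=> j; rewrite mxE; ring.
Qed.

Lemma Theta_gen (M M1 M2 s : R) : 1 < M -> 0 < M2 -> tau != 0 ->
  tau ^+ 2 + \sum_j eta j ^+ 2 = 1 -> \sum_j eta j ^+ 2 <= (1 - M^-1) ^+ 2 ->
  0 <= sg <= M1 -> b ^+ 2 + \sum_j g j ^+ 2 <= M2 ^+ 2 ->
  (1 + \sum_j (eta j != 0%R))%:R <= s ->
  Theta_sparse M M1 M2 s theta.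
Proof.
move=> M1' M20 t0 v1 VM hsg hn hs.
have Mi0 : 0 < M^-1 by rewrite invr_gt0; lra.
have Mi1 : M^-1 < 1 by rewrite invf_lt1//; lra.
have MM : M * M^-1 = 1 by rewrite divff//; lra.
have bnd mu : eigenvalue (Sigma theta) mu -> M^-1 <= mu <= M.
  move=> /(gen_eigenvalue v1) h; have {}h := le_trans h VM.
  have : `|mu - 1| <= 1 - M^-1.
    have h0 : 0 <= 1 - M^-1 by lra.
    rewrite -(@ler_pXn2r _ 2) ?nnegrE ?normr_ge0//.
    by rewrite real_normK ?num_real.
  rewrite ler_norml => /andP[h1 h2]; apply/andP; split; first by lra.
  (* [2 - M^-1 <= M], since M + 1 / M >= 2. *)
  apply: (@le_trans _ _ (2 - M^-1)); first by lra.
  by nra.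
have [mu0 emu0] := gen_eigenvalue_exists v1.
have lbd : has_lbound [set a | eigenvalue (Sigma theta) a].
  by exists M^-1 => a /= /bnd/andP[].
have ubd : has_ubound [set a | eigenvalue (Sigma theta) a].
  by exists M => a /= /bnd/andP[].
split; last first.
  rewrite norm0_row_inv_Sigma; [|exact: gen_sym|exact: gen_drsubmx|].
    rewrite (eq_bigr (fun j => (eta j != 0%R) : nat))//.
    by move=> j _; rewrite gen_covZW.
  rewrite gen_varZ (eq_bigr (fun j => eta j ^+ 2)); last by [].
  rewrite [X in _ - X](eq_bigr (fun j => eta j ^+ 2)); last by move=> j _; rewrite gen_covZW.
  by rewrite addrK exprn_even_gt0.
split.
- exact: gen_sym.
- apply/and3P; split.
  + by apply: lb_le_inf; [exists mu0|move=> a /= /bnd/andP[]].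
  + apply: (@le_trans _ _ mu0); [exact: ge_inf|exact: ub_le_sup].
  + by apply: ge_sup; [exists mu0|move=> a /= /bnd/andP[]].
- exact: gen_drsubmx.
- exact: hsg.
- rewrite /norm2 -(@ler_pXn2r _ 2) ?nnegrE ?sqrtr_ge0// ?(ltW M20)// sqr_sqrtr; last first.
    by apply: sumr_ge0 => i _; exact: sqr_ge0.
  rewrite (@big_split_ord _ _ _ 1 d) /= big_ord1 col_mxEu mxE/= mulr1n.
  rewrite (eq_bigr (fun j => g j ^+ 2))// => j _.
  by rewrite col_mxEd mxE.
Qed.
End gen_param_space.

(** Tensorization: likelihood ratios and bounds on their second moments multiply over the sample, so
    a single observation has to be studied. *)
Theorem minimax_iid_ge (R : realType) n d (alpha b : R)
    (Theta0 Theta1 : set (param (R := R) d)) (P0 : probability (obs d) R)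
    (theta0 : param d) (I : finType) (P : I -> probability (obs d) R)
    (theta : I -> param d) (l : I -> obs d -> R) (e : I -> I -> R) :
  alpha < 1 / 4 -> (0 < #|I|)%N ->
  Theta0 theta0 -> Theta1 theta0 -> beta theta0 = 0 -> obs_law theta0 P0 ->
  (forall i, Theta0 (theta i)) -> (forall i, beta (theta i) = b) ->
  (forall i, obs_law (theta i) (P i)) ->
  (forall i, measurable_fun setT (l i)) -> (forall i o, 0 <= l i o) ->
  (forall i (F : obs d -> \bar R), measurable_fun setT F ->
    (forall o, 0 <= F o)%E ->
    (\int[P i]_o F o = \int[P0]_o (F o * (l i o)%:E))%E) ->
  (forall i j, (\int[P0]_o (l i o * l j o)%:E <= (e i j)%:E)%E) ->
  \sum_i \sum_j e i j ^+ n <= 17 / 16 * #|I|%:R ^+ 2 ->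
  ((`|b| / 4)%:E <= minimax_diam n alpha Theta0 Theta1)%E.
Proof.
move=> a4 I0 h00 h01 b0 o0 hT hb ho ml l0 dens he hsum.
apply: (@minimax_diam_ge _ n d alpha b Theta0 Theta1 (iid_power P0 n) theta0 I
  (fun i => iid_power (P i) n) theta
  (fun i D => \prod_(k < n) l i (tnth D k))) => //.
- exact: data_law_iid.
- by move=> i; exact: data_law_iid.
- by move=> i; exact: measurable_prod_tnth.
- by move=> i D; apply: prodr_ge0.
- move=> i F mF F0.
  exact: (@iid_power_density _ _ _ P0 (P i) (l i) n F (ml i) (l0 i) (dens i) mF F0).
apply: (@le_trans _ _ (\sum_i \sum_j (e i j ^+ n)%:E)%E); last first.
  under eq_bigr do rewrite sumEFin.
  by rewrite sumEFin lee_fin.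
apply: lee_sum => i _; apply: lee_sum => j _.
under eq_integral do rewrite -big_split/=.
by apply: (@iid_power_prod_le _ _ _ P0 n (fun o => l i o * l j o)) => //;
  [exact: measurable_funM|move=> o; exact: mulr_ge0].
Qed.

Lemma measurable_fst_comp d d1 d2 (T : measurableType d) (T1 : measurableType d1)
    (T2 : measurableType d2) (f : T -> T1 * T2) : measurable_fun setT f ->
  measurable_fun setT (fun t => (f t).1).
Proof. by move=> mf; exact: (measurableT_comp measurable_fst mf). Qed.

Lemma measurable_snd_comp d d1 d2 (T : measurableType d) (T1 : measurableType d1)
    (T2 : measurableType d2) (f : T -> T1 * T2) : measurable_fun setT f ->
  measurable_fun setT (fun t => (f t).2).
Proof. by move=> mf; exact: (measurableT_comp measurable_snd mf). Qed.

Lemma measurable_tnth_comp d (T : measurableType d) d1 (T1 : measurableType d1) n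
    (f : T -> n.-tuple T1) i : measurable_fun setT f ->
  measurable_fun setT (fun t => tnth (f t) i).
Proof. by move=> mf; exact: (measurableT_comp (@measurable_tnth _ _ _ i) mf). Qed.

Ltac mproj := repeat lazymatch goal with
  | |- measurable_fun _ (fun _ => EFin _) => apply/measurable_EFinP
  | |- measurable_fun _ (fun x => (_ * _)%E) => apply: emeasurable_funM
  | |- measurable_fun _ (fun x => (_, _)) => apply: measurable_fun_pair
  | |- measurable_fun _ (GRing.add _) => apply: measurable_funD
  | |- measurable_fun _ (GRing.mul _) => apply: measurable_funM
  | |- measurable_fun _ (fun x => _ + _)%R => apply: measurable_funD
  | |- measurable_fun _ (fun x => - _)%R => apply: measurable_funN
  | |- measurable_fun _ (fun x => _ * _)%R => apply: measurable_funM
  | |- measurable_fun _ (fun x => \sum_(_ <- _) _)%R => apply: measurable_sum => ?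
  | |- measurable_fun _ (fun x => mehler _ _ _ _) => apply: measurable_mehler
  | |- measurable_fun _ (fun x => tnth _ _) => apply: measurable_tnth_comp
  | |- measurable_fun _ (fun x => fst _) => apply: measurable_fst_comp
  | |- measurable_fun _ (fun x => snd _) => apply: measurable_snd_comp
  | |- measurable_fun _ _ =>
      first [ assumption | exact: measurable_cst | exact: measurable_id
            | exact: measurable_fst | exact: measurable_snd ]
  end.

(** * Densities and second moments of the alternatives *)

Section planar.
Context {R : realType}.
Local Notation gam := (stdnormal R).
Local Open Scope ereal_scope.
Local Notation q := (Num.sqrt 2%:R : R)^-1%R.

Lemma invsqrt2_sqr : (q ^+ 2 = 1 / 2)%R.
Proof. by rewrite exprVn sqr_sqrtr// mul1r. Qed.

(* With [u = r x + c h], the pair [((u + g) / sqrt 2, (u - g) / sqrt 2)] has the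
   law of the argument of [H] on the left; only the law of [u] depends on [x]. *)
Lemma planar_density (c r tau x : R) (H : R * R -> \bar R) : (0 < c)%R ->
  (0 < tau)%R -> (tau ^+ 2 = (1 + c ^+ 2) / 2)%R ->
  measurable_fun setT H -> (forall z, 0 <= H z) ->
  \int[gam]_e \int[gam]_z H
    ((c ^+ 2 - 1) / (c ^+ 2 + 1) * (tau * z) + q * r * x + c / tau * e,
     tau * z + q * r * x)%R =
  \int[gam]_y \int[gam]_z (H (y, z) * (mehler c r (q * (y + z)) x)%:E).
Proof.
move=> c0 t0 t2 mH H0.
have c20 : (0 < c ^+ 2)%R by rewrite exprn_gt0.
have mHc d (T : measurableType d) (f : T -> R * R) : measurable_fun setT f ->
    measurable_fun setT (fun t => H (f t)) by move=> mf; exact: (measurable_comp_fun mH mf).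
move: q invsqrt2_sqr => k q2.
(* This angle turns the left side into a function of [k * (r * x + c * h + g)] and
   [k * (r * x + c * h - g)]. The next rotation, by 45 degrees, uses u and g as coordinates on the
   right, the density depending on u alone. *)
rewrite -(@stdnormal_rotation _ (c * k / tau) (k / tau) (fun p => H
    ((c ^+ 2 - 1) / (c ^+ 2 + 1) * (tau * p.2) + k * r * x + c / tau * p.1,
     tau * p.2 + k * r * x)%R)); first last.
- by [].
- by apply: mHc; mproj.
- rewrite !exprMn !exprVn t2 q2; field.
  by rewrite gt_eqF// addr_gt0.
rewrite -(@stdnormal_rotation _ k k (fun p => H p * (mehler c r (k * (p.1 + p.2)) x)%:E)); first last.
- by move=> p; rewrite mule_ge0// lee_fin mehler_ge0// ltW.
- apply: emeasurable_funM; first exact: mH.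
  by mproj.
- by rewrite q2; lra.
apply: eq_integral => g _ /=.
transitivity (\int[gam]_h H (k * (r * x + c * h + g), k * (r * x + c * h - g))%R).
  apply: eq_integral => h _; congr (H (_, _)).
    rewrite (_ : tau * (- (k / tau) * g + c * k / tau * h) = k * (c * h - g))%R; last first.
      by field; rewrite gt_eqF.
    rewrite (_ : c / tau * (c * k / tau * g + k / tau * h) = c * k * (c * g + h) / (tau ^+ 2))%R; last first.
      by field; rewrite gt_eqF.
    rewrite t2; field.
    by rewrite gt_eqF// addr_gt0.
  by field; rewrite gt_eqF.
rewrite (@stdnormal_mehler _ c r x (fun h => H (k * (h + g), k * (h - g))%R));
  [|exact: c0|by apply: mHc; mproj|by []].
apply: eq_integral => h _; congr (H (_, _) * (mehler _ _ _ _)%:E).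
- by ring.
- by ring.
rewrite (_ : k * (k * g + k * h + (- k * g + k * h)) = k ^+ 2 * (2 * h))%R; last by ring.
by rewrite q2; field.
Qed.

(** Half-sum and half-difference of two unit vectors are orthogonal, so the two forms are the sum
    and difference of independent normal variables of variances (1 + rho) / 2 and (1 - rho) / 2, the
    setting of [mehler_second_moment]. *)
Lemma direction_second_moment n (c r : R) (v w : 'I_n -> R) : (0 < c)%R ->
  (c ^+ 2 + r ^+ 2 = 1)%R -> (\sum_i v i ^+ 2 = 1)%R -> (\sum_i w i ^+ 2 = 1)%R ->
  \int[iid_power gam n]_t \int[gam]_u
    (mehler c r u (\sum_i v i * tnth t i) * mehler c r u (\sum_i w i * tnth t i))%:E =
  ((1 - r ^+ 2 * \sum_i v i * w i)^-1)%:E.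
Proof.
move=> c0 cr v1 w1.
have [Phi PhiE] : exists Phi : R * R -> \bar R, forall p, Phi p = \int[gam]_u
  (mehler c r u (p.1 + p.2) * mehler c r u (p.1 - p.2))%:E by eexists.
have M0 u y : (0 <= mehler c r u y)%R by apply: mehler_ge0; exact: ltW.
have mPhi : measurable_fun setT Phi.
  rewrite (funext PhiE); apply: measurable_integral_snd; first by mproj.
  by move=> p u; rewrite lee_fin mulr_ge0.
have Phi0 p : 0 <= Phi p by rewrite PhiE; apply: integral_ge0 => u _; rewrite lee_fin mulr_ge0.
have mPc d (T : measurableType d) (f : T -> R * R) : measurable_fun setT f ->
    measurable_fun setT (fun t => Phi (f t)) by move=> mf; exact: (measurable_comp_fun mPhi mf).
have [a [b [k [ha hab hbk hF]]]] := iid_normal_lin2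
  (fun i => (v i + w i) / 2)%R (fun i => (v i - w i) / 2)%R.
transitivity (\int[iid_power gam n]_t Phi (\sum_i (v i + w i) / 2 * tnth t i,
    \sum_i (v i - w i) / 2 * tnth t i)%R).
  apply: eq_integral => t _; rewrite PhiE; apply: eq_integral => u _ /=.
  congr (mehler _ _ _ _ * mehler _ _ _ _)%:E.
    by rewrite -big_split/=; apply: eq_bigr => i _; field.
  by rewrite -sumrB; apply: eq_bigr => i _; field.
rewrite hF; [|exact: mPhi|exact: Phi0].
set rho := (\sum_i v i * w i)%R.
have ha2 : (a ^+ 2 = (1 + rho) / 2)%R.
  rewrite ha (eq_bigr (fun i => 4^-1 * v i ^+ 2 + (2^-1 * (v i * w i) + 4^-1 * w i ^+ 2))%R); last first.
    by move=> i _; field.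
  by rewrite !big_split/= -!mulr_sumr v1 w1 -/rho; field.
have hbk2 : (b ^+ 2 + k ^+ 2 = (1 - rho) / 2)%R.
  rewrite hbk (eq_bigr (fun i => 4^-1 * v i ^+ 2 + (- 2^-1 * (v i * w i) + 4^-1 * w i ^+ 2))%R); last first.
    by move=> i _; field.
  by rewrite !big_split/= -!mulr_sumr v1 w1 -/rho; field.
have ab0 : (a * b = 0)%R.
  rewrite hab (eq_bigr (fun i => 4^-1 * v i ^+ 2 + - 4^-1 * w i ^+ 2)%R); last first.
    by move=> i _; field.
  by rewrite big_split/= -!mulr_sumr v1 w1; field.
pose m := Num.sqrt (b ^+ 2 + k ^+ 2).
have m2 : (m ^+ 2 = (1 - rho) / 2)%R.
  by rewrite /m sqr_sqrtr// addr_ge0 ?sqr_ge0.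
transitivity (\int[gam]_g \int[gam]_h Phi (a * g, m * h)%R).
  (* Orthogonality reads [a * b = 0]: either [b] vanishes, or [a] does and [v] is opposite to
     [w]. *)
  have [b0|b0] := eqVneq b 0%R.
    apply: eq_integral => g _.
    rewrite -(@stdnormal_conv _ b k (fun y => Phi ((a * g)%R, y)));
      [|by apply: mPc; mproj|by []].
    rewrite -[LHS](integral_prob_cst gam); apply: eq_integral => g' _.
    by apply: eq_integral => h _; rewrite b0 !mul0r !add0r.
  have a0 : (a = 0)%R by move/eqP: ab0; rewrite mulf_eq0 (negPf b0) orbF => /eqP.
  transitivity (\int[gam]_g \int[gam]_h Phi (0%R, b * g + k * h)%R).
    by apply: eq_integral => g _; apply: eq_integral => h _; rewrite a0 mul0r.
  rewrite (@stdnormal_conv _ b k (fun y => Phi (0%R, y))); [|by apply: mPc; mproj|by []].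
  rewrite -[LHS](integral_prob_cst gam); apply: eq_integral => g' _.
  by apply: eq_integral => h _; rewrite a0 mul0r.
rewrite ge0_integral_swap; [|by apply: mPc; mproj|by []].
rewrite (_ : (1 - r ^+ 2 * rho = 1 - r ^+ 2 * (a ^+ 2 - m ^+ 2))%R); last first.
  by rewrite ha2 m2; field.
rewrite -(@mehler_second_moment _ c r a m c0 cr); last by rewrite ha2 m2; field.
apply: eq_integral => h _; rewrite (eq_integral (fun g => \int[gam]_u (mehler c r u (a * g + m * h) *
  mehler c r u (a * g - m * h))%:E)); last by move=> g _; rewrite PhiE.
by rewrite ge0_integral_swap; [|mproj|move=> x y; rewrite lee_fin mulr_ge0].
Qed.

End planar.

Section densities.
Context {R : realType} {d : nat}.
Local Notation gam := (stdnormal R).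
Local Open Scope ereal_scope.
Local Notation q := (Num.sqrt 2%:R : R)^-1%R.
Implicit Types F : obs (R := R) d -> \bar R.

Lemma integral_std_obs_w F : measurable_fun setT F -> (forall o, 0 <= F o) ->
  \int[std_obs]_o F o =
  \int[iid_power gam d]_w \int[gam]_e \int[gam]_z F (e, (z, w)).
Proof.
move=> mF F0.
have mFc d' (T : measurableType d') (f : T -> obs (R := R) d) : measurable_fun setT f ->
    measurable_fun setT (fun t => F (f t)) by move=> mf; exact: (measurable_comp_fun mF mf).
rewrite integral_std_obs; [|exact: mF|exact: F0].
transitivity (\int[gam]_e \int[iid_power gam d]_w \int[gam]_z F (e, (z, w))).
  apply: eq_integral => e _; by rewrite ge0_integral_swap; [|apply: mFc; mproj|].
rewrite ge0_integral_swap; [by []| |by move=> x y; apply: integral_ge0].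
by apply: measurable_integral_snd => //; apply: mFc; mproj.
Qed.

Definition null_law (M1 : R) : probability (obs (R := R) d) R :=
  gen_law 0 M1 1 (fun=> 0%R) (fun=> 0%R).

Lemma integral_null_law (M1 : R) F : measurable_fun setT F -> (forall o, 0 <= F o) ->
  \int[null_law M1]_o F o =
  \int[iid_power gam d]_w \int[gam]_e \int[gam]_z F ((M1 * e)%R, (z, w)).
Proof.
move=> mF F0; rewrite [LHS]ge0_integral_image; [|exact: mF|exact: F0].
rewrite [LHS]integral_std_obs_w; [| |by move=> o; exact: F0]; last first.
  exact: (measurable_comp_fun mF (measurable_gen_obs _ _ _ _ _)).
apply: eq_integral => w _; apply: eq_integral => e _; apply: eq_integral => z _.
congr F; rewrite /gen_obs /gen_Z /=.
rewrite big1; last by move=> j _; rewrite mul0r.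
by rewrite mul0r mul1r !add0r addr0.
Qed.

(** Lowering the noise to [M1 * c] compensates the slope: when [c ^+ 2 + r ^+ 2 = 1], [y / M1] stays
    standard normal. Given Z its law is N(r Z, c ^+ 2), whose density is the Mehler kernel. *)
Lemma slope_density (M1 c r : R) F : (M1 != 0)%R -> (0 < c)%R ->
  measurable_fun setT F -> (forall o, 0 <= F o) ->
  \int[gen_law (M1 * r) (M1 * c) 1 (fun=> 0%R) (fun=> 0%R)]_o F o =
  \int[null_law M1]_o (F o * (mehler c r (o.1 / M1) o.2.1)%:E).
Proof.
move=> M10 c0 mF F0.
have mFc d' (T : measurableType d') (f : T -> obs (R := R) d) : measurable_fun setT f ->
    measurable_fun setT (fun t => F (f t)) by move=> mf; exact: (measurable_comp_fun mF mf).
have M0 u y : 0 <= (mehler c r u y)%:E by rewrite lee_fin; apply: mehler_ge0; exact: ltW.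
rewrite [RHS]integral_null_law; first last.
- by move=> o; rewrite mule_ge0.
- by apply: emeasurable_funM => //; mproj.
rewrite [LHS]ge0_integral_image; [|exact: mF|exact: F0].
rewrite [LHS]integral_std_obs_w; [| |by move=> o; exact: F0]; last first.
  exact: (measurable_comp_fun mF (measurable_gen_obs _ _ _ _ _)).
apply: eq_integral => w _.
transitivity (\int[gam]_z \int[gam]_e F ((M1 * (r * z + c * e))%R, (z, w))).
  rewrite ge0_integral_swap; [| |by []]; last first.
    by apply: mFc; apply: (measurable_comp_fun (measurable_gen_obs _ _ _ _ _)); mproj.
  apply: eq_integral => z _; apply: eq_integral => e _.
  congr F; rewrite /gen_obs /gen_Z /=.
  rewrite big1; last by move=> j _; rewrite mul0r.
  by rewrite mul1r !addr0; congr (_, _); ring.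
rewrite [RHS]ge0_integral_swap; first last.
- by move=> x y; rewrite mule_ge0.
- by apply: emeasurable_funM; [apply: mFc; mproj|mproj].
apply: eq_integral => z _.
rewrite (@stdnormal_mehler _ c r z (fun e => F ((M1 * e)%R, (z, w))));
  [|exact: c0|by apply: mFc; mproj|by []].
by apply: eq_integral => e _ /=; rewrite [(M1 * e / M1)%R]mulrC mulKf.
Qed.

(** The parameters come from regressing y on (Z, W). Given W, both [y / M1] and Z have mean [q * r]
    times the inner product of [v] and W, variance [tau ^+ 2] and covariance [(c ^+ 2 - 1) / 2]. The
    ratio of the last two is the slope, and the residual deviation is [c / tau]. *)
Lemma direction_density (M1 c r tau : R) (v : 'I_d -> R) F : (M1 != 0)%R ->
  (0 < c)%R -> (0 < tau)%R -> (tau ^+ 2 = (1 + c ^+ 2) / 2)%R ->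
  measurable_fun setT F -> (forall o, 0 <= F o) ->
  \int[gen_law (M1 * ((c ^+ 2 - 1) / (c ^+ 2 + 1))) (M1 * (c / tau)) tau
    (fun j => q * r * v j)%R
    (fun j => M1 * (1 - (c ^+ 2 - 1) / (c ^+ 2 + 1)) * (q * r * v j))%R]_o F o =
  \int[null_law M1]_o (F o * (mehler c r (q * (o.1 / M1 + o.2.1))
    (\sum_j v j * tnth o.2.2 j))%:E).
Proof.
move=> M10 c0 t0 t2 mF F0; set b := ((c ^+ 2 - 1) / (c ^+ 2 + 1))%R.
have mFc d' (T : measurableType d') (f : T -> obs (R := R) d) : measurable_fun setT f ->
    measurable_fun setT (fun t => F (f t)) by move=> mf; exact: (measurable_comp_fun mF mf).
have M0 u y : 0 <= (mehler c r u y)%:E by rewrite lee_fin; apply: mehler_ge0; exact: ltW.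
rewrite [RHS]integral_null_law; first last.
- by move=> o; rewrite mule_ge0.
- by apply: emeasurable_funM => //; mproj.
rewrite [LHS]ge0_integral_image; [|exact: mF|exact: F0].
rewrite [LHS]integral_std_obs_w; [| |by move=> o; exact: F0]; last first.
  exact: (measurable_comp_fun mF (measurable_gen_obs _ _ _ _ _)).
apply: eq_integral => w _; set x := (\sum_j v j * tnth w j)%R.
transitivity (\int[gam]_y \int[gam]_z (F ((M1 * y)%R, (z, w)) *
    (mehler c r (q * (y + z)) x)%:E)); last first.
  apply: eq_integral => y _; apply: eq_integral => z _ /=.
  by rewrite [(M1 * y / M1)%R]mulrC mulKf.
rewrite -(@planar_density _ c r tau x (fun p => F ((M1 * p.1)%R, (p.2, w))));
  [|exact: c0|exact: t0|exact: t2|by apply: mFc; mproj|by []].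
apply: eq_integral => e _; apply: eq_integral => z _ /=.
congr F; rewrite /gen_obs /gen_Z /=.
have E1 : (\sum_j q * r * v j * tnth w j = q * r * x)%R.
  by rewrite /x mulr_sumr; apply: eq_bigr => j _; rewrite mulrA.
have E2 : (\sum_j M1 * (1 - b) * (q * r * v j) * tnth w j = M1 * (1 - b) * (q * r * x))%R.
  by rewrite -E1 mulr_sumr; apply: eq_bigr => j _; ring.
by rewrite E1 E2 -/b; congr (_, _); ring.
Qed.

Lemma slope_second_moment (M1 c r : R) : (M1 != 0)%R -> (0 < c)%R ->
  (c ^+ 2 + r ^+ 2 = 1)%R ->
  \int[null_law M1]_o (mehler c r (o.1 / M1) o.2.1 *
    mehler c r (o.1 / M1) o.2.1)%:E = ((1 - r ^+ 2)^-1)%:E.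
Proof.
move=> M10 c0 cr.
have M0 u y : (0 <= mehler c r u y)%R by apply: mehler_ge0; exact: ltW.
rewrite [LHS]integral_null_law; first last.
- by move=> o; rewrite lee_fin mulr_ge0.
- by mproj.
rewrite -[RHS](integral_prob_cst (iid_power gam d)); apply: eq_integral => w _.
rewrite (_ : 1 - r ^+ 2 = 1 - r ^+ 2 * (1 ^+ 2 - 0 ^+ 2))%R; last by ring.
rewrite -(@mehler_second_moment _ c r 1 0 c0 cr); last by ring.
rewrite -[LHS](integral_prob_cst gam); apply: eq_integral => h _.
apply: eq_integral => u _; apply: eq_integral => g _ /=.
by rewrite mul0r mul1r addr0 subr0 [(M1 * u / M1)%R]mulrC mulKf.
Qed.

Lemma direction_null_second_moment (M1 c r : R) (v w : 'I_d -> R) :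
  (M1 != 0)%R -> (0 < c)%R -> (c ^+ 2 + r ^+ 2 = 1)%R ->
  (\sum_i v i ^+ 2 = 1)%R -> (\sum_i w i ^+ 2 = 1)%R ->
  \int[null_law M1]_o
    (mehler c r (q * (o.1 / M1 + o.2.1)) (\sum_j v j * tnth o.2.2 j) *
     mehler c r (q * (o.1 / M1 + o.2.1)) (\sum_j w j * tnth o.2.2 j))%:E =
  ((1 - r ^+ 2 * \sum_i v i * w i)^-1)%:E.
Proof.
move=> M10 c0 cr v1 w1.
have M0 u y : (0 <= mehler c r u y)%R by apply: mehler_ge0; exact: ltW.
rewrite [LHS]integral_null_law; first last.
- by move=> o; rewrite lee_fin mulr_ge0.
- by mproj.
rewrite -(direction_second_moment c0 cr v1 w1); apply: eq_integral => t _.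
set x := (\sum_j v j * tnth t j)%R; set y := (\sum_j w j * tnth t j)%R.
have mP : measurable_fun setT (fun u : R => (mehler c r u x * mehler c r u y)%:E) by mproj.
transitivity (\int[gam]_e \int[gam]_z (mehler c r (q * e + q * z) x *
    mehler c r (q * e + q * z) y)%:E).
  apply: eq_integral => e _; apply: eq_integral => z _ /=.
  by rewrite [(M1 * e / M1)%R]mulrC mulKf// mulrDr.
rewrite (@stdnormal_conv _ q q (fun u => (mehler c r u x * mehler c r u y)%:E));
  [|exact: mP|by move=> u; rewrite lee_fin mulr_ge0].
apply: eq_integral => u _.
by rewrite invsqrt2_sqr (_ : 1 / 2 + 1 / 2 = 1)%R ?sqrtr1 ?mul1r//; field.
Qed.
End densities.

(** * Two lower bounds *)

Lemma le_of_sqr (R : realDomainType) (x y : R) : 0 <= y -> x ^+ 2 <= y ^+ 2 -> x <= y.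
Proof.
by move=> y0 h; rewrite leNgt; apply/negP => yx; move: h; rewrite leNgt => /negP; apply; nra.
Qed.

Lemma Bernoulli_ge (R : realFieldType) (x : R) n : 0 <= x <= 1 ->
  1 - n%:R * x <= (1 - x) ^+ n.
Proof.
move=> /andP[x0 x1]; elim: n => [|n IH]; first by rewrite mul0r subr0.
have [h|h] := lerP 0 (1 - n%:R * x); last first.
  apply: le_trans (exprn_ge0 _ _); last by lra.
  by rewrite -natr1; lra.
rewrite exprS; apply: le_trans (ler_wpM2l _ IH); last by lra.
rewrite -natr1; have : 0 <= n%:R * x * x by rewrite !mulr_ge0.
by lra.
Qed.

Lemma Theta_null (R : realType) d (M M1 M2 s : R) : 1 < M -> 0 < M1 -> 0 < M2 ->
  1 <= s ->
  Theta_sparse M M1 M2 s (gen_param (d := d) 0 M1 1 (fun=> 0) (fun=> 0)).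
Proof.
move=> hM hM1 hM2 hs; have z0 (f : 'I_d -> R) : (forall i, f i = 0) -> \sum_i f i ^+ 2 = 0.
  by move=> h; rewrite big1// => i _; rewrite h expr0n.
apply: Theta_gen => //; rewrite ?z0 ?expr1n ?addr0//.
- exact: sqr_ge0.
- by rewrite lexx ltW.
- by rewrite expr0n; exact: sqr_ge0.
- by rewrite big1 ?addn0// => j _; rewrite eqxx.
Qed.

Lemma slope_lower_bound (R : realType) (M M1 M2 alpha : R) : 1 < M -> 0 < M1 ->
  0 < M2 -> alpha < 1 / 4 ->
  exists2 k : R, 0 < k & forall (n d : nat) (s s1 : R), (0 < n)%N ->
    1 <= s1 -> s1 <= s ->
    ((k * (Num.sqrt n%:R)^-1)%:E <= minimax_diam n alpha
      (Theta_sparse (d := d) M M1 M2 s) (Theta_sparse M M1 M2 s1))%E.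
Proof.
move=> hM hM1 hM2 ha.
(* The bound 1/6 gives [(1 - r ^+ 2) ^+ n >= 1 - k ^+ 2 >= 16 / 17] by Bernoulli's inequality; the
   other one keeps the slope [M1 * r] below [M2]. *)
pose k := Num.min (1 / 6) (M2 / M1).
have k0 : 0 < k by rewrite /k lt_min !divr_gt0.
have k6 : k <= 1 / 6 by rewrite /k ge_min lexx.
have kM : M1 * k <= M2.
  by rewrite mulrC -ler_pdivlMr// /k ge_min lexx orbT.
exists (M1 * k / 4); first by rewrite divr_gt0// mulr_gt0.
move=> n d s s1 n0 hs1 hs.
have N0 : 0 < n%:R :> R by rewrite ltr0n.
have N1 : 1 <= n%:R :> R by rewrite ler1n.
have w0 : 0 < Num.sqrt (n%:R : R) by rewrite sqrtr_gt0.
have w2 : Num.sqrt (n%:R : R) ^+ 2 = n%:R by rewrite sqr_sqrtr// ler0n.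
pose r := k / Num.sqrt n%:R.
have r0 : 0 < r by rewrite divr_gt0.
have r2 : r ^+ 2 = k ^+ 2 / n%:R by rewrite /r expr_div_n w2.
have kk : k ^+ 2 <= 1 / 36 by move: k0 k6 => k0 k6; nra.
have nr2 : n%:R * r ^+ 2 = k ^+ 2 by rewrite r2 mulrC divfK// gt_eqF.
have rk : r <= k.
  rewrite /r ler_pdivrMr//; apply: ler_peMr; first exact: ltW.
  by apply: le_of_sqr; [exact: ltW|rewrite w2 expr1n].
have rr : r ^+ 2 <= 1 / 36 by apply: le_trans kk; move: r0 rk => r0 rk; nra.
pose c := Num.sqrt (1 - r ^+ 2).
have c1 : 0 < 1 - r ^+ 2 by lra.
have c0 : 0 < c by rewrite sqrtr_gt0.
have c2 : c ^+ 2 = 1 - r ^+ 2 by rewrite sqr_sqrtr// ltW.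
have cr : c ^+ 2 + r ^+ 2 = 1 by rewrite c2; ring.
rewrite (_ : M1 * k / 4 * _ = `|M1 * r| / 4); last first.
  rewrite ger0_norm; last by rewrite mulr_ge0// ltW.
  by rewrite /r; field; rewrite gt_eqF.
have M10 : M1 != 0 by rewrite gt_eqF.
apply: (@minimax_iid_ge _ n d alpha (M1 * r) _ _ (null_law M1)
  (gen_param 0 M1 1 (fun=> 0) (fun=> 0)) unit
  (fun=> gen_law (M1 * r) (M1 * c) 1 (fun=> 0) (fun=> 0))
  (fun=> gen_param (M1 * r) (M1 * c) 1 (fun=> 0) (fun=> 0))
  (fun=> fun o => mehler c r (o.1 / M1) o.2.1)
  (fun _ _ => (1 - r ^+ 2)^-1)).
- by [].
- by rewrite card_unit.
- by apply: Theta_null => //; lra.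
- exact: Theta_null.
- by [].
- by apply: obs_law_gen; exact: ltW.
- move=> _; have z0 (f : 'I_d -> R) : (forall i, f i = 0) -> \sum_i f i ^+ 2 = 0.
    by move=> h; rewrite big1// => i _; rewrite h expr0n.
  apply: Theta_gen => //; rewrite ?z0 ?expr1n ?addr0//.
  + exact: sqr_ge0.
  + apply/andP; split; first by rewrite mulr_ge0// ltW.
    rewrite ger_pMr//.
    by apply: le_of_sqr => //; rewrite c2 expr1n; have := sqr_ge0 r; lra.
  + have h : M1 * r <= M2 by apply: le_trans kM; rewrite ler_wpM2l// ltW.
    by move: h (mulr_gt0 hM1 r0) => h1 h2; nra.
  + by rewrite big1 ?addn0 => [|j _]; [lra|rewrite eqxx].
- by [].
- by move=> _; apply: obs_law_gen; rewrite mulr_ge0// ltW.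
- by move=> _; mproj.
- by move=> _ o; apply: mehler_ge0; exact: ltW.
- by move=> _ F mF F0; exact: slope_density.
- by move=> _ _; rewrite slope_second_moment.
rewrite !big_const !card_unit /= !addr0 expr1n mulr1 exprVn.
rewrite (_ : 17 / 16 = (16 / 17)^-1); last by field.
have h1 : 16 / 17 <= (1 - r ^+ 2) ^+ n.
  apply: le_trans (Bernoulli_ge _ _); first by rewrite nr2; lra.
  by rewrite sqr_ge0/=; lra.
by rewrite lef_pV2 ?posrE ?exprn_gt0//; lra.
Qed.

(** * Random directions with one nonzero entry per block *)

Section blocks.
Context {R : realType} {d k m : nat}.
Hypotheses (k0 : (0 < k)%N) (kmd : (k * m <= d)%N).

Lemma block_subproof (i : 'I_k) (a : 'I_m) : (i * m + a < d)%N.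
Proof.
apply: leq_trans kmd; apply: (@leq_trans (i.+1 * m)); last by rewrite leq_mul2r ltn_ord orbT.
by rewrite mulSn addnC ltn_add2r ltn_ord.
Qed.

Definition block (i : 'I_k) (a : 'I_m) : 'I_d := Ordinal (block_subproof i a).

Lemma block_eq i a i' a' : (block i a == block i' a') = (i == i') && (a == a').
Proof.
apply/eqP/andP => [|[/eqP-> /eqP->]]//.
move=> /(congr1 val) /= h; have m0 : (0 < m)%N by apply: leq_ltn_trans (ltn_ord a).
have h1 := congr1 (fun x => x %/ m)%N h; have h2 := congr1 (fun x => x %% m)%N h.
rewrite !divnMDl// !divn_small ?ltn_ord// !addn0 in h1.
rewrite !modnMDl !modn_small ?ltn_ord// in h2.
by split; apply/eqP; exact: val_inj.
Qed.

Lemma ord_neq_blocks (f : 'I_k -> 'I_m) :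
  (\sum_j ((\sum_i (j == block i (f i)))%N != 0) <= k)%N.
Proof.
apply: (@leq_trans (\sum_(j < d) \sum_(i < k) (j == block i (f i)))).
  by apply: leq_sum => j _; case: (\sum_i _)%N.
rewrite exchange_big /= -[leqRHS]card_ord -sum1_card; apply: leq_sum => i _.
by rewrite (bigD1 (block i (f i)))//= eqxx big1// => j /negPf ->.
Qed.

Definition unit_dir (f : {ffun 'I_k -> 'I_m}) (j : 'I_d) : R :=
  (Num.sqrt k%:R)^-1 * \sum_i (j == block i (f i))%:R.

Lemma unit_dir_dot f g : \sum_j unit_dir f j * unit_dir g j =
  k%:R^-1 * \sum_i (f i == g i)%:R.
Proof.
have kR : 0 < k%:R :> R by rewrite ltr0n.
rewrite /unit_dir.
transitivity (k%:R^-1 * \sum_j \sum_i \sum_i' ((j == block i (f i))%:R * (j == block i' (g i'))%:R) : R).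
  rewrite mulr_sumr; apply: eq_bigr => j _; rewrite mulrACA -invfM -expr2 sqr_sqrtr ?ler0n//.
  by rewrite mulr_suml; congr (_ * _); apply: eq_bigr => i _; rewrite mulr_sumr.
congr (_ * _); rewrite exchange_big /=; apply: eq_bigr => i _.
rewrite (bigD1 (block i (f i)))//= [X in _ + X]big1 ?addr0; last first.
  by move=> j /negPf ji; rewrite big1// => i' _; rewrite ji mul0r.
rewrite (bigD1 i)//= [X in _ + X]big1 ?addr0; last first.
  by move=> i' ii; rewrite [X in _ * (nat_of_bool X)%:R]block_eq [i == i']eq_sym (negPf ii) mulr0.
by rewrite eqxx mul1r block_eq eqxx.
Qed.

Lemma unit_dir_norm f : \sum_j unit_dir f j ^+ 2 = 1.
Proof.
under eq_bigr do rewrite expr2.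
rewrite unit_dir_dot; under eq_bigr do rewrite eqxx.
by rewrite sumr_const card_ord mulVf// gt_eqF// ltr0n.
Qed.

Lemma unit_dir_support f (x : R) :
  (\sum_j ((x * unit_dir f j)%R != 0%R) <= k)%N.
Proof.
apply: leq_trans (ord_neq_blocks f); apply: leq_sum => j _.
rewrite /unit_dir -natr_sum; case: eqP => // h; case: eqP => // h'.
by case: h; rewrite h' mulr0 mulr0.
Qed.

(* The number of agreements of two independent uniform functions is binomial. *)
Lemma sum_exp_agree (E : R) : 1 <= E ->
  \sum_(f : {ffun 'I_k -> 'I_m}) \sum_(g : {ffun 'I_k -> 'I_m})
    \prod_i (if f i == g i then E else 1) =
  (m%:R ^+ k) * (m%:R - 1 + E) ^+ k.
Proof.
move=> E1; under eq_bigr => f _.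
  rewrite -(bigA_distr_bigA (fun i a => if f i == a then E else 1)).
  under eq_bigr => i _.
    rewrite (bigD1 (f i))//= eqxx (eq_bigr (fun=> 1)); last first.
      by move=> a ha; rewrite eq_sym (negPf ha).
    rewrite sumr_const (_ : E + _ = m%:R - 1 + E); last first.
      rewrite addrC; congr (_ + E); rewrite cardC1 card_ord -subn1 natrB//.
      by apply: leq_ltn_trans (ltn_ord (f i)).
    over.
  rewrite prodr_const card_ord; over.
by rewrite sumr_const card_ffun !card_ord -natrX mulr_natl.
Qed.
End blocks.


Lemma invr_one_sub_le (R : realType) (x : R) : 0 <= x <= 1 / 2 ->
  (1 - x)^-1 <= expR (2 * x).
Proof.
move=> /andP[x0 x1]; rewrite -div1r ler_pdivrMr; last by lra.
have h := expR_ge1Dx (2 * x); apply: (@le_trans _ _ ((1 + 2 * x) * (1 - x))); first by nra.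
by rewrite ler_wpM2r//; lra.
Qed.

Lemma expR_sub1_le (R : realType) (x : R) : expR x - 1 <= x * expR x.
Proof.
have := expR_ge1Dx (- x); have e := expRxMexpNx_1 x; have := expR_gt0 x; nra.
Qed.

(* [t * expR (- (D * t) / 2)] is at most [2 / D]. *)
Lemma expR_gain_le (R : realType) (c0 D t : R) : 0 < D -> 0 <= c0 -> 0 <= t ->
  c0 <= D / 68 -> expR (expR (- D * t) * (expR (2 * c0 * t) - 1)) <= 17 / 16.
Proof.
move=> D0 c00 t0 hc.
set x := _ * (_ - 1).
have hx : x <= 1 / 17.
  apply: (@le_trans _ _ (expR (- D * t) * (2 * c0 * t * expR (2 * c0 * t)))).
    by rewrite ler_wpM2l ?expR_ge0//; exact: expR_sub1_le.
  rewrite mulrCA -expRD.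
  have h1 : - D * t + 2 * c0 * t <= - (D * t / 2) by nra.
  apply: (@le_trans _ _ (2 * c0 * t * expR (- (D * t / 2)))).
    by rewrite ler_wpM2l ?mulr_ge0// ler_expR.
  have h2 : D * t / 2 * expR (- (D * t / 2)) <= 1.
    rewrite expRN ler_pdivrMr ?expR_gt0// mul1r.
    by have := expR_ge1Dx (D * t / 2); lra.
  have h3 := expR_ge0 (- (D * t / 2)).
  have h4 : 0 <= t * expR (- (D * t / 2)) by rewrite mulr_ge0.
  move: h2 h4; rewrite (_ : D * t / 2 * _ = D / 2 * (t * expR (- (D * t / 2)))); last by ring.
  rewrite -[2 * c0 * t * _]mulrA; move: (t * _) => y h2 h4.
  by nra.
have := expR_ge1Dx (- x); have := expRxMexpNx_1 x; have := expR_gt0 x; nra.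
Qed.

(** The choice is floor(s / 2) blocks of floor(d / k) coordinates. [k <= s / 2] leaves room for the
    diagonal entry of the precision row, and the last inequality bounds [k / m], the mean number of
    agreements of two random directions. *)
Lemma block_sizes (R : realType) d (s P : R) : 2 <= s -> d.+1%:R = P ->
  s ^+ 2 <= P -> exists k m : nat, [/\ (0 < k)%N, (0 < m)%N, (k * m <= d)%N &
    [/\ k%:R <= s / 2, s / 4 <= k%:R & P * (k%:R / m%:R) <= s ^+ 2 :> R]].
Proof.
move=> s2 dP sP.
pose k := Num.truncn (s / 2).
have s20 : 0 <= s / 2 by lra.
have k0 : (0 < k)%N by rewrite truncn_gt0; lra.
have ks : k%:R <= s / 2 by rewrite -truncn_ge_nat.
have sk : s / 2 < k.+1%:R by rewrite -truncn_le_nat.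
clearbody k; have k1 : 1 <= k%:R :> R by rewrite ler1n.
have s4 : s / 4 <= k%:R by move: sk; rewrite -[k.+1%:R]natr1; lra.
have dR : d%:R + 1 = P by rewrite natr1.
have h6 : 2 * k%:R * (2 * k%:R) <= s ^+ 2 by nra.
have k2 : k%:R <= k%:R * k%:R :> R by rewrite ler_peMl// ler0n.
have kd : (k <= d)%N by rewrite -(ler_nat R); lra.
have m0 : (0 < d %/ k)%N by rewrite divn_gt0.
exists k, (d %/ k)%N; split => //; first by rewrite mulnC leq_trunc_div.
split => //; set m := (d %/ k)%N in m0 *.
have mR : 1 <= m%:R :> R by rewrite ler1n.
have dm : (d < m.+1 * k)%N by rewrite ltn_ceil.
have {dm} : P <= m.+1%:R * k%:R by rewrite -dP -natrM ler_nat.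
clearbody m; rewrite -[m.+1%:R]natr1 => dm.
have h : P <= 2 * m%:R * k%:R by nra.
rewrite mulrA ler_pdivrMr; last by lra.
have h5 : P * k%:R <= (2 * m%:R * k%:R) * k%:R by rewrite ler_wpM2r.
apply: (le_trans h5).
by nra.
Qed.

Lemma direction_lower_bound (R : realType) (M M1 M2 alpha D : R) : 1 < M ->
  0 < M1 -> 0 < M2 -> alpha < 1 / 4 -> 0 < D ->
  exists2 k : R, 0 < k & forall (n d : nat) (s s1 L : R), (0 < n)%N ->
    1 <= s1 -> s1 <= s -> 2 <= s -> 0 <= L -> d.+1%:R = expR L ->
    s ^+ 2 <= expR L * expR (- D * L) -> s * n%:R^-1 * L <= 1 / 4 ->
    ((k * (s * n%:R^-1 * L))%:E <= minimax_diam n alpha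
      (Theta_sparse (d := d) M M1 M2 s) (Theta_sparse M M1 M2 s1))%E.
Proof.
move=> hM hM1 hM2 ha hD.
have Mi1 : M^-1 < 1 by rewrite invf_lt1//; lra.
(* The four constraints serve, in order, [expR_gain_le], the smallness of [r], the spectrum of Sigma
   and the norm of the coefficients. *)
pose c0 := Num.min (Num.min (D / 68) 1) (Num.min ((1 - M^-1) ^+ 2) (M2 ^+ 2 / M1 ^+ 2)).
have c00 : 0 < c0.
  rewrite /c0 !lt_min ltr01 divr_gt0 ?exprn_gt0 ?divr_gt0 ?exprn_gt0//; lra.
have c0D : c0 <= D / 68 by rewrite /c0 !ge_min lexx.
have c01 : c0 <= 1 by rewrite /c0 !ge_min lexx ?orbT.
have c0M : c0 <= (1 - M^-1) ^+ 2 by rewrite /c0 !ge_min lexx ?orbT.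
have c0B : M1 ^+ 2 * c0 <= M2 ^+ 2.
  by rewrite mulrC -ler_pdivlMr ?exprn_gt0// /c0 !ge_min lexx ?orbT.
move: c0 c00 c0D c01 c0M c0B => c0 c00 c0D c01 c0M c0B.
exists (M1 * c0 / 32); first by rewrite divr_gt0// mulr_gt0.
move=> n d s s1 L n0 hs1 hs s2 L0 dL sL snL.
have N0 : 0 < n%:R :> R by rewrite ltr0n.
have eD : expR (- D * L) <= 1 by rewrite -expR0 ler_expR mulNr oppr_le0 mulr_ge0// ltW.
have eL := expR_gt0 L.
have sP : s ^+ 2 <= expR L by apply: (le_trans sL); rewrite ger_pMr.
have [k [m [k0 m0 kmd [ks sk km]]]] := block_sizes s2 dL sP.
have kR : 1 <= k%:R :> R by rewrite ler1n.
have mR : 1 <= m%:R :> R by rewrite ler1n.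
have {}km : k%:R / m%:R <= expR (- D * L).
  by rewrite -(ler_pM2l eL); apply: (le_trans km).
(* The share of one block: [r ^+ 2] times the inner product of two directions is [b2] times the
   number of their agreements. *)
have [b2 b2E] : exists b2, b2 = c0 * (n%:R^-1 * L) by eexists.
have nL0 : 0 <= n%:R^-1 * L by rewrite mulr_ge0// invr_ge0 ltW.
have b20 : 0 <= b2 by rewrite b2E mulr_ge0// ltW.
have kb2 : k%:R * b2 <= c0 / 8.
  move: snL; rewrite b2E -mulrA; move: (n%:R^-1 * L) nL0 => y y0 hy.
  have : k%:R * y <= s / 2 * y by rewrite ler_wpM2r.
  by move=> h; have : c0 * (k%:R * y) <= c0 * (1 / 8); [rewrite ler_wpM2l ?(ltW c00)//; lra|lra].
pose r := Num.sqrt (k%:R * b2).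
have r2 : r ^+ 2 = k%:R * b2 by rewrite sqr_sqrtr// mulr_ge0// ler0n.
clearbody r; have r20 : 0 <= r ^+ 2 by exact: sqr_ge0.
have r28 : r ^+ 2 <= c0 / 8 by rewrite r2.
pose c := Num.sqrt (1 - r ^+ 2).
have c1 : 0 < 1 - r ^+ 2 by lra.
have cp : 0 < c by rewrite sqrtr_gt0.
have c2 : c ^+ 2 = 1 - r ^+ 2 by rewrite sqr_sqrtr// ltW.
clearbody c; have cr : c ^+ 2 + r ^+ 2 = 1 by rewrite c2; ring.
pose tau := Num.sqrt ((1 + c ^+ 2) / 2).
have tp : 0 < tau by rewrite sqrtr_gt0 c2; lra.
have t2 : tau ^+ 2 = (1 + c ^+ 2) / 2 by rewrite sqr_sqrtr// c2; lra.
clearbody tau; have M10 : M1 != 0 by rewrite gt_eqF.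
pose b := (c ^+ 2 - 1) / (c ^+ 2 + 1).
pose y := r ^+ 2 / (2 - r ^+ 2).
have yr : y * (2 - r ^+ 2) = r ^+ 2 by rewrite /y divfK// gt_eqF//; lra.
have y0 : 0 <= y by rewrite /y divr_ge0//; lra.
have bE : b = - y.
  transitivity (- r ^+ 2 / (2 - r ^+ 2)); last by rewrite /y mulNr.
  by rewrite /b c2; congr (_ / _); [ring|lra].
clearbody y.
have yl : r ^+ 2 / 2 <= y by nra.
have yu : y <= r ^+ 2 by nra.
pose q := (Num.sqrt 2%:R : R)^-1.
have q2 : q ^+ 2 = 1 / 2 := invsqrt2_sqr.
pose v (f : {ffun 'I_k -> 'I_m}) := @unit_dir R d k m kmd f.
have v1 f : \sum_j v f j ^+ 2 = 1 by exact: unit_dir_norm.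
have eta2 f : \sum_j (q * r * v f j) ^+ 2 = r ^+ 2 / 2.
  under eq_bigr do rewrite exprMn.
  by rewrite -mulr_sumr v1 exprMn q2; ring.
pose th f := gen_param (d := d) (M1 * b) (M1 * (c / tau)) tau (fun j => q * r * v f j)
  (fun j => M1 * (1 - b) * (q * r * v f j)).
apply: (@le_trans _ _ (`|M1 * b| / 4)%:E).
  rewrite lee_fin bE mulrN normrN ger0_norm; last by rewrite mulr_ge0// ltW.
  have h : c0 * (s * n%:R^-1 * L) / 4 <= r ^+ 2.
    rewrite r2 b2E -[s * _ * L]mulrA; move: (n%:R^-1 * L) nL0 => z z0.
    have : s / 4 * z <= k%:R * z by rewrite ler_wpM2r.
    by move=> h; have : c0 * (s / 4 * z) <= c0 * (k%:R * z); [rewrite ler_wpM2l// ltW|lra].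
  move: h; move: (s * _ * L) => z h.
  have : M1 * (c0 * z / 8) <= M1 * y by rewrite ler_pM2l//; lra.
  by lra.
apply: (@minimax_iid_ge _ n d alpha (M1 * b) _ _ (null_law M1)
  (gen_param 0 M1 1 (fun=> 0) (fun=> 0)) {ffun 'I_k -> 'I_m}
  (fun f => gen_law (M1 * b) (M1 * (c / tau)) tau (fun j => q * r * v f j)
    (fun j => M1 * (1 - b) * (q * r * v f j))) th
  (fun f o => mehler c r (q * (o.1 / M1 + o.2.1)) (\sum_j v f j * tnth o.2.2 j))
  (fun f g => (1 - r ^+ 2 * \sum_i v f i * v g i)^-1)).
- exact: ha.
- by rewrite card_ffun !card_ord expn_gt0 m0.
- by apply: Theta_null => //; lra.
- exact: Theta_null.
- by [].
- by apply: obs_law_gen; exact: ltW.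
- move=> f; apply: Theta_gen => //.
  + by rewrite gt_eqF.
  + by rewrite eta2 t2 c2; field.
  + by rewrite eta2; lra.
  + apply/andP; split; first by rewrite mulr_ge0 ?divr_ge0// ltW.
    rewrite ger_pMr// ler_pdivrMr// mul1r.
    by apply: le_of_sqr; [exact: ltW|rewrite c2 t2 c2; lra].
  + under [X in _ + X]eq_bigr do rewrite exprMn.
    rewrite -mulr_sumr eta2 (_ : _ + _ =
      M1 ^+ 2 * (b ^+ 2 + (1 - b) ^+ 2 * (r ^+ 2 / 2))); last by ring.
    apply: le_trans c0B; rewrite ler_wpM2l ?sqr_ge0//.
    have bu : b ^+ 2 <= r ^+ 2 by rewrite bE sqrrN; nra.
    have bl : (1 - b) ^+ 2 <= 4 by rewrite bE opprK; nra.
    by nra.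
  + apply: le_trans (_ : (1 + k)%:R <= s); last by rewrite natrD; lra.
    by rewrite ler_nat leq_add2l; exact: unit_dir_support.
- by [].
- by move=> f; apply: obs_law_gen; rewrite mulr_ge0 ?divr_ge0// ltW.
- by move=> f; mproj.
- by move=> f o; apply: mehler_ge0; exact: ltW.
- by move=> f F mF F0; exact: direction_density.
- by move=> f g; rewrite (direction_null_second_moment M10 cp cr (v1 f) (v1 g)).
(* The cost of one agreement over the whole sample: [(1 - b2 * N)^-1 ^+ n <= expR (2 * n * b2 * N)],
   and [n * b2 = c0 * L]. *)
pose E := expR (2 * c0 * L).
have E1 : 1 <= E by rewrite -expR0 ler_expR !mulr_ge0// ltW.
have mterm f g : (1 - r ^+ 2 * \sum_i v f i * v g i)^-1 ^+ n <=
    \prod_(i < k) (if f i == g i then E else 1).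
  rewrite /v unit_dir_dot//; set N := \sum_i (f i == g i)%:R.
  rewrite (_ : r ^+ 2 * _ = b2 * N); last first.
    by rewrite r2; field; rewrite gt_eqF//; lra.
  have N00 : 0 <= N :> R by apply: sumr_ge0 => i _; exact: ler0n.
  have Nk : N <= k%:R :> R.
    rewrite /N -[X in _ <= X%:R]card_ord -sum1_card natr_sum; apply: ler_sum => i _.
    by case: eqP => _; rewrite ?ler01.
  have bN : b2 * N <= 1 / 2.
    have : b2 * N <= b2 * k%:R by rewrite ler_wpM2l.
    by move: kb2; rewrite mulrC; lra.
  apply: (@le_trans _ _ (expR (2 * (b2 * N)) ^+ n)).
    rewrite lerXn2r ?nnegrE ?expR_ge0 ?invr_ge0//; first by lra.
    by apply: invr_one_sub_le; rewrite mulr_ge0.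
  rewrite -expRM_natl.
  rewrite (_ : n%:R * (2 * (b2 * N)) = N * (2 * c0 * L)); last first.
    by rewrite b2E; field; rewrite gt_eqF.
  rewrite /N mulr_suml expR_sum le_eqVlt; apply/orP; left; apply/eqP.
  by apply: eq_bigr => i _; case: eqP => _; rewrite ?mul1r// mul0r expR0.
apply: le_trans (ler_sum _ (fun f _ => ler_sum _ (fun g _ => mterm f g))) _.
rewrite sum_exp_agree// card_ffun !card_ord natrX.
(* Each block agrees with probability [1 / m], so the mean of [E] to the number of agreements is
   [(1 + (E - 1) / m) ^+ k], at most [expR (k / m * (E - 1))] with [k / m <= expR (- D * L)]. *)
rewrite (_ : m%:R - 1 + E = m%:R * (1 + (E - 1) / m%:R)); last first.
  by field; rewrite gt_eqF//; lra.
rewrite exprMn mulrA -expr2 mulrC ler_wpM2r ?sqr_ge0//.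
apply: (@le_trans _ _ (expR ((E - 1) / m%:R) ^+ k)).
  rewrite lerXn2r ?nnegrE ?expR_ge0 ?expR_ge1Dx//.
  by rewrite addr_ge0// divr_ge0//; lra.
rewrite -expRM_natl; apply: le_trans (expR_gain_le hD (ltW c00) L0 c0D).
rewrite ler_expR mulrCA mulrC ler_wpM2r//.
by lra.
Qed.

(** * The matching bounds together *)

Theorem theorem5 (R : realType) (M M1 M2 c alpha : R)
    (p : nat -> nat) (s : nat -> R) (s1 : nat -> nat)
    (hM : 1 < M) (hM1 : 0 < M1) (hM2 : 0 < M2)
    (hc : c < 1 / 2) (halpha : 0 < alpha < 1 / 4) :
  same_order
    [set n : nat | [/\ (0 < n)%N,
      s n * n%:R^-1 * ln (p n)%:R <= 1 / 4,
      2 <= s n <= (p n)%:R `^ c,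
      (0 < s1 n)%N & (s1 n)%:R <= s n / 2]]
    (fun n => minimax_diam n alpha
      (Theta_sparse (d := (p n).-1) M M1 M2 (s n))
      (Theta_sparse (d := (p n).-1) M M1 M2 (s1 n)%:R))
    (fun n => n%:R `^ (- (1 / 2)) + s n * n%:R^-1 * ln (p n)%:R).
Proof.
have /andP[a0 a4] := halpha; have D0 : 0 < 1 - 2 * c by lra.
have [C C0 upper] := upper_bound hM hM1 hM2 a0.
have [k1 k10 slope] := slope_lower_bound hM hM1 hM2 a4.
have [k2 k20 direction] := direction_lower_bound hM hM1 hM2 a4 D0.
exists (Num.max C (k1^-1 + k2^-1)); first by rewrite lt_max C0.
move=> n /=; move: (p n) (s n) (s1 n) => {p s s1} p s s1 [n0 snL /andP[s2 sp] s10 s1s].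
(* A power of 0 is 0, or 1 when c = 0; both contradict [2 <= s]. *)
have p0 : (0 < p)%N.
  rewrite lt0n; apply/eqP => p0; move: sp; rewrite p0 /powR eqxx.
  by case: (c == 0) => /=; lra.
have pR : 0 < p%:R :> R by rewrite ltr0n.
set L := ln _ in snL *.
have pL : p%:R = expR L by rewrite lnK.
have pd : p.-1.+1 = p by rewrite prednK.
(* s^2 <= p^(2c), with p^(2c) written as p times p^(-(1 - 2c)): the gain over p is what the block
   construction consumes. *)
have sL : s ^+ 2 <= expR L * expR (- (1 - 2 * c) * L).
  have sc : s <= expR (c * L) by move: sp; rewrite /powR gt_eqF.
  rewrite -expRD (_ : L + _ = c * L + c * L); last by ring.
  by rewrite expRD expr2; apply: ler_pM => //; lra.
(* From 4 <= s^2 <= p and e <= 4. *)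
have L1 : 1 <= L.
  have L0 : 0 <= L by rewrite ln_ge0// ler1n.
  have h4 : 4 <= expR L.
    apply: le_trans (_ : expR L * expR (- (1 - 2 * c) * L) <= _); first by nra.
    by rewrite ger_pMr ?expR_gt0// -[leRHS]expR0 ler_expR mulNr oppr_le0 mulr_ge0// ltW.
  have e2 : expR 1 <= 4 :> R.
    have e0 : 0 < expR (2^-1 : R) := expR_gt0 _.
    have e1 : expR (2^-1 : R) <= 2.
      have := expR_ge1Dx (- 2^-1 : R); have := expRxMexpNx_1 (2^-1 : R); nra.
    by rewrite (_ : 1 = 2^-1 + 2^-1)%R ?expRD; [nra|lra].
  by rewrite -ler_expR; exact: le_trans e2 h4.
have N0 : 0 < n%:R :> R by rewrite ltr0n.
have sn : s * L <= n%:R / 4.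
  move: snL; rewrite mulrAC ler_pdivrMr//; lra.
(* 4 s log p <= n, with s >= 2 and log p >= 1. *)
have n8 : (8 <= n)%N by rewrite -(ler_nat R); nra.
have s0 : 0 <= s by lra.
have Ln : L <= n%:R by nra.
have dL : p.-1%:R <= expR L by rewrite -pL ler_nat leq_pred.
rewrite div1r powRN powR12_sqrt ?ler0n//.
set v := minimax_diam _ _ _ _.
have vu := upper n p.-1 s L (Theta_sparse M M1 M2 s1%:R) n8 L1 s0 Ln dL.
have s1R : 1 <= s1%:R :> R by rewrite ler1n.
have s1s' : s1%:R <= s by lra.
have v1 := slope n p.-1 s s1%:R n0 s1R s1s'.
have v2 : ((k2 * (s * n%:R^-1 * L))%:E <= v)%E.
  by apply: direction => //; [lra|rewrite pd].
(* The upper bound excludes [+oo] and the lower bounds exclude [-oo], so the minimax value is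
   real. *)
rewrite -/v in vu v1; move: v vu v1 v2 => [v| |] //.
rewrite !lee_fin; set x := (Num.sqrt _)^-1; set y := _ * L => vu v1 v2.
have x0 : 0 <= x by rewrite invr_ge0.
have y0 : 0 <= y by rewrite !mulr_ge0// ?invr_ge0 ?ltW//; lra.
have xv : x <= k1^-1 * v by rewrite ler_pdivlMl.
have yv : y <= k2^-1 * v by rewrite ler_pdivlMl.
have v0 : 0 <= v by apply: le_trans v1; rewrite mulr_ge0// ltW.
split; first by apply: (le_trans vu); rewrite ler_wpM2r ?addr_ge0// le_max lexx.
apply: (@le_trans _ _ ((k1^-1 + k2^-1) * v)).
  by rewrite mulrDl lerD.
by rewrite ler_wpM2r// le_max lexx orbT.
Qed.
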